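(* Let $A$ be an algebra over $A_0=\oplus_{s\in I}\mathbb{C}e_s$ with a fixed choice of types $\mathfrak{t}:I\to\{\pm1\}$, let $\varpi:A\to A$ be a typed anti-involution, and let $\{\!\!\{-,-\}\!\!\}$ be a $\varpi$-typed double bracket on $A$ which is quasi-Poisson. Let $\alpha\in\mathbb{N}^I$ be a typed dimension vector, $N=\sum_s\alpha_s$, with corresponding map $\theta$ on $\mathfrak{gl}_N$, $\theta(\xi)=\Theta\xi^T\Theta^T$. Then the antisymmetric biderivation $\{-,-\}_{\varpi,\theta}$ on $\mathrm{Rep}^{\varpi,\theta}(A,\alpha)$ uniquely determined by $$\{a_{ij},b_{kl}\}_{\varpi,\theta}=\tfrac12\{\!\!\{a,b\}\!\!\}_{kj,il}+\tfrac12\,\mathfrak{sgn}_\alpha(\theta(i),\theta(j))\,\{\!\!\{\varpi(a),b\}\!\!\}_{k\theta(i),\theta(j)l},\qquad a,b\in A,\ 1\le i,j,k,l\le N,$$ is a quasi-Poisson bracket for the action of $G:=\prod_{s\in I}G_s$. Furthermore, if $\Phi\in A^\times$ is a moment map for $\{\!\!\{-,-\}\!\!\}$, it can be chosen (up to $\Phi\mapsto c\Phi$ with $c\in A_0^\times$) to satisfy $\Phi\,\varpi(\Phi)=1$; then $\mathtt{X}(\Phi):\mathrm{Rep}^{\varpi,\theta}(A,\alpha)\to G$ is a moment map for $\{-,-\}_{\varpi,\theta}$.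
   Context: Algebras are finitely generated, associative, unital over $\mathbb{C}$; $\otimes=\otimes_{\mathbb{C}}$. $I=\{1,\dots,|I|\}$ is finite, $A_0=\oplus_{s\in I}\mathbb{C}e_s$ with $e_se_t=\delta_{st}e_s$, $\sum_se_s=1$. Double brackets. Write $d=d'\otimes d''\in A\otimes A$; $(d'\otimes d'')^\circ=d''\otimes d'$; $a\,d\,b=ad'\otimes d''b$; $a\ast d\ast b=d'b\otimes ad''$. A double bracket is a $\mathbb{C}$-bilinear map $\{\!\!\{-,-\}\!\!\}:A\times A\to A\otimes A$ with $\{\!\!\{a,b\}\!\!\}=-\{\!\!\{b,a\}\!\!\}^\circ$, $\{\!\!\{a,bc\}\!\!\}=\{\!\!\{a,b\}\!\!\}c+b\{\!\!\{a,c\}\!\!\}$, $\{\!\!\{bc,a\}\!\!\}=\{\!\!\{b,a\}\!\!\}\ast c+b\ast\{\!\!\{c,a\}\!\!\}$, and $\{\!\!\{e,a\}\!\!\}=0=\{\!\!\{a,e\}\!\!\}$ for $e\in A_0$. With $\{\!\!\{a,d\}\!\!\}_L=\{\!\!\{a,d'\}\!\!\}\otimes d''$ and $\tau_{(123)}(a_1\otimes a_2\otimes a_3)=a_3\otimes a_1\otimes a_2$, put $\{\!\!\{a,b,c\}\!\!\}=\{\!\!\{a,\{\!\!\{b,c\}\!\!\}\}\!\!\}_L+\tau_{(123)}\{\!\!\{b,\{\!\!\{c,a\}\!\!\}\}\!\!\}_L+\tau_{(123)}^2\{\!\!\{c,\{\!\!\{a,b\}\!\!\}\}\!\!\}_L$.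 It is quasi-Poisson if for all $a,b,c\in A$ $$\{\!\!\{a,b,c\}\!\!\}=\tfrac14\sum_{s\in I}\big(ce_sa\otimes e_sb\otimes e_s-ce_sa\otimes e_s\otimes be_s-ce_s\otimes ae_sb\otimes e_s+ce_s\otimes ae_s\otimes be_s-e_sa\otimes e_sb\otimes e_sc+e_sa\otimes e_s\otimes be_sc+e_s\otimes ae_sb\otimes e_sc-e_s\otimes ae_s\otimes be_sc\big).$$ A moment map is an invertible $\Phi=\sum_s\Phi_s$, $\Phi_s\in e_sAe_s$, with $\{\!\!\{\Phi_s,a\}\!\!\}=\frac12(ae_s\otimes\Phi_s-e_s\otimes\Phi_sa+a\Phi_s\otimes e_s-\Phi_s\otimes e_sa)$ for all $a\in A$, $s\in I$. Types. A choice of types assigns to each $s\in I$ a type $\mathrm{O}$ ($\mathfrak t(s)=+1$) or $\mathrm{Sp}$ ($\mathfrak t(s)=-1$). A typed anti-involution is a $\mathbb{C}$-linear anti-morphism $\varpi:A\to A$ with $\varpi(e_s)=e_s$ for all $s$ and $\varpi^2(a)=\mathfrak t(s)\mathfrak t(t)a$ for $a\in e_sAe_t$. The double bracket is $\varpi$-typed if $\varpi^{\otimes2}(\{\!\!\{a,b\}\!\!\})=\{\!\!\{\varpi(a),\varpi(b)\}\!\!\}^\circ$ for all $a,b$. A typed dimension vector is $\alpha\in\mathbb{N}^I$ with $\alpha_s$ even whenever $s$ has type $\mathrm{Sp}$. $G_s=\mathrm{O}(\alpha_s)$, $\Theta_s=\mathrm{Id}_{\alpha_s}$ if $s$ has type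 $\mathrm{O}$; $G_s=\mathrm{Sp}(\alpha_s)$, $\Theta_s=\Omega_{\alpha_s}$ if $s$ has type $\mathrm{Sp}$, where $\Omega_{2d}=\begin{pmatrix}0_d&\mathrm{Id}_d\\-\mathrm{Id}_d&0_d\end{pmatrix}$ and $\mathrm{Sp}(\alpha_s)$ preserves $\Omega_{\alpha_s}$; $\Theta=\mathrm{diag}(\Theta_1,\dots,\Theta_{|I|})$. Index notation. $\mathtt{R}_s=\{\alpha_1+\dots+\alpha_{s-1}+1,\dots,\alpha_1+\dots+\alpha_s\}$; $\iota(k)=s$ if $k\in\mathtt{R}_s$. If $\iota(k)$ has type $\mathrm{O}$: $\mathrm{sgn}_\alpha(k)=+1$, $\theta(k)=k$. If $s=\iota(k)$ has type $\mathrm{Sp}$: $\mathrm{sgn}_\alpha(k)=+1$ if $k-\sum_{t<s}\alpha_t\le\alpha_s/2$ and $-1$ otherwise, and $\theta(k)=k+\frac12\mathrm{sgn}_\alpha(k)\alpha_s$. $\mathfrak{sgn}_\alpha(i,j)=\mathfrak t(\iota(i))\,\mathrm{sgn}_\alpha(i)\,\mathfrak t(\iota(j))\,\mathrm{sgn}_\alpha(j)$. Representation spaces. $\mathbb{C}[\mathrm{Rep}(A,\alpha)]$ is the commutative algebra generated by $a_{ij}$ ($a\in A$, $1\le i,j\le N$), linear in $a$, with $(ab)_{ij}=\sum_ra_{ir}b_{rj}$ and $(e_s)_{ij}=\delta_{ij}$ if $i,j\in\mathtt{R}_s$, $0$ otherwise; $\mathtt{X}(a)=(a_{ij})$. $\mathrm{Rep}^{\varpi,\theta}(A,\alpha)=\{\rho\mid\rho\circ\varpi=\theta\circ\rho\}$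 is the closed subscheme cut out by the ideal generated by $\varpi(a)_{ij}-\mathfrak{sgn}_\alpha(i,j)\,a_{\theta(j),\theta(i)}$. Notation $(c\otimes d)_{kj,il}=c_{kj}d_{il}$. $G$, embedded block-diagonally in $\mathrm{GL}_N$, acts by $g\cdot\mathtt{X}(a)=g^{-1}\mathtt{X}(a)g$ on coordinate functions, with infinitesimal action $\xi_M(\mathtt{X}(a))=[\mathtt{X}(a),\xi]$. Quasi-Poisson conventions. Let $\mathfrak g=\mathrm{Lie}(G)\subset\mathfrak{gl}_N$, with trace form $\langle\xi,\eta\rangle=\mathrm{tr}(\xi\eta)$, basis $(F_a)$ and dual basis $(\check F_a)$. Put $\psi^{\mathfrak g}=\frac1{12}\sum_{a,b,c}\langle\check F_a,[\check F_b,\check F_c]\rangle F_a\wedge F_b\wedge F_c$, with $x_1\wedge x_2\wedge x_3=\sum_{\sigma\in S_3}\mathrm{sgn}(\sigma)x_{\sigma(1)}\otimes x_{\sigma(2)}\otimes x_{\sigma(3)}$, and let $\psi^{\mathfrak g}_M$ be the trivector field obtained from the infinitesimal action $\xi\mapsto\xi_M$, where $\xi_M(f)(x)=\frac{d}{dt}|_{t=0}f(\exp(-t\xi)\cdot x)$. A $G$-invariant antisymmetric biderivation $\{-,-\}$ on $M$ is quasi-Poisson if $\{f,\{g,h\}\}+\{g,\{h,f\}\}+\{h,\{f,g\}\}=\frac12\psi^{\mathfrak g}_M(f,g,h)$. A moment map is a $G$-equivariant morphism $\Xi:M\to G$ (adjoint action on $G$) with $\{\Xi^*\mathcal{H},-\}=\frac12\sum_a\Xi^*((F_a^L+F_a^R)(\mathcal{H}))\,(\check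 F_a)_M$ for all functions $\mathcal{H}$ on $G$, where $\xi^L(\mathcal{H})(g)=\frac{d}{dt}|_{0}\mathcal{H}(ge^{t\xi})$, $\xi^R(\mathcal{H})(g)=\frac{d}{dt}|_0\mathcal{H}(e^{t\xi}g)$. *)

(* Defs.v *)
From HB Require Import structures.
From mathcomp Require Import all_boot all_order all_fingroup all_algebra.
From mathcomp Require Import generic_quotient boolp reals.
From mathcomp Require Import complex.

Set Implicit Arguments.
Unset Strict Implicit.
Unset Printing Implicit Defensive.

Import GRing.Theory.
Local Open Scope ring_scope.
Local Open Scope quotient_scope.

Reserved Notation "u \ox v" (at level 40, left associativity).

(** [tensor U V] is the set of finite formal sums of pairs, modulo the
    congruence generated by bilinearity. *)
Section Tensor.
Variables (K : comNzRingType) (U V : lmodType K).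
Local Notation fsum := (seq (U * V)).

Inductive teq : fsum -> fsum -> Prop :=
| teq_refl s : teq s s
| teq_sym s t : teq s t -> teq t s
| teq_trans s t r : teq s t -> teq t r -> teq s r
| teq_cat s s' t t' : teq s s' -> teq t t' -> teq (s ++ t) (s' ++ t')
| teq_catC s t : teq (s ++ t) (t ++ s)
| teq_addl u u' v : teq [:: (u + u', v)] [:: (u, v); (u', v)]
| teq_addr u v v' : teq [:: (u, v + v')] [:: (u, v); (u, v')]
| teq_scale k u v : teq [:: (k *: u, v)] [:: (u, k *: v)]
| teq_0 v : teq [:: (0, v)] [::].

Definition teqb (s t : fsum) : bool := `[< teq s t >].

Lemma teqb_refl : reflexive teqb.
Proof. by move=> s; apply/asboolP/teq_refl. Qed.

Lemma teqb_sym : symmetric teqb.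
Proof. by move=> s t; apply/asboolP/asboolP => /teq_sym. Qed.

Lemma teqb_trans : transitive teqb.
Proof. by move=> t s r /asboolP st /asboolP tr; apply/asboolP/(teq_trans st). Qed.

Canonical teqb_equiv := EquivRel teqb teqb_refl teqb_sym teqb_trans.

Definition tensor := {eq_quot teqb}.
HB.instance Definition _ := Choice.on tensor.

Definition tpi (s : fsum) : tensor := \pi_{eq_quot teqb} s.
Definition trep (x : tensor) : fsum := repr (x : {eq_quot teqb}).

Lemma trepK x : tpi (trep x) = x.
Proof. exact: reprK. Qed.

Lemma tpiP s t : tpi s = tpi t <-> teq s t.
Proof.
by split=> [/eqmodP/asboolP //|st]; apply/eqmodP/asboolP.
Qed.

Lemma trep_pi s : teq (trep (tpi s)) s.
Proof. by apply/tpiP; rewrite trepK. Qed.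

Definition tadd x y := tpi (trep x ++ trep y).
Definition tscale k x := tpi [seq (k *: p.1, p.2) | p <- trep x].
Definition topp x := tscale (-1) x.

Lemma tadd_pi s t : tadd (tpi s) (tpi t) = tpi (s ++ t).
Proof. by apply/tpiP; apply: teq_cat; apply: trep_pi. Qed.

Lemma teq_map_scale k s t : teq s t ->
  teq [seq (k *: p.1, p.2) | p <- s] [seq (k *: p.1, p.2) | p <- t].
Proof.
elim=> {s t} [s|s t _ IH|s t r _ IH _ IH'|s s' t t' _ IH _ IH'|s t|u u' v|u v v'
  |l u v|v] /=; rewrite ?map_cat.
- exact: teq_refl.
- exact: teq_sym.
- exact: teq_trans IH'.
- exact: teq_cat.
- exact: teq_catC.
- by rewrite scalerDr; apply: teq_addl.
- exact: teq_addr.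
- by rewrite scalerA mulrC -scalerA; apply: teq_scale.
- by rewrite scaler0; apply: teq_0.
Qed.

Lemma tscale_pi k s : tscale k (tpi s) = tpi [seq (k *: p.1, p.2) | p <- s].
Proof. by apply/tpiP/teq_map_scale/trep_pi. Qed.

Lemma taddA : associative tadd.
Proof.
move=> x y z; rewrite -(trepK x) -(trepK y) -(trepK z).
by rewrite !tadd_pi catA.
Qed.

Lemma taddC : commutative tadd.
Proof. by move=> x y; apply/tpiP/teq_catC. Qed.

Lemma tadd0 : left_id (tpi [::]) tadd.
Proof. by move=> x; rewrite -(trepK x) tadd_pi. Qed.

Lemma tscaleDl x : {morph tscale^~ x : k l / k + l >-> tadd k l}.
Proof.
move=> k l; rewrite -(trepK x); elim: (trep x) => [|[u v] s IH] /=.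
  by rewrite !tscale_pi tadd_pi.
have E m : tscale m (tpi ((u, v) :: s)) =
    tadd (tpi [:: (m *: u, v)]) (tscale m (tpi s)).
  by rewrite !tscale_pi tadd_pi.
rewrite !E IH.
have -> : tpi [:: ((k + l) *: u, v)] =
    tadd (tpi [:: (k *: u, v)]) (tpi [:: (l *: u, v)]).
  by rewrite tadd_pi; apply/tpiP; rewrite scalerDl; apply: teq_addl.
by rewrite -!taddA; congr tadd; rewrite taddA [tadd (tpi _) (tscale k _)]taddC
  -taddA.
Qed.

Lemma tscale0 x : tscale 0 x = tpi [::].
Proof.
rewrite -(trepK x); elim: (trep x) => [|[u v] s IH]; first by rewrite tscale_pi.
rewrite tscale_pi /= -cat1s -tadd_pi -tscale_pi IH tadd_pi cats0.
by apply/tpiP; rewrite scale0r; apply: teq_0.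
Qed.

Lemma tscale1 : left_id 1 tscale.
Proof.
move=> x; rewrite -[RHS]trepK -{1}(trepK x) tscale_pi; congr tpi.
by rewrite -[RHS]map_id; apply: eq_map => -[u v] /=; rewrite scale1r.
Qed.

Lemma taddN : left_inverse (tpi [::]) topp tadd.
Proof. by move=> x; rewrite -{2}(tscale1 x) -tscaleDl addNr tscale0. Qed.

HB.instance Definition _ := GRing.isZmodule.Build tensor taddA taddC tadd0 taddN.

Lemma tscaleA k l x : tscale k (tscale l x) = tscale (k * l) x.
Proof.
rewrite -(trepK x) !tscale_pi -map_comp; congr tpi.
by apply: eq_map => -[u v] /=; rewrite scalerA.
Qed.

Lemma tscaleDr : right_distributive tscale +%R.
Proof.
move=> k x y; rewrite -(trepK x) -(trepK y).
by rewrite [_ + _]tadd_pi !tscale_pi map_cat [RHS]tadd_pi.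
Qed.

HB.instance Definition _ :=
  GRing.Zmodule_isLmodule.Build K tensor tscaleA tscale1 tscaleDr tscaleDl.

Definition tens (u : U) (v : V) : tensor := tpi [:: (u, v)].

(** The linear map out of [tensor U V] induced by [b]; meaningful when [b] is
    bilinear, see [tliftE]. *)
Definition tlift (W : lmodType K) (b : U -> V -> W) (x : tensor) : W :=
  \sum_(p <- trep x) b p.1 p.2.

Definition bilin (W : lmodType K) (b : U -> V -> W) :=
  (forall k u u' v, b (k *: u + u') v = k *: b u v + b u' v) /\
  (forall k u v v', b u (k *: v + v') = k *: b u v + b u v').

Lemma tlift_pi (W : lmodType K) (b : U -> V -> W) s : bilin b ->
  tlift b (tpi s) = \sum_(p <- s) b p.1 p.2.
Proof.
case=> bl br; suff H t r : teq t r ->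
    \sum_(p <- t) b p.1 p.2 = \sum_(p <- r) b p.1 p.2 by apply/H/trep_pi.
have b0 v : b 0 v = 0.
  by have := bl 1 0 0 v; rewrite !scale1r addr0 -[LHS]addr0 => /addrI.
have b0' u : b u 0 = 0.
  by have := br 1 u 0 0; rewrite !scale1r addr0 -[LHS]addr0 => /addrI.
elim=> {s t r} [s|s t _ IH|s t r _ IH _ IH'|s s' t t' _ IH _ IH'|s t|u u' v
  |u v v'|l u v|v]; rewrite ?big_cat ?big_cons ?big_nil /= ?addr0 ?b0 //.
- by rewrite IH.
- by rewrite IH IH'.
- by rewrite addrC.
- by rewrite -[u in LHS]scale1r bl scale1r.
- by rewrite -[v in LHS]scale1r br scale1r.
- by rewrite -[l *: u]addr0 -[l *: v]addr0 bl br b0 b0'.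
Qed.

Lemma tliftE (W : lmodType K) (b : U -> V -> W) u v : bilin b ->
  tlift b (tens u v) = b u v.
Proof. by move=> bb; rewrite tlift_pi // big_seq1. Qed.

End Tensor.

Notation "u \ox v" := (tens u v) : ring_scope.

(** [calg rel] is the commutative [K]-algebra generated by [X] subject to the
    relations [p = q] for [rel p q].  It may be the zero ring. *)
Inductive expr (K X : Type) : Type :=
| Cst of K
| Var of X
| Add of expr K X & expr K X
| Mul of expr K X & expr K X.
Arguments Cst {K X}.
Arguments Var {K X}.
Arguments Add {K X}.
Arguments Mul {K X}.

HB.instance Definition _ (K X : Type) := gen_eqMixin (expr K X).
HB.instance Definition _ (K X : Type) := gen_choiceMixin (expr K X).

Section Presented.
Variables (K : comNzRingType) (X : Type) (rel : expr K X -> expr K X -> Prop).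
Local Notation expr := (expr K X).

Inductive ceq : expr -> expr -> Prop :=
| ceq_rel p q : rel p q -> ceq p q
| ceq_refl p : ceq p p
| ceq_sym p q : ceq p q -> ceq q p
| ceq_trans p q r : ceq p q -> ceq q r -> ceq p r
| ceq_Add p p' q q' : ceq p p' -> ceq q q' -> ceq (Add p q) (Add p' q')
| ceq_Mul p p' q q' : ceq p p' -> ceq q q' -> ceq (Mul p q) (Mul p' q')
| ceq_addA p q r : ceq (Add p (Add q r)) (Add (Add p q) r)
| ceq_addC p q : ceq (Add p q) (Add q p)
| ceq_add0 p : ceq (Add (Cst 0) p) p
| ceq_addN p : ceq (Add (Mul (Cst (-1)) p) p) (Cst 0)
| ceq_mulA p q r : ceq (Mul p (Mul q r)) (Mul (Mul p q) r)
| ceq_mulC p q : ceq (Mul p q) (Mul q p)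
| ceq_mul1 p : ceq (Mul (Cst 1) p) p
| ceq_mulDl p q r : ceq (Mul (Add p q) r) (Add (Mul p r) (Mul q r))
| ceq_cstD k l : ceq (Cst (k + l)) (Add (Cst k) (Cst l))
| ceq_cstM k l : ceq (Cst (k * l)) (Mul (Cst k) (Cst l)).

Definition ceqb (p q : expr) : bool := `[< ceq p q >].

Lemma ceqb_refl : reflexive ceqb.
Proof. by move=> s; apply/asboolP/ceq_refl. Qed.

Lemma ceqb_sym : symmetric ceqb.
Proof. by move=> s t; apply/asboolP/asboolP => /ceq_sym. Qed.

Lemma ceqb_trans : transitive ceqb.
Proof. by move=> t s r /asboolP st /asboolP tr; apply/asboolP/(ceq_trans st). Qed.

Canonical ceqb_equiv := EquivRel ceqb ceqb_refl ceqb_sym ceqb_trans.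

Definition calg := {eq_quot ceqb}.
HB.instance Definition _ := Choice.on calg.

Definition cpi (p : expr) : calg := \pi_{eq_quot ceqb} p.
Definition crep (f : calg) : expr := repr (f : {eq_quot ceqb}).

Lemma crepK f : cpi (crep f) = f.
Proof. exact: reprK. Qed.

Lemma cpiP p q : cpi p = cpi q <-> ceq p q.
Proof. by split=> [/eqmodP/asboolP //|pq]; apply/eqmodP/asboolP. Qed.

Lemma crep_pi p : ceq (crep (cpi p)) p.
Proof. by apply/cpiP; rewrite crepK. Qed.

Definition ccst (k : K) : calg := cpi (Cst k).
Definition cgen (x : X) : calg := cpi (Var x).
Definition cadd f g := cpi (Add (crep f) (crep g)).
Definition cmul f g := cpi (Mul (crep f) (crep g)).
Definition copp f := cmul (ccst (-1)) f.
Definition cscale k f := cmul (ccst k) f.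

Lemma cadd_pi p q : cadd (cpi p) (cpi q) = cpi (Add p q).
Proof. by apply/cpiP; apply: ceq_Add; apply: crep_pi. Qed.

Lemma cmul_pi p q : cmul (cpi p) (cpi q) = cpi (Mul p q).
Proof. by apply/cpiP; apply: ceq_Mul; apply: crep_pi. Qed.

Lemma caddA : associative cadd.
Proof.
move=> f g h; rewrite -(crepK f) -(crepK g) -(crepK h) !cadd_pi.
exact/cpiP/ceq_addA.
Qed.

Lemma caddC : commutative cadd.
Proof. by move=> f g; apply/cpiP/ceq_addC. Qed.

Lemma cadd0 : left_id (ccst 0) cadd.
Proof. by move=> f; rewrite -(crepK f) cadd_pi; apply/cpiP/ceq_add0. Qed.

Lemma caddN : left_inverse (ccst 0) copp cadd.
Proof.
by move=> f; rewrite -(crepK f) /copp cmul_pi cadd_pi; apply/cpiP/ceq_addN.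
Qed.

HB.instance Definition _ := GRing.isZmodule.Build calg caddA caddC cadd0 caddN.

Lemma cmulA : associative cmul.
Proof.
move=> f g h; rewrite -(crepK f) -(crepK g) -(crepK h) !cmul_pi.
exact/cpiP/ceq_mulA.
Qed.

Lemma cmulC : commutative cmul.
Proof. by move=> f g; apply/cpiP/ceq_mulC. Qed.

Lemma cmul1 : left_id (ccst 1) cmul.
Proof. by move=> f; rewrite -(crepK f) cmul_pi; apply/cpiP/ceq_mul1. Qed.

Lemma cmulDl : left_distributive cmul +%R.
Proof.
move=> f g h; rewrite -(crepK f) -(crepK g) -(crepK h) [_ + _]cadd_pi !cmul_pi.
by rewrite [RHS]cadd_pi; apply/cpiP/ceq_mulDl.
Qed.

HB.instance Definition _ :=
  GRing.Zmodule_isComPzRing.Build calg cmulA cmulC cmul1 cmulDl.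

Lemma cstD k l : ccst (k + l) = ccst k + ccst l.
Proof. by rewrite [RHS]cadd_pi; apply/cpiP/ceq_cstD. Qed.

Lemma cstM k l : ccst (k * l) = ccst k * ccst l.
Proof. by rewrite [RHS]cmul_pi; apply/cpiP/ceq_cstM. Qed.

Lemma cscaleA k l f : cscale k (cscale l f) = cscale (k * l) f.
Proof. by rewrite /cscale cstM; apply: cmulA. Qed.

Lemma cscaleDr : right_distributive cscale +%R.
Proof. by move=> k f g; apply: mulrDr. Qed.

Lemma cscaleDl f : {morph cscale^~ f : k l / k + l}.
Proof. by move=> k l; rewrite /cscale cstD; apply: mulrDl. Qed.

HB.instance Definition _ :=
  GRing.Zmodule_isLmodule.Build K calg cscaleA cmul1 cscaleDr cscaleDl.

Lemma calg_scaleE k (f : calg) : k *: f = ccst k * f.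
Proof. by []. Qed.

End Presented.

Section Eval.
Variables (K X : Type) (S : pzSemiRingType) (io : K -> S) (v d : X -> S).

Fixpoint ceval (p : expr K X) : S :=
  match p with
  | Cst k => io k
  | Var x => v x
  | Add p q => ceval p + ceval q
  | Mul p q => ceval p * ceval q
  end.

Fixpoint cdeval (p : expr K X) : S :=
  match p with
  | Cst _ => 0
  | Var x => d x
  | Add p q => cdeval p + cdeval q
  | Mul p q => cdeval p * ceval q + ceval p * cdeval q
  end.

End Eval.

Section Maps.
Variables (K : comNzRingType) (X Y : Type).
Variables (rel : expr K X -> expr K X -> Prop).
Variables (rel' : expr K Y -> expr K Y -> Prop).
Local Notation O := (calg rel).
Local Notation O' := (calg rel').

(** [csubst v] is the algebra morphism sending [cgen x] to [v x], and [cderiv d]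
    the derivation sending [cgen x] to [d x].  They are computed on a
    representative; [csubst_pi] and [cderiv_pi] show that the choice is
    immaterial as soon as [v], resp. [d], respects the relations. *)
Definition csubst (v : X -> O') (f : O) : O' := ceval (@ccst _ _ rel') v (crep f).

Definition cderiv (d : X -> O) (f : O) : O :=
  cdeval (@ccst _ _ rel) (@cgen _ _ rel) d (crep f).

Lemma cpiE (p : expr K X) : cpi rel p = ceval (@ccst _ _ rel) (@cgen _ _ rel) p.
Proof.
elim: p => [k|x|p IHp q IHq|p IHp q IHq] //=.
  by rewrite -IHp -IHq [RHS]cadd_pi.
by rewrite -IHp -IHq [RHS]cmul_pi.
Qed.

Lemma csubst_pi (v : X -> O') :
  (forall p q, rel p q -> ceval (@ccst _ _ rel') v p = ceval (@ccst _ _ rel') v q) ->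
  forall p, csubst v (cpi rel p) = ceval (@ccst _ _ rel') v p.
Proof.
move=> vrel; suff H p q : ceq rel p q ->
    ceval (@ccst _ _ rel') v p = ceval (@ccst _ _ rel') v q.
  by move=> p; apply/H/crep_pi.
elim=> //= {p q}.
- by move=> p q r _ -> _ ->.
- by move=> p p' q q' _ -> _ ->.
- by move=> p p' q q' _ -> _ ->.
- by move=> p q r; rewrite addrA.
- by move=> p q; rewrite addrC.
- by move=> p; rewrite add0r.
- by move=> p; exact: addNr.
- by move=> p q r; rewrite mulrA.
- by move=> p q; rewrite mulrC.
- by move=> p; rewrite mul1r.
- by move=> p q r; rewrite mulrDl.
- by move=> k l; rewrite cstD.
- by move=> k l; rewrite cstM.
Qed.

Lemma cderiv_pi (d : X -> O) :
  (forall p q, rel p q -> cdeval (@ccst _ _ rel) (@cgen _ _ rel) d p =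
                          cdeval (@ccst _ _ rel) (@cgen _ _ rel) d q) ->
  forall p, cderiv d (cpi rel p) = cdeval (@ccst _ _ rel) (@cgen _ _ rel) d p.
Proof.
move=> drel; suff H p q : ceq rel p q ->
    cdeval (@ccst _ _ rel) (@cgen _ _ rel) d p =
    cdeval (@ccst _ _ rel) (@cgen _ _ rel) d q.
  by move=> p; apply/H/crep_pi.
have E r s : ceq rel r s -> ceval (@ccst _ _ rel) (@cgen _ _ rel) r =
    ceval (@ccst _ _ rel) (@cgen _ _ rel) s by rewrite -!cpiE => /cpiP.
elim=> //= {p q}.
- by move=> p q r _ -> _ ->.
- by move=> p p' q q' _ -> _ ->.
- by move=> p p' q q' /E-> -> /E-> ->.
- by move=> p q r; rewrite addrA.
- by move=> p q; rewrite addrC.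
- by move=> p; rewrite add0r.
- by move=> p; rewrite mul0r add0r; exact: addNr.
- by move=> p q r; rewrite mulrDr mulrDl !mulrA addrA.
- by move=> p q; rewrite addrC mulrC [X in _ + X]mulrC.
- by move=> p; rewrite mul0r add0r mul1r.
- by move=> p q r; rewrite !mulrDl addrACA.
- by rewrite addr0.
- by move=> k l; rewrite mul0r mulr0 addr0.
Qed.

End Maps.

Section DoubleBracket.
Variables (K : fieldType) (n : nat) (A : algType K) (e : 'I_n -> A).
Local Notation A2 := (tensor A A).
Local Notation A3 := (tensor A2 A).

Inductive generated (gs : seq A) : A -> Prop :=
| gen_mem a : a \in gs -> generated gs a
| gen_one : generated gs 1
| gen_lin k a b : generated gs a -> generated gs b -> generated gs (k *: a + b)
| gen_mul a b : generated gs a -> generated gs b -> generated gs (a * b).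

Definition finitely_generated := exists gs : seq A, forall a, generated gs a.

(** The image in [A] of the element [c] of [A_0 = K e_1 + ... + K e_n]. *)
Definition of_A0 (c : 'I_n -> K) : A := \sum_s c s *: e s.

Definition A0_algebra :=
  (forall s t, e s * e t = if s == t then e s else 0) /\ \sum_s e s = 1.

Definition tflip (d : A2) : A2 := tlift (fun d' d'' => d'' \ox d') d.
Definition outer (a : A) (d : A2) (b : A) : A2 :=
  tlift (fun d' d'' => (a * d') \ox (d'' * b)) d.
Definition inner (a : A) (d : A2) (b : A) : A2 :=
  tlift (fun d' d'' => (d' * b) \ox (a * d'')) d.
Definition tau123 (x : A3) : A3 :=
  tlift (fun d a3 => tlift (fun a1 a2 => a3 \ox a1 \ox a2) d) x.

Record is_double_bracket (db : A -> A -> A2) : Prop := IsDoubleBracket {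
  db_bilin : bilin db;
  db_antisym : forall a b, db a b = - tflip (db b a);
  db_leibr : forall a b c, db a (b * c) = outer 1 (db a b) c + outer b (db a c) 1;
  db_leibl : forall a b c, db (b * c) a = inner 1 (db b a) c + inner b (db c a) 1;
  db_A0l : forall c a, db (of_A0 c) a = 0;
  db_A0r : forall c a, db a (of_A0 c) = 0
}.

Definition dbL (db : A -> A -> A2) (a : A) (d : A2) : A3 :=
  tlift (fun d' d'' => db a d' \ox d'') d.

Definition triple_bracket (db : A -> A -> A2) (a b c : A) : A3 :=
  dbL db a (db b c) + tau123 (dbL db b (db c a))
  + tau123 (tau123 (dbL db c (db a b))).

Definition double_quasi_poisson (db : A -> A -> A2) := forall a b c,
  triple_bracket db a b c = 4^-1 *: \sum_s
    (   (c * e s * a) \ox (e s * b) \ox e s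
      - (c * e s * a) \ox e s \ox (b * e s)
      - (c * e s) \ox (a * e s * b) \ox e s
      + (c * e s) \ox (a * e s) \ox (b * e s)
      - (e s * a) \ox (e s * b) \ox (e s * c)
      + (e s * a) \ox e s \ox (b * e s * c)
      + e s \ox (a * e s * b) \ox (e s * c)
      - e s \ox (a * e s) \ox (b * e s * c)).

Definition double_moment_map (db : A -> A -> A2) (Phi : A) :=
  (exists Psi, Phi * Psi = 1 /\ Psi * Phi = 1) /\
  exists Phi_ : 'I_n -> A,
    [/\ Phi = \sum_s Phi_ s,
        forall s, Phi_ s = e s * Phi_ s * e s &
        forall s a, db (Phi_ s) a = 2^-1 *:
          (   (a * e s) \ox Phi_ s - e s \ox (Phi_ s * a)
            + (a * Phi_ s) \ox e s - Phi_ s \ox (e s * a))].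

End DoubleBracket.

Inductive gtype := tO | tSp.

Definition is_Sp (t : gtype) : bool := if t is tSp then true else false.

Section Types.
Variables (K : fieldType) (n : nat) (ty : 'I_n -> gtype).

Definition tsign (s : 'I_n) : K := if is_Sp (ty s) then -1 else 1.

Section AntiInvolution.
Variables (A : algType K) (e : 'I_n -> A) (w : A -> A).

Record typed_anti_involution : Prop := TypedAntiInvolution {
  tai_lin : forall k a b, w (k *: a + b) = k *: w a + w b;
  tai_mul : forall a b, w (a * b) = w b * w a;
  tai_idem : forall s, w (e s) = e s;
  tai_sq : forall s t a, a = e s * a * e t -> w (w a) = (tsign s * tsign t) *: a
}.

Definition typed_double_bracket (db : A -> A -> tensor A A) := forall a b,
  tlift (fun x y => w x \ox w y) (db a b) = tflip (db (w a) (w b)).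

End AntiInvolution.

Variable alpha : 'I_n -> nat.

Definition typed_dim := forall s, is_Sp (ty s) -> ~~ odd (alpha s).

Local Notation N := (\sum_s alpha s)%N.

(** ['I_N] is the disjoint union of the consecutive blocks [R_s]: the index
    [k] is the [blk_off k]-th element (counted from 0) of the block
    [blk k]. *)
Definition blk (k : 'I_N) : 'I_n := tagnat.sig1 k.
Definition blk_off (k : 'I_N) : nat := tagnat.sig2 k.

Definition blk_half (k : 'I_N) : nat := (alpha (blk k))./2.

Definition sgn_alpha (k : 'I_N) : K :=
  if is_Sp (ty (blk k)) && (blk_half k <= blk_off k)%N then -1 else 1.

(** For a typed dimension vector the index passed to [insubd] is always
    smaller than [N], so that the default value [k] is never used. *)
Definition theta (k : 'I_N) : 'I_N :=
  if is_Sp (ty (blk k)) then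
    insubd k (if (blk_off k < blk_half k)%N then k + blk_half k
              else k - blk_half k)%N
  else k.

Definition sgn2_alpha (i j : 'I_N) : K :=
  tsign (blk i) * sgn_alpha i * (tsign (blk j) * sgn_alpha j).

Definition Theta_ (S : pzRingType) (s : 'I_n) : 'M[S]_(alpha s) :=
  if is_Sp (ty s) then
    \matrix_(i, j) (((j == i + (alpha s)./2 :> nat)%N)%:R
                    - ((i == j + (alpha s)./2 :> nat)%N)%:R)
  else 1%:M.

Definition Theta (S : pzRingType) : 'M[S]_N := \mxdiag_s Theta_ S s.

(** The points of [G = prod_s G_s], embedded block-diagonally in [GL_N], over
    a commutative ring [S]. *)
Definition inG (S : comPzRingType) (g : 'M[S]_N) : Prop :=
  exists g_ : forall s, 'M[S]_(alpha s),
    g = \mxdiag_s g_ s /\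
    forall s, (g_ s)^T *m Theta_ S s *m g_ s = Theta_ S s.

Definition inLie (xi : 'M[K]_N) : Prop :=
  exists xi_ : forall s, 'M[K]_(alpha s),
    xi = \mxdiag_s xi_ s /\
    forall s, (xi_ s)^T *m Theta_ K s + Theta_ K s *m xi_ s = 0.

Definition dual_bases (d : nat) (F F' : d.-tuple 'M[K]_N) : Prop :=
  [/\ free F,
      forall xi, inLie xi <-> xi \in <<F>>%VS,
      forall a, inLie (tnth F' a) &
      forall a b, \tr (tnth F a *m tnth F' b) = (a == b)%:R].

Local Notation gexpr := (expr K ('I_N * 'I_N)).

Inductive group_rel : gexpr -> gexpr -> Prop :=
| group_diag i j : blk i != blk j -> group_rel (Var (i, j)) (Cst 0)
| group_form i j : group_rel
    (\big[Add/Cst 0]_p \big[Add/Cst 0]_q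
        Mul (Mul (Var (p, i)) (Cst (Theta K p q))) (Var (q, j)))
    (Cst (Theta K i j)).

Definition groupO := calg group_rel.

Definition Gcoord : 'M[groupO]_N := \matrix_(i, j) cgen group_rel (i, j).

(** [xi^L], resp. [xi^R], is the derivative of [H (g (1 + t xi))], resp.
    [H ((1 + t xi) g)], at [t = 0]. *)
Definition vfL (xi : 'M[K]_N) : groupO -> groupO :=
  cderiv (fun x => (Gcoord *m map_mx (ccst group_rel) xi) x.1 x.2).
Definition vfR (xi : 'M[K]_N) : groupO -> groupO :=
  cderiv (fun x => (map_mx (ccst group_rel) xi *m Gcoord) x.1 x.2).

Section Rep.
Variables (A : algType K) (e : 'I_n -> A) (w : A -> A).

Local Notation rexpr := (expr K (A * 'I_N * 'I_N)).

Inductive rep_rel : rexpr -> rexpr -> Prop :=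
| rep_lin k a b i j : rep_rel
    (Var (k *: a + b, i, j)) (Add (Mul (Cst k) (Var (a, i, j))) (Var (b, i, j)))
| rep_mul a b i j : rep_rel
    (Var (a * b, i, j))
    (\big[Add/Cst 0]_r Mul (Var (a, i, r)) (Var (b, r, j)))
| rep_idem s i j : rep_rel
    (Var (e s, i, j)) (Cst ((i == j) && (blk i == s))%:R)
| rep_inv a i j : rep_rel
    (Var (w a, i, j)) (Mul (Cst (sgn2_alpha i j)) (Var (a, theta j, theta i))).

(** The coordinate ring of [Rep^(w,theta)(A,alpha)]: the relations other than
    [rep_inv] present the coordinate ring of [Rep(A,alpha)].  In matrix form
    [rep_inv] reads [X (w a) = Theta^T *m (X a)^T *m Theta]; transposing
    [Theta] only changes the sign of the blocks joining an orthogonal and a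
    symplectic index, and yields a [G]-equivariantly isomorphic scheme. *)
Definition repO := calg rep_rel.

Definition rcoord (a : A) (i j : 'I_N) : repO := cgen rep_rel (a, i, j).
Definition Xmx (a : A) : 'M[repO]_N := \matrix_(i, j) rcoord a i j.

(** The entry [d_(ij,kl) = d'_(ij) d''_(kl)]. *)
Definition entry2 (d : tensor A A) (i j k l : 'I_N) : repO :=
  tlift (fun d' d'' => rcoord d' i j * rcoord d'' k l) d.

Local Notation constmx := (map_mx (ccst rep_rel)).

(** The action of [g] on functions, [g . X(a) = g^-1 X(a) g], and the
    infinitesimal action [xi_M (X(a)) = [X(a), xi]]. *)
Definition Gact (g : 'M[K]_N) : repO -> repO :=
  csubst (fun x : A * 'I_N * 'I_N => let: (a, i, j) := x in
    (constmx (invmx g) *m Xmx a *m constmx g) i j).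
Definition inf_act (xi : 'M[K]_N) : repO -> repO :=
  cderiv (fun x : A * 'I_N * 'I_N => let: (a, i, j) := x in
    (Xmx a *m constmx xi - constmx xi *m Xmx a) i j).

Record antisym_biderivation (br : repO -> repO -> repO) : Prop :=
  AntisymBiderivation {
  br_bilin : bilin br;
  br_antisym : forall f g, br f g = - br g f;
  br_leib : forall f g h, br f (g * h) = br f g * h + g * br f h
}.

Definition G_invariant (br : repO -> repO -> repO) := forall g, inG g ->
  forall f h, br (Gact g f) (Gact g h) = Gact g (br f h).

(** The trivector field [psi_M] attached to
    [psi = 1/12 sum <F'_a, [F'_b, F'_c]> F_a /\ F_b /\ F_c],
    evaluated on [f_1, f_2, f_3]. *)
Definition psiM (d : nat) (F F' : d.-tuple 'M[K]_N) (f1 f2 f3 : repO) : repO :=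
  12^-1 *: \sum_(a < d) \sum_(b < d) \sum_(c < d)
    \tr (tnth F' a *m (tnth F' b *m tnth F' c - tnth F' c *m tnth F' b)) *:
    \sum_(s : 'S_3) (-1) ^+ s *:
      \prod_(i < 3) inf_act (tnth [tuple tnth F a; tnth F b; tnth F c] (s i))
                           (tnth [tuple f1; f2; f3] i).

Definition quasi_poisson (br : repO -> repO -> repO) :=
  [/\ antisym_biderivation br,
      G_invariant br &
      forall d (F F' : d.-tuple 'M[K]_N), dual_bases F F' -> forall f g h,
        br f (br g h) + br g (br h f) + br h (br f g)
        = 2^-1 *: psiM F F' f g h].

(** A morphism [Xi : Rep^(w,theta)(A,alpha) -> G] is a point of [G] over
    [repO]; [comorphism Xi] is the induced map of coordinate rings. *)
Definition comorphism (Xi : 'M[repO]_N) : groupO -> repO :=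
  csubst (fun x => Xi x.1 x.2).

Definition moment_map (br : repO -> repO -> repO) (Xi : 'M[repO]_N) :=
  [/\ inG Xi,
      forall g, inG g -> map_mx (Gact g) Xi = constmx (invmx g) *m Xi *m constmx g &
      forall d (F F' : d.-tuple 'M[K]_N), dual_bases F F' -> forall H f,
        br (comorphism Xi H) f
        = 2^-1 *: \sum_(a < d)
            comorphism Xi (vfL (tnth F a) H + vfR (tnth F a) H)
            * inf_act (tnth F' a) f].

Definition bracket_formula (db : A -> A -> tensor A A)
  (br : repO -> repO -> repO) := forall a b i j k l,
  br (rcoord a i j) (rcoord b k l)
  = 2^-1 *: entry2 (db a b) k j i l
    + (2^-1 * sgn2_alpha (theta i) (theta j)) *:
        entry2 (db (w a) b) k (theta i) (theta j) l.

End Rep.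
End Types.

(* Main.v *)
(** Write the defining relation of the representation space as
    [X (w a) = tau (X a)], with [tau] the adjunction for [Theta].  The bracket
    of [tr (P X(a))] with [X(b)] is the average of Van den Bergh's bracket
    over [(a, P) |-> (w a, tau P)].  In the Jacobiator of three such traces the
    averages over the nested brackets regroup, because the double bracket is
    typed, into the triple brackets of [a] or [w a], [b] or [w b], and [c].
    The quasi-Poisson identity turns each of them into a trace of a product of
    block-diagonal parts of the commutators [[P, X(a)]], and their sum is the
    trace of a commutator product of the projections of these commutators to
    [Lie G], which is the Cartan trivector by the Casimir identity.  The same
    identity gives the moment map condition.

    For the normalization, the moment map equations of [Phi_s] and of
    [Phi_s w(Phi_s)] compute the double bracket of these two elements in two
    ways; comparing them gives
    [Phi_s w(Phi_s) Phi_s (x) e_s = Phi_s (x) Phi_s w(Phi_s)], so that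
    [Phi_s w(Phi_s)] is a multiple of [e_s]. *)

Require Import Defs.
From HB Require Import structures.
From mathcomp Require Import all_boot all_order all_fingroup all_algebra.
From mathcomp Require Import boolp classical_sets reals complex ring zify.

Set Implicit Arguments.
Unset Strict Implicit.
Unset Printing Implicit Defensive.

Import GRing.Theory.
Local Open Scope ring_scope.

(** * Derivations of presented algebras *)

(** The coordinate rings are given by generators and relations and need not be reduced, so nothing
    is tested at points with values in the field: maps are defined on generators and checked against
    the relations, and derivations are compared on generators. The matrix computations are done for
    an [S]-point of the representation space over an arbitrary commutative ring [S], of which the
    coordinate ring with its tautological point is an instance. Indices are carried by test matrices
    [P]: for elementary [P] the trace of [P *m X a] is an entry, and cyclicity of the trace replaces
    index manipulations. The obstacle is that neither [w] nor [tau] is an involution when both types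
    occur; their squares are conjugations by the signs of the types. The two conjugations cancel
    inside every bracket because the double bracket is linear over [A_0]. In the Jacobiator only two
    of the three arguments have to be averaged: the commutator of two elements of [Lie G] is in
    [Lie G], so its trace against the third does not see the projection of the third. The constant
    1/4 of the double identity is the product of the two halves in the other two projections. *)

Section PresentedAlgebra.
Variables (K : comNzRingType) (X : Type) (rel : expr K X -> expr K X -> Prop).

Lemma calg_ind (P : calg rel -> Prop) :
  (forall k, P (ccst rel k)) -> (forall x, P (cgen rel x)) ->
  (forall f g, P f -> P g -> P (f + g)) ->
  (forall f g, P f -> P g -> P (f * g)) -> forall f, P f.
Proof.
move=> Pc Pg PD PM f; rewrite -(crepK f).
elim: (crep f) => [k|x|p IHp q IHq|p IHp q IHq]; [exact: Pc|exact: Pg| |].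
- by rewrite -cadd_pi; apply: PD.
- by rewrite -cmul_pi; apply: PM.
Qed.

Fact ccst_zmod_morphism : zmod_morphism (ccst rel).
Proof.
move=> k l; rewrite cstD; congr (_ + _); rewrite -mulN1r cstM; exact: erefl.
Qed.
Fact ccst_monoid_morphism : monoid_morphism (ccst rel).
Proof. by split=> // k l; rewrite cstM. Qed.

HB.instance Definition _ :=
  GRing.isZmodMorphism.Build K (calg rel) (ccst rel) ccst_zmod_morphism.
HB.instance Definition _ :=
  GRing.isMonoidMorphism.Build K (calg rel) (ccst rel) ccst_monoid_morphism.

End PresentedAlgebra.

Section MorphismsDerivations.
Variables (K : comNzRingType) (X Y : Type).
Variables (rel : expr K X -> expr K X -> Prop).
Variables (rel' : expr K Y -> expr K Y -> Prop).
Local Notation O := (calg rel).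
Local Notation O' := (calg rel').

Record cmorph (phi : O -> O') : Prop := CMorph {
  cmorphC : forall k, phi (ccst rel k) = ccst rel' k;
  cmorphD : forall f g, phi (f + g) = phi f + phi g;
  cmorphM : forall f g, phi (f * g) = phi f * phi g }.

(** Derivations of [O] into [O'], seen as an [O]-module through [phi]. *)
Record cder (phi D : O -> O') : Prop := CDer {
  cderC : forall k, D (ccst rel k) = 0;
  cderD : forall f g, D (f + g) = D f + D g;
  cderM : forall f g, D (f * g) = D f * phi g + phi f * D g }.

Lemma cder_ext phi D D' : cder phi D -> cder phi D' ->
  (forall x, D (cgen rel x) = D' (cgen rel x)) -> D =1 D'.
Proof.
move=> [c1 d1 m1] [c2 d2 m2] E; elim/calg_ind => [k|x|f g IHf IHg|f g IHf IHg] //.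
- by rewrite c1 c2.
- by rewrite d1 d2 IHf IHg.
- by rewrite m1 m2 IHf IHg.
Qed.

Lemma cmorph0 phi : cmorph phi -> phi 0 = 0.
Proof. by case=> C _ _; apply: C. Qed.

Lemma cmorphN phi f : cmorph phi -> phi (- f) = - phi f.
Proof. by move=> m; apply/eqP; rewrite -addr_eq0 -(cmorphD m) addNr (cmorph0 m). Qed.

Lemma cmorph_sum phi (I : Type) (r : seq I) (P : pred I) F : cmorph phi ->
  phi (\sum_(i <- r | P i) F i) = \sum_(i <- r | P i) phi (F i).
Proof. by move=> m; apply: big_morph; [apply: cmorphD|apply: cmorph0]. Qed.

Lemma map_cmorphM phi m n p (A : 'M_(m, n)) (B : 'M_(n, p)) : cmorph phi ->
  map_mx phi (A *m B) = map_mx phi A *m map_mx phi B.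
Proof.
move=> m_phi; apply/matrixP=> i j; rewrite !mxE (cmorph_sum _ _ _ m_phi).
by apply: eq_bigr => q _; rewrite (cmorphM m_phi) !mxE.
Qed.

Lemma map_cmorph_cst phi m n (A : 'M[K]_(m, n)) : cmorph phi ->
  map_mx phi (map_mx (ccst rel) A) = map_mx (ccst rel') A.
Proof. by case=> C _ _; apply/matrixP=> i j; rewrite !mxE C. Qed.

Section Derivation.
Variables (phi D : O -> O') (dD : cder phi D).

Lemma cder0 : D 0 = 0.
Proof. exact: (cderC dD). Qed.

Lemma cder_sum (I : Type) (r : seq I) (P : pred I) F :
  D (\sum_(i <- r | P i) F i) = \sum_(i <- r | P i) D (F i).
Proof. by apply: big_morph; [apply: (cderD dD)|apply: cder0]. Qed.

Lemma cderN f : D (- f) = - D f.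
Proof. by apply/eqP; rewrite -addr_eq0 -(cderD dD) addNr cder0. Qed.

Lemma map_cderM m n p (A : 'M_(m, n)) (B : 'M_(n, p)) :
  map_mx D (A *m B) = map_mx D A *m map_mx phi B + map_mx phi A *m map_mx D B.
Proof.
apply/matrixP=> i j; rewrite !mxE cder_sum -big_split.
by apply: eq_bigr => q _; rewrite (cderM dD) !mxE.
Qed.

Lemma map_cder_cst m n (A : 'M[K]_(m, n)) :
  map_mx D (map_mx (ccst rel) A) = 0.
Proof. by apply/matrixP=> i j; rewrite !mxE (cderC dD). Qed.

Lemma cder_tr n (A : 'M_n) : D (\tr A) = \tr (map_mx D A).
Proof. by rewrite /mxtrace cder_sum; apply: eq_bigr => i _; rewrite mxE. Qed.

Lemma cder_lscale (h : O') : cder phi (fun f => h * D f).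
Proof.
split=> [k|f g|f g]; rewrite ?(cderC dD) ?(cderD dD) ?(cderM dD).
- by rewrite mulr0.
- by rewrite mulrDr.
- ring.
Qed.

Lemma cder_opp : cder phi (fun f => - D f).
Proof.
split=> [k|f g|f g]; rewrite ?(cderC dD) ?(cderD dD) ?(cderM dD).
- by rewrite oppr0.
- by rewrite opprD.
- ring.
Qed.

End Derivation.

Lemma cderZ phi D k f : cmorph phi -> cder phi D -> D (k *: f) = k *: D f.
Proof.
by move=> m [C _ M]; rewrite !calg_scaleE M C (cmorphC m) mul0r add0r.
Qed.

Lemma cder_add phi D D' : cder phi D -> cder phi D' ->
  cder phi (fun f => D f + D' f).
Proof.
move=> d d'; split=> [k|f g|f g]; rewrite ?(cderC d) ?(cderD d) ?(cderM d)
  ?(cderC d') ?(cderD d') ?(cderM d'); ring.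
Qed.

Lemma cder_zero phi : cder phi (fun=> 0).
Proof. by split=> *; ring. Qed.

Lemma cder_bigsum phi (I : Type) (r : seq I) (D : I -> O -> O') :
  (forall i, cder phi (D i)) -> cder phi (fun f => \sum_(i <- r) D i f).
Proof.
move=> dD; split=> [k|f g|f g].
- by rewrite big1 // => i _; rewrite (cderC (dD i)).
- by rewrite -big_split; apply: eq_bigr => i _; rewrite (cderD (dD i)).
- rewrite mulr_suml mulr_sumr -big_split.
  by apply: eq_bigr => i _; rewrite (cderM (dD i)).
Qed.

Section Csubst.
Variable v : X -> O'.
Hypothesis vrel : forall p q, rel p q ->
  ceval (@ccst _ _ rel') v p = ceval (@ccst _ _ rel') v q.

Lemma csubst_gen x : csubst v (cgen rel x) = v x.
Proof. exact: (csubst_pi vrel). Qed.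

Lemma csubst_cmorph : cmorph (csubst v : O -> O').
Proof.
split=> [k|f g|f g]; first exact: (csubst_pi vrel).
- rewrite -(crepK f) -(crepK g) [X in csubst _ X]cadd_pi.
  by rewrite !(csubst_pi vrel).
- rewrite -(crepK f) -(crepK g) [X in csubst _ X]cmul_pi.
  by rewrite !(csubst_pi vrel).
Qed.

End Csubst.

End MorphismsDerivations.

Section Derivations.
Variables (K : comNzRingType) (X Y : Type).
Variables (rel : expr K X -> expr K X -> Prop).
Variables (rel' : expr K Y -> expr K Y -> Prop).
Local Notation O := (calg rel).
Local Notation O' := (calg rel').
Local Notation cev := (cdeval (@ccst _ _ rel) (@cgen _ _ rel)).

Lemma cmorph_id : cmorph (@id O).
Proof. by []. Qed.

Lemma cder_comp (phi : O' -> O) D : cder id D -> cmorph phi ->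
  cder phi (D \o phi).
Proof.
move=> d m; split=> [k|f g|f g] /=.
- by rewrite (cmorphC m) (cderC d).
- by rewrite (cmorphD m) (cderD d).
- by rewrite (cmorphM m) (cderM d).
Qed.

Lemma cmorph_comp_der (phi : O -> O') D : cder id D -> cmorph phi ->
  cder phi (phi \o D).
Proof.
move=> d m; split=> [k|f g|f g] /=.
- by rewrite (cderC d) (cmorph0 m).
- by rewrite (cderD d) (cmorphD m).
- by rewrite (cderM d) (cmorphD m) !(cmorphM m).
Qed.

Lemma cder_comm (D D' : O -> O) : cder id D -> cder id D' ->
  cder id (fun f => D (D' f) - D' (D f)).
Proof.
move=> d d'; split=> [k|f g|f g].
- by rewrite (cderC d) (cderC d') (cder0 d) (cder0 d') subr0.
- by rewrite (cderD d) (cderD d') (cderD d) (cderD d'); ring.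
- by rewrite (cderM d) (cderM d') (cderD d) (cderD d') !(cderM d) !(cderM d'); ring.
Qed.

Lemma map_cder_conj D m n p q (U : 'M[K]_(m, n)) (Z : 'M[O]_(n, p)) (V : 'M[K]_(p, q)) :
  cder id D -> map_mx D (map_mx (ccst rel) U *m Z *m map_mx (ccst rel) V) =
  map_mx (ccst rel) U *m map_mx D Z *m map_mx (ccst rel) V.
Proof.
move=> d; have mid m' n' (Z' : 'M[O]_(m', n')) : map_mx id Z' = Z' by apply: map_mx_id.
by rewrite !(map_cderM d) !(map_cder_cst d) !mid mul0mx add0r mulmx0 addr0.
Qed.

Lemma cder_tr_cst D n (U : 'M[K]_n) (Z : 'M[O]_n) : cder id D ->
  D (\tr (map_mx (ccst rel) U *m Z)) = \tr (map_mx (ccst rel) U *m map_mx D Z).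
Proof.
move=> d; have mid m' n' (Z' : 'M[O]_(m', n')) : map_mx id Z' = Z' by apply: map_mx_id.
by rewrite (cder_tr d) (map_cderM d) (map_cder_cst d) !mid mul0mx add0r.
Qed.

Section Cderiv.
Variable d : X -> O.
Hypothesis drel : forall p q, rel p q -> cev d p = cev d q.

Lemma cderiv_gen x : cderiv d (cgen rel x) = d x.
Proof. exact: (cderiv_pi drel). Qed.

Lemma cderiv_cder : cder id (cderiv d : O -> O).
Proof.
split=> [k|f g|f g]; first exact: (cderiv_pi drel).
- rewrite -(crepK f) -(crepK g) [X in cderiv _ X]cadd_pi.
  by rewrite !(cderiv_pi drel).
- rewrite -(crepK f) -(crepK g) [X in cderiv _ X]cmul_pi.
  by rewrite !(cderiv_pi drel) /= -!cpiE.
Qed.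

End Cderiv.

Lemma cdevalD d1 d2 p : cev (fun x => d1 x + d2 x) p = cev d1 p + cev d2 p.
Proof.
elim: p => [k|x|p IHp q IHq|p IHp q IHq] //=; rewrite ?IHp ?IHq ?addr0 //; ring.
Qed.

Lemma cdevalM h d p : cev (fun x => h * d x) p = h * cev d p.
Proof.
elim: p => [k|x|p IHp q IHq|p IHp q IHq] //=; rewrite ?IHp ?IHq ?mulr0 //; ring.
Qed.

Lemma eq_cdeval d1 d2 p : d1 =1 d2 -> cev d1 p = cev d2 p.
Proof. by move=> E; elim: p => //= p -> q ->. Qed.

(** The extension is made one variable at a time: [E f y] extends [d2] in the first variable, and
    [br f] is the derivation with values [E f y] on generators. The relations are assumed for the
    second argument; antisymmetry carries them to the first. *)
Lemma biderivation_exists (d2 : X -> X -> O) :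
  (forall x y, d2 x y = - d2 y x) ->
  (forall x p q, rel p q -> cev (d2 x) p = cev (d2 x) q) ->
  exists br : O -> O -> O,
    [/\ forall f, cder id (br f), forall f g, br f g = - br g f &
        forall x y, br (cgen rel x) (cgen rel y) = d2 x y].
Proof.
move=> d2N d2rel; pose E f y := - cderiv (d2 y) f.
have dE y : cder id (E^~ y) by apply/cder_opp/cderiv_cder/d2rel.
have Egen x y : E (cgen rel x) y = d2 x y.
  by rewrite /E (cderiv_gen (d2rel y)) [RHS]d2N.
(* The [f] for which [E f] respects the relations include constants and generators and are closed
   under sums and products, because [cdeval] is linear in the values of the derivation. *)
have Erel f p q : rel p q -> cev (E f) p = cev (E f) q.
  move=> pq; elim/calg_ind: f => [k|x|f g IHf IHg|f g IHf IHg].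
  - have E0 r : cev (E (ccst rel k)) r = 0.
      rewrite (@eq_cdeval _ (fun x => 0 * E (ccst rel k) x)) ?cdevalM ?mul0r //.
      by move=> x; rewrite mul0r (cderC (dE x)).
    by rewrite !E0.
  - by rewrite !(eq_cdeval _ (Egen x)); apply: d2rel.
  - have ED y : E (f + g) y = E f y + E g y by apply: (cderD (dE y)).
    by rewrite !(eq_cdeval _ ED) !(cdevalD (E f) (E g)) IHf IHg.
  - have EM y : E (f * g) y = g * E f y + f * E g y.
      by rewrite (cderM (dE y)) [X in X + _]mulrC.
    by rewrite !(eq_cdeval _ EM) !(cdevalD (fun y => g * E f y)
      (fun y => f * E g y)) !(cdevalM g (E f)) !(cdevalM f (E g)) IHf IHg.
pose br f := cderiv (E f).
have br_r f : cder id (br f) by apply/cderiv_cder/Erel.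
have br_gen f y : br f (cgen rel y) = E f y by apply/cderiv_gen/Erel.
(* By construction [br] is a derivation in its second argument; in the first this is tested on
   generators, where [br] is [E]. *)
have br_l g : cder id (br^~ g).
  split=> [k|f f'|f f'].
  - apply: (cder_ext (br_r _) (cder_zero id) _ g) => y.
    by rewrite br_gen (cderC (dE y)).
  - apply: (cder_ext (br_r _) (cder_add (br_r _) (br_r _)) _ g) => y.
    by rewrite !br_gen (cderD (dE y)).
  - rewrite [X in X + _]mulrC.
    apply: (cder_ext (br_r _) (cder_add (cder_lscale (br_r _) _)
      (cder_lscale (br_r _) _)) _ g) => y.
    by rewrite !br_gen (cderM (dE y)) [X in X + _]mulrC.
exists br; split=> //; last by move=> x y; rewrite br_gen Egen.
move=> f g; apply: (cder_ext (br_l g) (cder_opp (br_r g)) _ f) => x.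
apply: (cder_ext (br_r _) (cder_opp (br_l _)) _ g) => y.
by rewrite !br_gen !Egen d2N.
Qed.

End Derivations.

(** * Linear maps out of tensor products *)
Section TensorMaps.
Variable K : comNzRingType.
Implicit Types U V W : lmodType K.

Definition islin U W (f : U -> W) :=
  forall k x y, f (k *: x + y) = k *: f x + f y.

Lemma islinD U W (f : U -> W) x y : islin f -> f (x + y) = f x + f y.
Proof. by move=> lf; rewrite -[x in LHS]scale1r lf scale1r. Qed.

Lemma islin0 U W (f : U -> W) : islin f -> f 0 = 0.
Proof. by move=> lf; apply: (addrI (f 0)); rewrite -islinD // !addr0. Qed.

Lemma islinZ U W (f : U -> W) k x : islin f -> f (k *: x) = k *: f x.
Proof. by move=> lf; rewrite -[k *: x]addr0 lf islin0 // addr0. Qed.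

Lemma islinN U W (f : U -> W) x : islin f -> f (- x) = - f x.
Proof. by move=> lf; rewrite -scaleN1r islinZ // scaleN1r. Qed.

Lemma islinB U W (f : U -> W) x y : islin f -> f (x - y) = f x - f y.
Proof. by move=> lf; rewrite islinD // islinN. Qed.

Lemma islin_sum U W (f : U -> W) (I : Type) (r : seq I) (P : pred I) F :
  islin f -> f (\sum_(i <- r | P i) F i) = \sum_(i <- r | P i) f (F i).
Proof.
by move=> lf; apply: big_morph => [x y|]; [apply: islinD|apply: islin0].
Qed.

Lemma islin_comp U V W (f : V -> W) (g : U -> V) :
  islin f -> islin g -> islin (fun x => f (g x)).
Proof. by move=> lf lg k x y; rewrite lg lf. Qed.

Lemma tens_bilin U V : bilin (@tens K U V).
Proof.
have tD (x y : seq (U * V)) : tpi (x ++ y) = tpi x + tpi y.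
  by rewrite -tadd_pi.
have tZ k u v : k *: (u \ox v) = (k *: u) \ox v.
  exact: (tscale_pi k [:: (u, v)]).
split=> [k u u' v|k u v v']; rewrite tZ -tD /tens; apply/tpiP.
  exact: teq_addl.
apply: (teq_trans (teq_addr _ _ _)).
exact: (teq_cat (teq_sym (teq_scale k u v)) (teq_refl [:: (u, v')])).
Qed.

Lemma tensDl U V (u u' : U) (v : V) : (u + u') \ox v = u \ox v + u' \ox v.
Proof. by rewrite -{1}[u]scale1r (tens_bilin U V).1 scale1r. Qed.
Lemma tensDr U V (u : U) (v v' : V) : u \ox (v + v') = u \ox v + u \ox v'.
Proof. by rewrite -{1}[v]scale1r (tens_bilin U V).2 scale1r. Qed.
Lemma tens0l U V (v : V) : (0 : U) \ox v = 0.
Proof. by apply: (addrI (0 \ox v)); rewrite -tensDl !addr0. Qed.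
Lemma tens0r U V (u : U) : u \ox (0 : V) = 0.
Proof. by apply: (addrI (u \ox 0)); rewrite -tensDr !addr0. Qed.
Lemma tensZl U V k (u : U) (v : V) : (k *: u) \ox v = k *: (u \ox v).
Proof. by rewrite -[k *: u]addr0 (tens_bilin U V).1 tens0l addr0. Qed.
Lemma tensZr U V k (u : U) (v : V) : u \ox (k *: v) = k *: (u \ox v).
Proof. by rewrite -[k *: v]addr0 (tens_bilin U V).2 tens0r addr0. Qed.

Lemma tensor_ind U V (P : tensor U V -> Prop) :
  P 0 -> (forall x y, P x -> P y -> P (x + y)) ->
  (forall u v, P (u \ox v)) -> forall x, P x.
Proof.
move=> P0 PD Pt x; rewrite -(trepK x); elim: (trep x) => [|[u v] s IH] //.
have -> : tpi ((u, v) :: s) = u \ox v + tpi s by rewrite [RHS]tadd_pi.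
exact: PD.
Qed.

Lemma tensor_ext U V W (f g : tensor U V -> W) : islin f -> islin g ->
  (forall u v, f (u \ox v) = g (u \ox v)) -> f =1 g.
Proof.
move=> lf lg E x; elim/tensor_ind: x => [|x y IHx IHy|u v]; last exact: E.
  by rewrite !islin0.
by rewrite !islinD // IHx IHy.
Qed.

Lemma tlift_islin U V W (b : U -> V -> W) : bilin b -> islin (tlift b).
Proof.
move=> bb k x y; have tD (s t : seq (U * V)) : tpi (s ++ t) = tpi s + tpi t.
  by rewrite -tadd_pi.
rewrite -(trepK x) -(trepK y).
have -> : k *: tpi (trep x) = tpi [seq (k *: p.1, p.2) | p <- trep x].
  exact: tscale_pi.
rewrite -tD !tlift_pi // big_cat /=.
congr (_ + _); rewrite big_map scaler_sumr; apply: eq_bigr => p _ /=.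
have b0 : b 0 p.2 = 0.
  apply: (addrI (b 0 p.2)); rewrite addr0.
  by have := bb.1 1 0 0 p.2; rewrite !scale1r addr0.
by rewrite -[k *: p.1]addr0 bb.1 b0 addr0.
Qed.

Lemma bilin_comp U V U' V' W (b : U -> V -> W) (f : U' -> U) (g : V' -> V) :
  bilin b -> islin f -> islin g -> bilin (fun u v => b (f u) (g v)).
Proof. by move=> [bl br] lf lg; split=> *; rewrite ?lf ?lg ?bl ?br. Qed.

End TensorMaps.

(** * Trace identities *)
Lemma sum_single (V : nmodType) (I : finType) (i : I) (F : I -> V) :
  (forall k, k != i -> F k = 0) -> \sum_k F k = F i.
Proof. by move=> F0; rewrite (bigD1 i) //= big1 ?addr0. Qed.

Section TraceForm.
Variables (S : comPzRingType) (n : nat).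

(** Entries are traces against elementary matrices with transposed indices; hence [delta_mx j i]
    accompanies the entry [(i, j)] throughout. *)
Lemma tr_mul_delta (A : 'M[S]_n) i j : \tr (A *m delta_mx i j) = A j i.
Proof.
rewrite /mxtrace (sum_single (i := j)) => [|k kj]; rewrite mxE.
  rewrite (sum_single (i := i)) => [|l li]; first by rewrite mxE !eqxx mulr1.
  by rewrite mxE (negPf li) mulr0.
by rewrite big1 // => l _; rewrite mxE (negPf kj) andbF mulr0.
Qed.

Lemma tr_mul_inj (A B : 'M[S]_n) :
  (forall C, \tr (A *m C) = \tr (B *m C)) -> A = B.
Proof.
by move=> E; apply/matrixP=> i j; have := E (delta_mx j i); rewrite !tr_mul_delta.
Qed.

(** Elementary matrices have entries in the base field, so this is how facts about the Lie algebra
    over the field pass to matrices over [S]. *)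
Lemma mx_lin_ext (f g : 'M[S]_n -> 'M[S]_n) :
  (forall z (Y Z : 'M[S]_n), f (z *: Y + Z) = z *: f Y + f Z) ->
  (forall z (Y Z : 'M[S]_n), g (z *: Y + Z) = z *: g Y + g Z) ->
  (forall i j, f (delta_mx i j) = g (delta_mx i j)) -> f =1 g.
Proof.
move=> fl gl fg Y.
have l0 (h : 'M[S]_n -> 'M[S]_n) :
    (forall z (Y Z : 'M[S]_n), h (z *: Y + Z) = z *: h Y + h Z) -> h 0 = 0.
  move=> hl; apply: (addrI (h 0)).
  by have := hl 1 0 0; rewrite !scale1r !addr0.
have lD (h : 'M[S]_n -> 'M[S]_n) :
    (forall z (Y Z : 'M[S]_n), h (z *: Y + Z) = z *: h Y + h Z) ->
    {morph h : Y Z / Y + Z}.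
  by move=> hl U V; rewrite -[U in LHS]scale1r hl scale1r.
rewrite (matrix_sum_delta Y).
rewrite !(big_morph f (lD f fl) (l0 f fl)) !(big_morph g (lD g gl) (l0 g gl)).
apply: eq_bigr => i _.
rewrite !(big_morph f (lD f fl) (l0 f fl)) !(big_morph g (lD g gl) (l0 g gl)).
apply: eq_bigr => j _.
have lZ (h : 'M[S]_n -> 'M[S]_n) z (U : 'M[S]_n) :
    (forall z (Y Z : 'M[S]_n), h (z *: Y + Z) = z *: h Y + h Z) ->
    h (z *: U) = z *: h U.
  by move=> hl; rewrite -[z *: U]addr0 hl l0 ?addr0.
by rewrite !lZ // fg.
Qed.

Lemma alt8 (t1 t2 t3 t4 t5 t6 t7 t8 : S) :
  t1 - t2 - (t3 - t4) - (t5 - t6 - (t7 - t8)) =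
  t1 - t2 - t3 + t4 - t5 + t6 + t7 - t8.
Proof. ring. Qed.

Lemma perm8 (t1 t2 t3 t4 t5 t6 t7 t8 : S) :
  t7 - t5 - t3 + t1 - t8 + t6 + t4 - t2 =
  t1 - t2 - t3 + t4 - t5 + t6 + t7 - t8.
Proof. ring. Qed.

Lemma tr_comm3 (Es Xa Xb Xc P Q R : 'M[S]_n) :
  \tr (Es *m (P *m Xa - Xa *m P) *m Es *m (Q *m Xb - Xb *m Q) *m Es
        *m (R *m Xc - Xc *m R)) =
    \tr (Es *m (P *m Xa) *m Es *m (Q *m Xb) *m Es *m (R *m Xc))
  - \tr (Es *m (P *m Xa) *m Es *m (Q *m Xb) *m Es *m (Xc *m R))
  - \tr (Es *m (P *m Xa) *m Es *m (Xb *m Q) *m Es *m (R *m Xc))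
  + \tr (Es *m (P *m Xa) *m Es *m (Xb *m Q) *m Es *m (Xc *m R))
  - \tr (Es *m (Xa *m P) *m Es *m (Q *m Xb) *m Es *m (R *m Xc))
  + \tr (Es *m (Xa *m P) *m Es *m (Q *m Xb) *m Es *m (Xc *m R))
  + \tr (Es *m (Xa *m P) *m Es *m (Xb *m Q) *m Es *m (R *m Xc))
  - \tr (Es *m (Xa *m P) *m Es *m (Xb *m Q) *m Es *m (Xc *m R)).
Proof.
have trB (U V : 'M[S]_n) : \tr (U - V) = \tr U - \tr V by rewrite raddfB.
have L1 (U V Y Z : 'M[S]_n) : \tr (Es *m (U - V) *m Es *m Y *m Es *m Z) =
    \tr (Es *m U *m Es *m Y *m Es *m Z) - \tr (Es *m V *m Es *m Y *m Es *m Z).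
  by rewrite mulmxBr !mulmxBl trB.
have L2 (U V Y Z : 'M[S]_n) : \tr (Es *m Y *m Es *m (U - V) *m Es *m Z) =
    \tr (Es *m Y *m Es *m U *m Es *m Z) - \tr (Es *m Y *m Es *m V *m Es *m Z).
  by rewrite mulmxBr !mulmxBl trB.
have L3 (U V Y Z : 'M[S]_n) : \tr (Es *m Y *m Es *m Z *m Es *m (U - V)) =
    \tr (Es *m Y *m Es *m Z *m Es *m U) - \tr (Es *m Y *m Es *m Z *m Es *m V).
  by rewrite mulmxBr trB.
move: (P *m Xa) (Xa *m P) (Q *m Xb) (Xb *m Q) (R *m Xc) (Xc *m R).
move=> a1 a2 b1 b2 c1 c2.
rewrite (L1 a1 a2) (L2 b1 b2 a1) (L2 b1 b2 a2) (L3 c1 c2 a1 b1) (L3 c1 c2 a1 b2).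
rewrite (L3 c1 c2 a2 b1) (L3 c1 c2 a2 b2); exact: alt8.
Qed.

(** The left side is what the eight terms of the quasi-Poisson identity become for one [s], in their
    order there, with [E], [A], [B], [C] the images of [e s], [a], [b], [c]. Cyclic rotation puts
    each term between the same three copies of [E], and the signs are those of a product of three
    commutators. *)
Lemma tr_comm3_rot (E A B C P Q R : 'M[S]_n) :
  \tr (C *m E *m A *m P *m (E *m B) *m Q *m E *m R)
  - \tr (C *m E *m A *m P *m E *m Q *m (B *m E) *m R)
  - \tr (C *m E *m P *m (A *m E *m B) *m Q *m E *m R)
  + \tr (C *m E *m P *m (A *m E) *m Q *m (B *m E) *m R)
  - \tr (E *m A *m P *m (E *m B) *m Q *m (E *m C) *m R)
  + \tr (E *m A *m P *m E *m Q *m (B *m E *m C) *m R)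
  + \tr (E *m P *m (A *m E *m B) *m Q *m (E *m C) *m R)
  - \tr (E *m P *m (A *m E) *m Q *m (B *m E *m C) *m R) =
  \tr (E *m (P *m A - A *m P) *m E *m (Q *m B - B *m Q) *m E *m (R *m C - C *m R)).
Proof.
rewrite tr_comm3.
have -> : \tr (C *m E *m A *m P *m (E *m B) *m Q *m E *m R) =
    \tr (E *m (A *m P) *m E *m (B *m Q) *m E *m (R *m C)).
  by rewrite -!mulmxA mxtrace_mulC !mulmxA.
have -> : \tr (C *m E *m A *m P *m E *m Q *m (B *m E) *m R) =
    \tr (E *m (A *m P) *m E *m (Q *m B) *m E *m (R *m C)).
  by rewrite -!mulmxA mxtrace_mulC !mulmxA.
have -> : \tr (C *m E *m P *m (A *m E *m B) *m Q *m E *m R) =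
    \tr (E *m (P *m A) *m E *m (B *m Q) *m E *m (R *m C)).
  by rewrite -!mulmxA mxtrace_mulC !mulmxA.
have -> : \tr (C *m E *m P *m (A *m E) *m Q *m (B *m E) *m R) =
    \tr (E *m (P *m A) *m E *m (Q *m B) *m E *m (R *m C)).
  by rewrite -!mulmxA mxtrace_mulC !mulmxA.
rewrite !mulmxA; exact: perm8.
Qed.

(** The four choices of a primed or unprimed factor come from the averages over two of the three
    arguments. *)
Lemma tr_expand (U U' V V' W : 'M[S]_n) :
  \tr (U *m V *m W) - \tr (U *m W *m V) +
  (\tr (U *m V' *m W) - \tr (U *m W *m V')) +
  (\tr (U' *m V *m W) - \tr (U' *m W *m V)) +
  (\tr (U' *m V' *m W) - \tr (U' *m W *m V')) =
  \tr ((U + U') *m (V + V') *m W) - \tr ((U + U') *m W *m (V + V')).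
Proof.
have E1 : (U + U') *m (V + V') *m W =
    U *m V *m W + U *m V' *m W + (U' *m V *m W + U' *m V' *m W).
  by rewrite mulmxDl !mulmxDr !mulmxDl.
have E2 : (U + U') *m W *m (V + V') =
    U *m W *m V + U *m W *m V' + (U' *m W *m V + U' *m W *m V').
  by rewrite [(U + U') *m W]mulmxDl mulmxDl !mulmxDr.
rewrite E1 E2 !mxtraceD.
move: (\tr _) (\tr _) (\tr _) (\tr _) (\tr _) (\tr _) (\tr _) (\tr _).
move=> t1 t2 t3 t4 t5 t6 t7 t8; ring.
Qed.

Lemma tr_mul_comm (x y z : 'M[S]_n) :
  \tr (x *m (y *m z - z *m y)) = \tr ((x *m y - y *m x) *m z).
Proof.
have trB (U V : 'M[S]_n) : \tr (U - V) = \tr U - \tr V by rewrite raddfB.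
rewrite mulmxBr mulmxBl !trB !mulmxA; congr (_ - _).
by rewrite mxtrace_mulC mulmxA.
Qed.

Lemma tr_comm_scale h (U V W : 'M[S]_n) :
  \tr ((h *: U *m (h *: V) - h *: V *m (h *: U)) *m W) =
  h * h * (\tr (U *m V *m W) - \tr (U *m W *m V)).
Proof.
have trB (Y Z : 'M[S]_n) : \tr (Y - Z) = \tr Y - \tr Z by rewrite raddfB.
have Zl (Y Z : 'M[S]_n) : \tr (h *: Y *m (h *: Z) *m W) = h * h * \tr (Y *m Z *m W).
  by rewrite -scalemxAr -!scalemxAl !mxtraceZ mulrA.
rewrite mulmxBl trB !Zl -mulrBr; congr (_ * (_ - _)).
by rewrite -mulmxA mxtrace_mulC.
Qed.

Lemma mxtraceN (U : 'M[S]_n) : \tr (- U) = - \tr U.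
Proof. by rewrite raddfN. Qed.

Lemma tr_comm_swap (L U V : 'M[S]_n) :
  \tr ((U *m L - L *m U) *m V) = \tr (L *m (V *m U - U *m V)).
Proof.
rewrite mulmxBl mulmxBr !(mxtraceD, mxtraceN) !mulmxA; congr (_ - _).
by rewrite -[in LHS]mulmxA [LHS]mxtrace_mulC.
Qed.

Lemma tr_comm_opp (L U V : 'M[S]_n) :
  \tr (L *m (U *m V - V *m U)) = - \tr ((L *m V - V *m L) *m U).
Proof. by rewrite -(opprB (V *m U)) mulmxN mxtraceN tr_mul_comm. Qed.

Lemma conj_entry (G G' Z : 'M[S]_n) i j :
  (G' *m Z *m G) i j = \tr (G *m delta_mx j i *m G' *m Z).
Proof.
by rewrite -(tr_mul_delta (G' *m Z *m G)) -!mulmxA mxtrace_mulC -!mulmxA mxtrace_mulC -!mulmxA.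
Qed.

(** The moment map equation for one [s], with [Ys] the corresponding block of [Y]: the four terms
    pair the anticommutator of [P] and [Y] with the commutator of [Q] and [B]. *)
Lemma tr_moment (E B P Q Y Ys : 'M[S]_n) : E *m Y = Ys -> Y *m E = Ys ->
  \tr (B *m E *m P *m Ys *m Q) - \tr (E *m P *m (Ys *m B) *m Q)
  + \tr (B *m Ys *m P *m E *m Q) - \tr (Ys *m P *m (E *m B) *m Q) =
  \tr (E *m (P *m Y + Y *m P) *m E *m (Q *m B - B *m Q)).
Proof.
move=> EY YE.
have -> : E *m (P *m Y + Y *m P) *m E = E *m P *m Ys + Ys *m P *m E.
  by rewrite mulmxDr mulmxDl -!mulmxA YE !mulmxA EY.
rewrite mulmxBr !mulmxDl !(mxtraceD, mxtraceN) opprD !mulmxA.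
have -> : \tr (B *m E *m P *m Ys *m Q) = \tr (E *m P *m Ys *m Q *m B).
  by rewrite -!mulmxA mxtrace_mulC !mulmxA.
have -> : \tr (B *m Ys *m P *m E *m Q) = \tr (Ys *m P *m E *m Q *m B).
  by rewrite -!mulmxA mxtrace_mulC !mulmxA.
move: (\tr _) (\tr _) (\tr _) (\tr _) => t1 t2 t3 t4; ring.
Qed.

(** The left side is the derivative of an entry of [Y] along the sum of the left and right invariant
    fields of [L]. *)
Lemma tr_comm_entry (L Y : 'M[S]_n) i j : (Y *m L + L *m Y) i j =
  \tr (L *m (delta_mx j i *m Y + Y *m delta_mx j i)).
Proof.
rewrite -(tr_mul_delta (Y *m L + L *m Y)) mulmxDl mulmxDr !mxtraceD !mulmxA.
by congr (_ + _); rewrite -mulmxA mxtrace_mulC.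
Qed.

Lemma tr_comm_cyc (x y z : 'M[S]_n) :
  \tr (x *m (y *m z - z *m y)) = \tr (y *m (z *m x - x *m z)).
Proof. by rewrite [RHS]tr_mul_comm mxtrace_mulC. Qed.

Lemma comm_leib (L U V : 'M[S]_n) :
  U *m V *m L - L *m (U *m V) = (U *m L - L *m U) *m V + U *m (V *m L - L *m V).
Proof. by rewrite mulmxBl mulmxBr !mulmxA [RHS]addrC addrA subrK. Qed.

(** Differentiating the form condition along [G *m x] shows that the left invariant field of a Lie
    algebra element is tangent to the group. *)
Lemma form_der_mull (Th G x : 'M[S]_n) : G^T *m Th *m G = Th ->
  x^T *m Th + Th *m x = 0 ->
  (G *m x)^T *m Th *m G + G^T *m Th *m (G *m x) = 0.
Proof.
move=> GG xx; rewrite trmx_mul.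
have -> : x^T *m G^T *m Th *m G = x^T *m (G^T *m Th *m G) by rewrite !mulmxA.
by rewrite [G^T *m Th *m (G *m x)]mulmxA GG.
Qed.

Lemma form_der_mulr (Th G x : 'M[S]_n) : x^T *m Th + Th *m x = 0 ->
  (x *m G)^T *m Th *m G + G^T *m Th *m (x *m G) = 0.
Proof.
move=> xx; rewrite trmx_mul.
have -> : G^T *m x^T *m Th *m G = G^T *m (x^T *m Th) *m G by rewrite !mulmxA.
have -> : G^T *m Th *m (x *m G) = G^T *m (Th *m x) *m G by rewrite !mulmxA.
by rewrite -mulmxDl -mulmxDr xx mulmx0 mul0mx.
Qed.

Lemma mulmx3E (U V W : 'M[S]_n) i j :
  (U^T *m V *m W) i j = \sum_p \sum_q U p i * V p q * W q j.
Proof.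
rewrite mxE exchange_big; apply: eq_bigr => q _; rewrite mxE mulr_suml.
by apply: eq_bigr => p _; rewrite mxE.
Qed.

Lemma lin4 (h x y z T : S) : x - y + z = h * h * T ->
  h * h * x - h * h * y + h * h * z = h * (h * (h * h * T)).
Proof.
move=> E; transitivity (h * h * (x - y + z)); first by ring.
by rewrite E; ring.
Qed.

End TraceForm.

Lemma map_delta (S S' : pzRingType) (f : {rmorphism S -> S'}) n (i j : 'I_n) :
  map_mx f (delta_mx i j) = delta_mx i j.
Proof. by apply/matrixP=> p q; rewrite !mxE rmorph_nat. Qed.

(** * Block matrices and the involution of [gl_N] *)
Section BlockDiagonal.
Variables (n : nat) (alpha : 'I_n -> nat).
Local Notation N := (\sum_s alpha s)%N.

Lemma mxdiag_Rank (V : nmodType) (B : forall s, 'M[V]_(alpha s)) s a b :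
  (\mxdiag_t B t) (tagnat.Rank s a) (tagnat.Rank s b) = B s a b.
Proof. by rewrite -[in RHS](submxblock_diag B s) [in RHS]mxE. Qed.

Lemma mxdiag_offdiag (V : nmodType) (B : forall s, 'M[V]_(alpha s)) (i j : 'I_N) :
  blk i != blk j -> (\mxdiag_t B t) i j = 0.
Proof. by move=> ij; rewrite mxE (negPf ij) mxE. Qed.

Lemma blk_eqP (i j : 'I_N) : blk i = blk j ->
  exists s a b, i = tagnat.Rank s a /\ j = tagnat.Rank s b.
Proof.
move=> E; exists (blk i), (tagnat.sig2 i), (cast_ord (congr1 alpha (esym E)) (tagnat.sig2 j)).
split; first by rewrite tagnat.sig2K.
apply/ord_inj.
by rewrite [LHS]tagnat.rect tagnat.RankEsum; congr addn; rewrite // E.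
Qed.

Lemma blk_Rank s (a : 'I_(alpha s)) : blk (tagnat.Rank s a) = s.
Proof. exact: tagnat.Rank1K. Qed.

Lemma blk_off_Rank s (a : 'I_(alpha s)) : blk_off (tagnat.Rank s a) = a.
Proof. by rewrite /blk_off tagnat.Rank2K. Qed.

Definition bdiag (V : nmodType) (M : 'M[V]_N) := forall i j, blk i != blk j -> M i j = 0.

Lemma bdiagP (V : nmodType) (M : 'M[V]_N) :
  bdiag M -> M = \mxdiag_s submxblock M s s.
Proof.
move=> bM; apply/matrixP => i j; have [/blk_eqP[s [a [b [-> ->]]]]|ij] := eqVneq (blk i) (blk j).
  by rewrite mxdiag_Rank mxE.
by rewrite bM // mxdiag_offdiag.
Qed.

Lemma mul_mxdiag (S : pzRingType) (B C : forall s, 'M[S]_(alpha s)) :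
  (\mxdiag_s B s) *m (\mxdiag_s C s) = \mxdiag_s (B s *m C s).
Proof.
rewrite {1}/mxdiag mul_mxblock_mxdiag; apply/eq_mxblock => i j.
by case: eqVneq => [->|_]; rewrite ?conform_mx_id ?mul0mx.
Qed.

Definition blockE (S : pzRingType) (s : 'I_n) : 'M[S]_N :=
  \matrix_(i, j) ((i == j) && (blk i == s))%:R.

Lemma mul_blockE (S : pzRingType) s (M : 'M[S]_N) i j :
  (blockE S s *m M) i j = (blk i == s)%:R * M i j.
Proof.
rewrite mxE (sum_single (i := i)) => [|k ki]; first by rewrite mxE eqxx.
by rewrite mxE eq_sym (negPf ki) mul0r.
Qed.

Lemma mulr_blockE (S : pzRingType) s (M : 'M[S]_N) i j :
  (M *m blockE S s) i j = M i j * (blk j == s)%:R.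
Proof.
rewrite mxE (sum_single (i := j)) => [|k ki]; first by rewrite mxE eqxx.
by rewrite mxE (negPf ki) mulr0.
Qed.

Lemma blockE_id (S : pzRingType) s : blockE S s *m blockE S s = blockE S s.
Proof.
apply/matrixP=> i j; rewrite mul_blockE !mxE -natrM mulnb.
by case: (blk i == s); rewrite ?andbT ?andbF.
Qed.

Definition bproj (S : pzRingType) (M : 'M[S]_N) : 'M[S]_N :=
  \sum_s blockE S s *m M *m blockE S s.

Lemma bprojE (S : pzRingType) (M : 'M[S]_N) i j :
  bproj M i j = if blk i == blk j then M i j else 0.
Proof.
rewrite summxE (sum_single (i := blk i)) => [|s si]; last first.
  by rewrite mulr_blockE mul_blockE [_ == s]eq_sym (negPf si) !mul0r.
rewrite mulr_blockE mul_blockE eqxx mul1r eq_sym.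
by case: eqP; rewrite ?mulr1 ?mulr0.
Qed.

Lemma bproj_bdiag (S : pzRingType) (M : 'M[S]_N) : bdiag (bproj M).
Proof. by move=> i j /negPf ij; rewrite bprojE ij. Qed.

Lemma bdiag_bproj (S : pzRingType) (M : 'M[S]_N) : bdiag M -> bproj M = M.
Proof.
by move=> bM; apply/matrixP=> i j; rewrite bprojE; case: ifPn => // /bM.
Qed.

Lemma tr_bproj (S : comPzRingType) (A B : 'M[S]_N) : bdiag A ->
  \tr (A *m bproj B) = \tr (A *m B).
Proof.
move=> bA; rewrite /mxtrace; apply: eq_bigr => i _; rewrite !mxE.
apply: eq_bigr => j _; rewrite bprojE eq_sym; case: ifPn => // /bA ->.
by rewrite !mul0r.
Qed.

Lemma tr_bproj_sym (S : comPzRingType) (Y Z : 'M[S]_N) :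
  \tr (Y *m bproj Z) = \tr (bproj Y *m Z).
Proof.
rewrite /mxtrace; apply: eq_bigr => i _; rewrite !mxE; apply: eq_bigr => j _.
by rewrite !bprojE eq_sym; case: ifP; rewrite ?mulr0 ?mul0r.
Qed.

Lemma bproj_islin (S : comPzRingType) k (A B : 'M[S]_N) :
  bproj (k *: A + B) = k *: bproj A + bproj B.
Proof.
apply/matrixP=> i j; rewrite !mxE !bprojE !mxE; case: ifP => // _.
by rewrite mulr0 addr0.
Qed.

Lemma bprojN (S : comPzRingType) (A : 'M[S]_N) : bproj (- A) = - bproj A.
Proof.
by apply/matrixP=> i j; rewrite [RHS]mxE !bprojE mxE; case: ifP; rewrite ?oppr0.
Qed.

Lemma bdiag_mul (S : pzRingType) (A B : 'M[S]_N) :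
  bdiag A -> bdiag B -> bdiag (A *m B).
Proof.
move=> bA bB i j ij; rewrite mxE big1 // => k _.
have [ik|/bA->] := eqVneq (blk i) (blk k); last by rewrite mul0r.
by rewrite bB ?mulr0 -?ik.
Qed.

Lemma bdiag_scaleB (S : pzRingType) (h : S) (A B : 'M[S]_N) :
  bdiag A -> bdiag B -> bdiag (h *: (A - B)).
Proof. by move=> bA bB i j ij; rewrite !mxE bA // bB // subrr mulr0. Qed.

Lemma map_bproj (S S' : pzRingType) (f : {rmorphism S -> S'}) (A : 'M[S]_N) :
  map_mx f (bproj A) = bproj (map_mx f A).
Proof.
by apply/matrixP=> i j; rewrite mxE !bprojE mxE; case: ifP; rewrite ?rmorph0.
Qed.

Lemma bdiag_blockE (S : pzRingType) s (A : 'M[S]_N) : bdiag A ->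
  blockE S s *m A = A *m blockE S s.
Proof.
move=> bA; apply/matrixP=> i j; rewrite mul_blockE mulr_blockE.
have [->|/bA->] := eqVneq (blk i) (blk j); last by rewrite mulr0 mul0r.
by case: eqP; rewrite ?mul1r ?mulr1 ?mul0r ?mulr0.
Qed.

End BlockDiagonal.

(** * The index map [theta], the anti-automorphism [tau], and the group and Lie algebra defined by
    [tau] *)

Section Theta.
Variables (n : nat) (ty : 'I_n -> gtype) (alpha : 'I_n -> nat).
Hypothesis alpha_typed : typed_dim ty alpha.
Local Notation N := (\sum_s alpha s)%N.
Local Notation theta := (theta ty).

(** [theta] shifts the global index; since symplectic blocks have even size, the shift stays inside
    the block and acts on the offset alone. *)
Lemma theta_blk_off (k : 'I_N) : blk (theta k) = blk k /\
  blk_off (theta k) = if is_Sp (ty (blk k)) then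
    (if blk_off k < blk_half k then blk_off k + blk_half k
     else blk_off k - blk_half k)%N else blk_off k.
Proof.
rewrite /theta; case: ifP => // Sp; set o := (if _ then _ else _).
have lt_o : (blk_off (tagnat.Rank (blk k) (tagnat.sig2 k)) < alpha (blk k))%N.
  by rewrite blk_off_Rank.
have ev := odd_double_half (alpha (blk k)).
rewrite (negPf (alpha_typed Sp)) add0n in ev.
pose o' := (if (blk_off k < blk_half k)%N then blk_off k + blk_half k
            else blk_off k - blk_half k)%N.
have lt_o' : (o' < alpha (blk k))%N.
  move: (ltn_ord (tagnat.sig2 k)); rewrite -/(blk k) -/(blk_off k) /o' /blk_half.
  by move: ev; rewrite -addnn; case: ifP; lia.
have oE : o = tagnat.Rank (blk k) (Ordinal lt_o') :> nat.
  have kE : k = (\sum_(i < n | i < blk k) alpha i + blk_off k)%N :> nat.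
    exact: tagnat.rect.
  by rewrite tagnat.RankEsum /= /o /o' kE; case: ltnP => ?; rewrite ?addnA ?addnBA.
(* [o] is the value of a genuine index, so [insubd] does not return its default. *)
rewrite oE /insubd valK /= blk_off_Rank blk_Rank; split=> //.
Qed.

Lemma blk_theta (k : 'I_N) : blk (theta k) = blk k.
Proof. by have [] := theta_blk_off k. Qed.

Lemma blk_off_inj (i j : 'I_N) : blk i = blk j -> blk_off i = blk_off j -> i = j.
Proof.
move=> E1 E2; apply/val_inj; rewrite /= [LHS]tagnat.rect [RHS]tagnat.rect.
by congr addn => //; rewrite -/(blk i) -/(blk j) E1.
Qed.

Definition sgb (k : 'I_N) : bool :=
  is_Sp (ty (blk k)) && (blk_half k <= blk_off k)%N.

Lemma off_lt_double (k : 'I_N) : is_Sp (ty (blk k)) ->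
  (blk_off k < blk_half k + blk_half k)%N.
Proof.
move=> Sp; have ev := odd_double_half (alpha (blk k)).
rewrite (negPf (alpha_typed Sp)) add0n -addnn in ev.
by rewrite /blk_half ev; apply: ltn_ord.
Qed.

Lemma thetaK : involutive (theta (alpha := alpha)).
Proof.
move=> k; have [b1 o1] := theta_blk_off (theta k); have [b2 o2] := theta_blk_off k.
apply: blk_off_inj; first by rewrite b1.
have h2 : blk_half (theta k) = blk_half k by rewrite /blk_half b2.
rewrite o1 b2 h2 o2; case: ifP => // Sp.
  rewrite Sp; have := off_lt_double Sp; move: (blk_off k) (blk_half k) => o h.
  by case: (ltnP o h) => ? ?; case: ltnP; lia.
by rewrite Sp.
Qed.

Lemma theta_inj : injective (theta (alpha := alpha)).
Proof. exact: inv_inj thetaK. Qed.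

Lemma sgb_theta k : sgb (theta k) = is_Sp (ty (blk k)) (+) sgb k.
Proof.
have [b o] := theta_blk_off k; rewrite /sgb b /blk_half b -/(blk_half k) o.
case: ifP => //= Sp; have := off_lt_double Sp.
by case: (ltnP (blk_off k) (blk_half k)) => ? ?; [rewrite leq_addl|]; lia.
Qed.

Lemma sgn_alphaE (K : fieldType) k : sgn_alpha K ty k = (-1) ^+ sgb k.
Proof. by rewrite /sgn_alpha -/(sgb k); case: sgb. Qed.

Lemma tsignE (K : fieldType) s : tsign K ty s = (-1) ^+ is_Sp (ty s).
Proof. by rewrite /tsign; case: is_Sp. Qed.

(** The sign of the type is exactly what changes when [theta] exchanges the halves of a symplectic
    block, so [tsign] times [sgn_alpha] at [i] is [sgn_alpha] at [theta i]. *)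
Lemma sgn2_alphaE (K : fieldType) i j :
  sgn2_alpha K ty i j = (-1) ^+ sgb (theta i) * (-1) ^+ sgb (theta j).
Proof. by rewrite /sgn2_alpha !sgn_alphaE !tsignE !sgb_theta !signr_addb. Qed.

Section Ring.
Variable S : comPzRingType.
Local Notation Th := (Theta ty alpha S).

(** [Theta] is a signed permutation matrix; this joins the matrix form of the relations to their
    index form. *)
Lemma ThetaE i j : Th i j = (-1) ^+ sgb i *+ (j == theta i).
Proof.
rewrite /Theta; have [/blk_eqP[s [a [b [-> ->]]]]|ij] := eqVneq (blk i) (blk j); last first.
  rewrite mxdiag_offdiag //; case: (eqVneq j (theta i)) ij => // ->.
  by rewrite blk_theta eqxx.
rewrite mxdiag_Rank /Theta_; set i' := tagnat.Rank s a; set j' := tagnat.Rank s b.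
have [bt ot] := theta_blk_off i'.
have bi : blk i' = s by apply: blk_Rank.
have bj : blk j' = s by apply: blk_Rank.
have oi : blk_off i' = a by apply: blk_off_Rank.
have oj : blk_off j' = b by apply: blk_off_Rank.
have jE : (j' == theta i') = (blk_off j' == blk_off (theta i')).
  apply/eqP/eqP => [->//|]; apply: blk_off_inj.
  by rewrite bt bi bj.
rewrite jE ot oi oj /sgb bi /blk_half bi oi; case: ifP => Sp /=; last first.
  by rewrite mxE eq_sym.
(* Both offsets are below twice [h], so for a row in a given half only one of the two terms of the
   symplectic form can be nonzero. *)
have := off_lt_double (k := i'); have := off_lt_double (k := j').
rewrite bi bj /blk_half oi oj bi bj Sp => /(_ isT) lj /(_ isT) li.
rewrite mxE; set h := (alpha s)./2 in lj li *; case: ltnP => lah.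
  have -> : (a == b + h :> nat)%N = false by lia.
  by rewrite subr0 expr0.
have -> : (b == a + h :> nat)%N = false by lia.
have -> : (a == b + h :> nat)%N = (b == a - h :> nat)%N by lia.
by rewrite expr1 sub0r mulNrn.
Qed.

Lemma Theta_trE i j : Th^T i j = (-1) ^+ sgb (theta i) *+ (j == theta i).
Proof.
rewrite mxE ThetaE [i == _]eq_sym (can2_eq thetaK thetaK).
by case: eqP => [->|].
Qed.

Lemma mulTheta (M : 'M[S]_N) i j : (M *m Th) i j = M i (theta j) * (-1) ^+ sgb (theta j).
Proof.
rewrite mxE (sum_single (i := theta j)) => [|k kj].
  by rewrite ThetaE thetaK eqxx mulr1n.
by rewrite ThetaE eq_sym (can2_eq thetaK thetaK) (negPf kj) mulr0.
Qed.

Lemma Theta_trmul (M : 'M[S]_N) i j :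
  (Th^T *m M) i j = (-1) ^+ sgb (theta i) * M (theta i) j.
Proof.
rewrite mxE (sum_single (i := theta i)) => [|k ki].
  by rewrite Theta_trE eqxx mulr1n.
by rewrite Theta_trE (negPf ki) mul0r.
Qed.

Lemma Theta_orth : Th^T *m Th = 1%:M.
Proof.
apply/matrixP=> i j; rewrite Theta_trmul ThetaE thetaK mxE eq_sym.
by rewrite mulrnAr -signr_addb addbb.
Qed.

Lemma Theta_orth' : Th *m Th^T = 1%:M.
Proof.
apply/matrixP=> i j; rewrite mxE (sum_single (i := theta i)) => [|k ki].
  rewrite [Th^T _ _]mxE !ThetaE eqxx mulr1n (inj_eq theta_inj) mxE.
  by case: eqP => [->|_]; rewrite ?mulr0n ?mulr0 ?mulr1n -?signr_addb ?addbb.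
by rewrite ThetaE (negPf ki) mul0r.
Qed.

(** On matrices over [S] this is the involution [theta] of the paper up to
    signs; [X (w a) = tau (X a)] in the representation space. *)
Definition tau (M : 'M[S]_N) : 'M[S]_N := Th^T *m M^T *m Th.

Lemma tauE M i j :
  tau M i j = (-1) ^+ sgb (theta i) * (-1) ^+ sgb (theta j) * M (theta j) (theta i).
Proof. by rewrite mulTheta Theta_trmul mxE mulrAC. Qed.

Lemma tau_islin k (A B : 'M[S]_N) : tau (k *: A + B) = k *: tau A + tau B.
Proof. by rewrite /tau linearP /= mulmxDr mulmxDl -scalemxAr -scalemxAl. Qed.

Lemma tauD (A B : 'M[S]_N) : tau (A + B) = tau A + tau B.
Proof. by rewrite -{1}[A]scale1r tau_islin scale1r. Qed.

Lemma tau0 : tau 0 = 0.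
Proof. by rewrite /tau trmx0 mulmx0 mul0mx. Qed.

Lemma tauZ k (A : 'M[S]_N) : tau (k *: A) = k *: tau A.
Proof. by rewrite -[k *: A]addr0 tau_islin tau0 addr0. Qed.

Lemma tauN (A : 'M[S]_N) : tau (- A) = - tau A.
Proof. by rewrite -scaleN1r tauZ scaleN1r. Qed.

Lemma tauB (A B : 'M[S]_N) : tau (A - B) = tau A - tau B.
Proof. by rewrite tauD tauN. Qed.

Lemma tauM A B : tau (A *m B) = tau B *m tau A.
Proof.
by rewrite /tau trmx_mul !mulmxA -[_ *m Th *m Th^T]mulmxA Theta_orth' mulmx1.
Qed.

Lemma tr_tau A : \tr (tau A) = \tr A.
Proof. by rewrite /tau mxtrace_mulC mulmxA Theta_orth' mul1mx mxtrace_tr. Qed.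

Lemma tau1 : tau 1%:M = 1%:M.
Proof. by rewrite /tau trmx1 mulmx1 Theta_orth. Qed.

Lemma tau_bdiag A : bdiag A -> bdiag (tau A).
Proof. by move=> bA i j ij; rewrite tauE bA ?mulr0 // !blk_theta eq_sym. Qed.

Lemma tau_bproj A : tau (bproj A) = bproj (tau A).
Proof.
apply/matrixP=> i j; rewrite !(tauE, bprojE) !blk_theta eq_sym.
by case: ifP; rewrite ?mulr0.
Qed.

Definition hmx : 'M[S]_N := \sum_s (-1) ^+ is_Sp (ty s) *: blockE alpha S s.

Lemma hmxE i j : hmx i j = (-1) ^+ is_Sp (ty (blk i)) *+ (i == j).
Proof.
rewrite summxE (sum_single (i := blk i)) => [|s si]; rewrite !mxE ?eqxx.
  by rewrite andbT mulr_natr.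
by rewrite [blk i == s]eq_sym (negPf si) andbF mulr0.
Qed.

(** [Theta] squares to 1 on orthogonal blocks and to -1 on symplectic ones, that is, to [hmx]. The
    resulting conjugation disappears on block-diagonal matrices. *)
Lemma tau_tau M : tau (tau M) = hmx *m M *m hmx.
Proof.
apply/matrixP=> i j; rewrite !tauE !thetaK mxE (sum_single (i := j)) => [|k kj].
  rewrite mxE (sum_single (i := i)) => [|k ki]; last first.
    by rewrite hmxE eq_sym (negPf ki) mul0r.
  rewrite !hmxE !eqxx !sgb_theta !signr_addb !mulr1n.
  have sq (b : bool) : (-1) ^+ b * (-1) ^+ b = 1 :> S.
    by rewrite -signr_addb addbb.
  move: (sq (sgb i)) (sq (sgb j)).
  move: ((-1) ^+ sgb i) ((-1) ^+ sgb j) ((-1) ^+ is_Sp (ty (blk i))) => a b c.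
  move: ((-1) ^+ is_Sp (ty (blk j))) => d aa bb.
  transitivity (a * a * (b * b) * (c * M i j * d)); first by ring.
  by rewrite aa bb; ring.
by rewrite hmxE (negPf kj) mulr0.
Qed.

Lemma hmx_sq : hmx *m hmx = 1%:M.
Proof. by have := tau_tau 1%:M; rewrite !tau1 mulmx1. Qed.

Lemma hmx_bdiag (Z : 'M[S]_N) : bdiag Z -> hmx *m Z *m hmx = Z.
Proof.
move=> bZ; rewrite -mulmxA.
have -> : Z *m hmx = hmx *m Z.
  rewrite /hmx mulmx_sumr mulmx_suml; apply: eq_bigr => s _.
  by rewrite -scalemxAr -scalemxAl bdiag_blockE.
by rewrite mulmxA hmx_sq mul1mx.
Qed.

Lemma tau_tau_bdiag Z : bdiag Z -> tau (tau Z) = Z.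
Proof. by move=> bZ; rewrite tau_tau hmx_bdiag. Qed.

(** For [h = 1/2], the orthogonal projection of [gl_N] onto the Lie algebra
    of [G], with scalars extended to [S]. *)
Definition projg (h : S) (Y : 'M[S]_N) : 'M[S]_N := h *: (bproj Y - tau (bproj Y)).

(** [tau] preserves the trace and reverses products, so on block-diagonal matrices, where it is
    involutive, it is self-adjoint for the trace form; so is the block projection. *)
Lemma tr_projg_sym h (Y Z : 'M[S]_N) : \tr (Y *m projg h Z) = \tr (projg h Y *m Z).
Proof.
rewrite /projg -scalemxAr -scalemxAl !mxtraceZ mulmxBr mulmxBl !raddfB /=.
congr (_ * (_ - _)); first exact: tr_bproj_sym.
rewrite -[LHS]tr_tau tauM tau_tau_bdiag; last exact: bproj_bdiag.
by rewrite mxtrace_mulC tr_bproj_sym -tau_bproj.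
Qed.

Lemma projg_lin h (z : S) (Y Z : 'M[S]_N) :
  projg h (z *: Y + Z) = z *: projg h Y + projg h Z.
Proof.
rewrite /projg bproj_islin tau_islin [in RHS]scalerA [z * _]mulrC -scalerA -scalerDr.
by rewrite [in RHS](scalerBr z) opprD addrACA.
Qed.

(** [h + h = 1] makes [projg] fix [L], and self-adjointness moves the projection from [Z] to [L]. *)
Lemma tr_projg h (L Z : 'M[S]_N) : h + h = 1 -> bdiag L -> tau L = - L ->
  \tr (L *m projg h Z) = \tr (L *m Z).
Proof.
move=> hh bL tL; rewrite tr_projg_sym; congr (\tr (_ *m _)).
by rewrite /projg bdiag_bproj // tL opprK scalerDr -scalerDl hh scale1r.
Qed.

Lemma bdiag_projg h Y : bdiag (projg h Y).
Proof. by apply: bdiag_scaleB; last apply: tau_bdiag; apply: bproj_bdiag. Qed.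

Lemma tau_projg h Y : tau (projg h Y) = - projg h Y.
Proof.
rewrite /projg tauZ tauB tau_tau_bdiag; last exact: bproj_bdiag.
by rewrite -scalerN opprB.
Qed.

Lemma tau_comm (U V : 'M[S]_N) : tau U = - U -> tau V = - V ->
  tau (U *m V - V *m U) = - (U *m V - V *m U).
Proof.
by move=> tU tV; rewrite tauB !tauM tU tV !mulNmx !mulmxN !opprK opprB.
Qed.

Lemma tau_delta i j : tau (delta_mx j i) =
  ((-1) ^+ sgb i * (-1) ^+ sgb j) *: delta_mx (theta i) (theta j).
Proof.
apply/matrixP=> p q; rewrite tauE !mxE ![theta _ == _](can2_eq thetaK thetaK).
rewrite andbC; case: eqP => [->|_]; rewrite ?mulr0 //.
by case: eqP => [->|_]; rewrite ?mulr0 // !thetaK.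
Qed.

(** Orthogonality of [Theta] turns preservation of the form into unitarity for [tau], the shape that
    [w Phi * Phi = 1] takes at a point. *)
Lemma Theta_form g : g^T *m Th *m g = Th <-> tau g *m g = 1%:M.
Proof.
rewrite /tau; split=> [E|E].
  by rewrite -!mulmxA in E *; rewrite E Theta_orth.
rewrite -[LHS]mul1mx -Theta_orth' -[RHS]mulmx1 -E -!mulmxA.
by congr (_ *m _); rewrite !mulmxA.
Qed.

Lemma Lie_form (y : 'M[S]_N) : y^T *m Th + Th *m y = 0 <-> tau y = - y.
Proof.
rewrite /tau; split=> E.
  apply/eqP; rewrite -addr_eq0 -[X in _ + X]mul1mx -Theta_orth.
  by rewrite -!mulmxA -mulmxDr E mulmx0.
rewrite -[_^T *m _]mul1mx -Theta_orth' -[X in X + _]mulmxA -mulmxDr.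
by rewrite mulmxA E addNr mulmx0.
Qed.

Lemma inGP (g : 'M[S]_N) : inG ty g <-> bdiag g /\ tau g *m g = 1%:M.
Proof.
split=> [[g_ [-> E]]|[bg E]].
  split; first by move=> i j; apply: mxdiag_offdiag.
  by apply/Theta_form; rewrite /Theta tr_mxdiag !mul_mxdiag; apply/eq_mxdiag.
exists (fun s => submxblock g s s); split; first exact: bdiagP.
apply/eq_mxdiagP; rewrite -!mul_mxdiag -tr_mxdiag -bdiagP //.
exact/Theta_form.
Qed.

End Ring.

Lemma inLieP (K : fieldType) (x : 'M[K]_N) :
  inLie ty x <-> bdiag x /\ tau x = - x.
Proof.
split=> [[x_ [-> E]]|[bx E]].
  split; first by move=> i j; apply: mxdiag_offdiag.
  apply/Lie_form; rewrite /Theta tr_mxdiag !mul_mxdiag -mxdiagD -mxdiag0.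
  exact/eq_mxdiag.
exists (fun s => submxblock x s s); split; first exact: bdiagP.
apply/eq_mxdiagP; rewrite mxdiagD -!mul_mxdiag -tr_mxdiag -bdiagP //.
by rewrite mxdiag0; apply/Lie_form.
Qed.

Lemma map_ThetaE (S S' : comPzRingType) (f : {rmorphism S -> S'}) i j :
  f (Theta ty alpha S i j) = Theta ty alpha S' i j.
Proof. by rewrite !ThetaE rmorphMn rmorph_sign. Qed.

Lemma map_Theta (S S' : comPzRingType) (f : {rmorphism S -> S'}) :
  map_mx f (Theta ty alpha S) = Theta ty alpha S'.
Proof. by apply/matrixP=> i j; rewrite mxE map_ThetaE. Qed.

Lemma map_tau (S S' : comPzRingType) (f : {rmorphism S -> S'}) (A : 'M[S]_N) :
  map_mx f (tau A) = tau (map_mx f A).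
Proof. by rewrite /tau !map_mxM -!map_trmx !map_Theta. Qed.

Lemma inG_inv (K : fieldType) (g : 'M[K]_N) : inG ty g ->
  [/\ invmx g = tau g, tau (invmx g) = g, g *m invmx g = 1%:M & invmx g *m g = 1%:M].
Proof.
move=> /inGP[bg tg]; have [_ ug] := mulmx1_unit tg.
have ig : invmx g = tau g by rewrite -[RHS]mulmx1 -(mulmxV ug) mulmxA tg mul1mx.
by split; rewrite ?mulmxV ?mulVmx // ig tau_tau_bdiag.
Qed.

Lemma map_projg (S S' : comPzRingType) (f : {rmorphism S -> S'}) h (Y : 'M[S]_N) :
  map_mx f (projg h Y) = projg (f h) (map_mx f Y).
Proof. by rewrite /projg map_mxZ map_mxB map_tau map_bproj. Qed.

Lemma inLie_projg (K : fieldType) h (Y : 'M[K]_N) : inLie ty (projg h Y).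
Proof. by apply/inLieP; split; [apply: bdiag_projg|apply: tau_projg]. Qed.

End Theta.

(** * Evaluation of tensors in an abelian group *)

Section TensorSum.
Variables (K : comNzRingType) (U V : lmodType K) (W : zmodType).

(** [tlift] without a scalar action on the target. *)
Definition tsum (b : U -> V -> W) (x : tensor U V) : W :=
  \sum_(p <- trep x) b p.1 p.2.

(** With only an abelian group as target, bilinearity becomes additivity together with moving
    scalars across the tensor sign, as in the relations of [teq]. *)
Definition balanced (b : U -> V -> W) :=
  [/\ forall u u' v, b (u + u') v = b u v + b u' v,
      forall u v v', b u (v + v') = b u v + b u v' &
      forall k u v, b (k *: u) v = b u (k *: v)].

Variable b : U -> V -> W.
Hypothesis b_bal : balanced b.

Lemma tsum_pi s : tsum b (tpi s) = \sum_(p <- s) b p.1 p.2.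
Proof.
case: b_bal => bl br bk; suff H t r : teq t r ->
    \sum_(p <- t) b p.1 p.2 = \sum_(p <- r) b p.1 p.2 by apply/H/trep_pi.
have b0 v : b 0 v = 0 by apply: (addrI (b 0 v)); rewrite -bl !addr0.
elim=> {s t r} [s|s t _ IH|s t r _ IH _ IH'|s s' t t' _ IH _ IH'|s t|u u' v
  |u v v'|l u v|v]; rewrite ?big_cat ?big_cons ?big_nil /= ?addr0 ?b0 //.
- by rewrite IH.
- by rewrite IH IH'.
- by rewrite addrC.
Qed.

Lemma tsum_tens u v : tsum b (u \ox v) = b u v.
Proof. by rewrite tsum_pi // big_seq1. Qed.

Lemma tsumD x y : tsum b (x + y) = tsum b x + tsum b y.
Proof.
rewrite -(trepK x) -(trepK y) [X in tsum b X](_ : _ = tpi (trep x ++ trep y)).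
  by rewrite !tsum_pi big_cat.
exact: tadd_pi.
Qed.

Lemma tsum0 : tsum b 0 = 0.
Proof. by apply: (addrI (tsum b 0)); rewrite -tsumD !addr0. Qed.

End TensorSum.

Section DoubleBracketTensors.
Variables (K : fieldType) (A : algType K).
Local Notation A2 := (tensor A A).
Implicit Types (a b c : A) (d : A2).

Lemma mulr_islin c : islin (fun a : A => a * c).
Proof. by move=> k x y; rewrite mulrDl scalerAl. Qed.
Lemma mull_islin c : islin (fun a : A => c * a).
Proof. by move=> k x y; rewrite mulrDr scalerAr. Qed.
Lemma id_islin (U : lmodType K) : islin (@id U). Proof. by []. Qed.

Lemma bilin_islinl (U V W : lmodType K) (b : U -> V -> W) v :
  bilin b -> islin (b^~ v).
Proof. by move=> [bl _] k x y; apply: bl. Qed.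
Lemma bilin_islinr (U V W : lmodType K) (b : U -> V -> W) u :
  bilin b -> islin (b u).
Proof. by move=> [_ br] k x y; apply: br. Qed.

Lemma bilin_swap (U V W : lmodType K) (b : U -> V -> W) :
  bilin b -> bilin (fun v u => b u v).
Proof. by case=> bl br; split=> *; [apply: br|apply: bl]. Qed.

Lemma tflip_islin : islin (@tflip K A).
Proof. exact/tlift_islin/bilin_swap/tens_bilin. Qed.
Lemma tflip_tens a b : tflip (a \ox b) = b \ox a.
Proof. exact/tliftE/bilin_swap/tens_bilin. Qed.
Lemma tflipK : involutive (@tflip K A).
Proof.
have lf := tflip_islin.
apply: tensor_ext => [||a b]; [exact: islin_comp|exact: id_islin|].
by rewrite !tflip_tens.
Qed.

Lemma outer_bilin a b :
  bilin (fun d' d'' : A => (a * d') \ox (d'' * b)).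
Proof. exact: bilin_comp (tens_bilin A A) (mull_islin a) (mulr_islin b). Qed.
Lemma inner_bilin a b :
  bilin (fun d' d'' : A => (d' * b) \ox (a * d'')).
Proof. exact: bilin_comp (tens_bilin A A) (mulr_islin b) (mull_islin a). Qed.
Lemma outer_islin a b : islin (fun d => outer a d b).
Proof. exact/tlift_islin/outer_bilin. Qed.
Lemma outer_tens a b x y : outer a (x \ox y) b = (a * x) \ox (y * b).
Proof. exact/tliftE/outer_bilin. Qed.
Lemma inner_islin a b : islin (fun d => inner a d b).
Proof. exact/tlift_islin/inner_bilin. Qed.
Lemma inner_tens a b x y : inner a (x \ox y) b = (x * b) \ox (a * y).
Proof. exact/tliftE/inner_bilin. Qed.

Lemma tau123_bilin_in (a3 : A) : bilin (fun a1 a2 : A => a3 \ox a1 \ox a2).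
Proof.
by split=> *; rewrite ?(tens_bilin _ _).2 ?(tens_bilin _ _).1.
Qed.
Lemma tau123_bilin : bilin (fun (d : A2) (a3 : A) =>
  tlift (fun a1 a2 => a3 \ox a1 \ox a2) d).
Proof.
split=> [k x y a3|k d x y]; first exact: (tlift_islin (tau123_bilin_in a3)).
elim/tensor_ind: d => [|d1 d2 IH1 IH2|u v].
- by rewrite !(islin0 (tlift_islin (tau123_bilin_in _))) scaler0 addr0.
- rewrite !(islinD _ _ (tlift_islin (tau123_bilin_in _))) IH1 IH2 scalerDr.
  by rewrite addrACA.
- by rewrite !(tliftE _ _ (tau123_bilin_in _)) !(tens_bilin _ _).1.
Qed.
Lemma tau123_islin : islin (@tau123 K A).
Proof. exact/tlift_islin/tau123_bilin. Qed.
Lemma tau123_tens a b c : tau123 (a \ox b \ox c) = c \ox a \ox b.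
Proof.
by rewrite /tau123 (tliftE _ _ tau123_bilin) (tliftE _ _ (tau123_bilin_in c)).
Qed.

Section DbL.
Variable db : A -> A -> A2.
Hypothesis db_lin : bilin db.

Lemma dbL_bilin a : bilin (fun d' d'' : A => db a d' \ox d'').
Proof. exact: (bilin_comp (tens_bilin A2 A) (bilin_islinr a db_lin) (id_islin (U := A))). Qed.
Lemma dbL_islin a : islin (dbL db a).
Proof. exact/tlift_islin/dbL_bilin. Qed.
Lemma dbL_tens a x y : dbL db a (x \ox y) = db a x \ox y.
Proof. exact/tliftE/dbL_bilin. Qed.
End DbL.

Section Ww.
Variable w : A -> A.
Hypothesis w_lin : islin w.
Lemma ww_bilin : bilin (fun x y : A => w x \ox w y).
Proof. exact: bilin_comp (tens_bilin A A) w_lin w_lin. Qed.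
Lemma ww_islin : islin (tlift (fun x y : A => w x \ox w y)).
Proof. exact/tlift_islin/ww_bilin. Qed.
Lemma ww_tens x y : tlift (fun x y : A => w x \ox w y) (x \ox y) = w x \ox w y.
Proof. exact/tliftE/ww_bilin. Qed.
End Ww.

Section Brackets.
Variables (n : nat) (e : 'I_n -> A) (db : A -> A -> A2).
Hypothesis db_dbl : is_double_bracket e db.

(** The bracket vanishes on [A_0], so the Leibniz rule makes it linear over [A_0]. This is applied
    to the signs of the types, conjugation by which is the square of [w]. *)
Lemma db_A0_inner x a b : db (of_A0 e x * a * of_A0 e x) b =
  inner (of_A0 e x) (db a b) (of_A0 e x).
Proof.
have l0 u v : inner u (0 : A2) v = 0 by apply: islin0 (inner_islin u v).
rewrite !(db_leibl db_dbl) !(db_A0l db_dbl) !l0 addr0 add0r.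
set h := of_A0 e x; move: (db a b).
apply: (@tensor_ext _ _ _ _ (fun d => inner 1 (inner h d 1) h) (fun d => inner h d h)).
- exact: islin_comp (inner_islin _ _) (inner_islin _ _).
- exact: inner_islin.
- by move=> u v; rewrite !inner_tens mul1r mulr1.
Qed.

Lemma db_A0_outer x a b : db b (of_A0 e x * a * of_A0 e x) =
  outer (of_A0 e x) (db b a) (of_A0 e x).
Proof.
have l0 u v : outer u (0 : A2) v = 0 by apply: islin0 (outer_islin u v).
rewrite !(db_leibr db_dbl) !(db_A0r db_dbl) !l0 addr0 add0r.
set h := of_A0 e x; move: (db b a).
apply: (@tensor_ext _ _ _ _ (fun d => outer 1 (outer h d 1) h) (fun d => outer h d h)).
- exact: islin_comp (outer_islin _ _) (outer_islin _ _).
- exact: outer_islin.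
- by move=> u v; rewrite !outer_tens mul1r mulr1.
Qed.

End Brackets.
End DoubleBracketTensors.

(** * Brackets at a point of the representation space *)
Section TypedPoints.
Variables (K : numFieldType) (n : nat) (A : algType K) (e : 'I_n -> A).
Variables (ty : 'I_n -> gtype) (w : A -> A) (alpha : 'I_n -> nat).
Hypotheses (A_A0 : A0_algebra e) (w_tai : typed_anti_involution ty e w).
Hypothesis alpha_typed : typed_dim ty alpha.
Variables (S : comPzRingType) (cst : {rmorphism K -> S}).

Local Notation N := (\sum_s alpha s)%N.
Local Notation M := 'M[S]_N.
Local Notation tau := (@tau n ty alpha S).
Local Notation E := (blockE alpha S).
Implicit Types (P Q R Z : M) (a b c : A).

Lemma w_lin : islin w.
Proof. by move=> k x y; apply: (tai_lin w_tai). Qed.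

Definition hA : A := of_A0 e (tsign K ty).

(** Each Peirce component of [a] is scaled by the product of the signs at its two ends, which is
    conjugation by [hA]. In this form brackets see the square of [w] through [A_0]-linearity. *)
Lemma wwE a : w (w a) = hA * a * hA.
Proof.
case: A_A0 => e_ort e_sum.
have blockw s t : w (w (e s * a * e t)) = (tsign K ty s * tsign K ty t) *: (e s * a * e t).
  apply: (tai_sq w_tai); rewrite !mulrA e_ort eqxx -!mulrA e_ort eqxx //.
have wl := w_lin; have wwl : islin (fun a => w (w a)) := islin_comp wl wl.
have {1}-> : a = \sum_s \sum_t e s * a * e t.
  under eq_bigr do rewrite -mulr_sumr e_sum mulr1.
  by rewrite -mulr_suml e_sum mul1r.
rewrite (islin_sum _ _ _ wwl) /hA /of_A0 mulr_suml mulr_suml.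
apply: eq_bigr => s _; rewrite (islin_sum _ _ _ wwl) mulr_sumr.
by apply: eq_bigr => t _; rewrite blockw -!scalerAl -scalerAr -!scalerA.
Qed.

Lemma sum_blockE : \sum_s E s = 1%:M.
Proof.
apply/matrixP=> i j; rewrite summxE (sum_single (i := blk i)) => [|s si].
  by rewrite !mxE eqxx andbT.
by rewrite mxE eq_sym andbC [_ == s]eq_sym (negPf si).
Qed.

(** An [S]-point of the representation space. *)
Record typed_point (X : A -> M) : Prop := TypedPoint {
  X_lin : forall k a b, X (k *: a + b) = cst k *: X a + X b;
  XM : forall a b, X (a * b) = X a *m X b;
  Xe : forall s, X (e s) = E s;
  Xw : forall a, X (w a) = tau (X a) }.

Variable X : A -> M.
Hypothesis X_pt : typed_point X.

Lemma XD a b : X (a + b) = X a + X b.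
Proof. by rewrite -{1}[a]scale1r (X_lin X_pt) rmorph1 scale1r. Qed.
Lemma X0 : X 0 = 0.
Proof. by apply: (addrI (X 0)); rewrite -XD !addr0. Qed.
Lemma XZ k a : X (k *: a) = cst k *: X a.
Proof. by rewrite -[k *: a]addr0 (X_lin X_pt) X0 addr0. Qed.
Lemma X_sum (I : Type) (r : seq I) F : X (\sum_(i <- r) F i) = \sum_(i <- r) X (F i).
Proof. by apply: (big_morph _ XD X0). Qed.

Lemma X1 : X 1 = 1%:M.
Proof.
by case: A_A0 => _ <-; rewrite X_sum -sum_blockE; apply: eq_bigr => s _; apply: (Xe X_pt).
Qed.

Lemma X_A0 x : X (of_A0 e x) = \sum_s cst (x s) *: E s.
Proof. by rewrite X_sum; apply: eq_bigr => s _; rewrite XZ (Xe X_pt). Qed.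

Lemma X_hA : X hA = hmx ty alpha S.
Proof.
rewrite X_A0; apply: eq_bigr => s _.
by rewrite tsignE rmorph_sign.
Qed.

(** The matrix [X(d') P X(d'')], so that [entry2 d k j i l] is its [(k, l)]
    entry for [P] the elementary matrix [E_(ji)]. *)
Definition emx (d : tensor A A) P : M := tsum (fun d' d'' => X d' *m P *m X d'') d.

Lemma emx_bal P : balanced (fun d' d'' => X d' *m P *m X d'').
Proof.
split=> [x y z|z x y|k x y]; rewrite ?XD ?XZ.
- by rewrite !mulmxDl.
- by rewrite !mulmxDr.
- by rewrite -!scalemxAl -scalemxAr.
Qed.

Lemma emx_tens a b P : emx (a \ox b) P = X a *m P *m X b.
Proof. exact: tsum_tens (emx_bal P) a b. Qed.
Lemma emxD x y P : emx (x + y) P = emx x P + emx y P.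
Proof. exact: tsumD (emx_bal P) x y. Qed.
Lemma emx0 P : emx 0 P = 0.
Proof. exact: tsum0 (emx_bal P). Qed.
Lemma emxN x P : emx (- x) P = - emx x P.
Proof. by apply/eqP; rewrite -addr_eq0 -emxD addNr emx0. Qed.

Lemma emxZ k x P : emx (k *: x) P = cst k *: emx x P.
Proof.
elim/tensor_ind: x => [|x y IHx IHy|u v].
- by rewrite !scaler0 emx0 scaler0.
- by rewrite scalerDr !emxD IHx IHy scalerDr.
- by rewrite -tensZl !emx_tens XZ -!scalemxAl.
Qed.

Lemma emx_Zr (z : S) d P : emx d (z *: P) = z *: emx d P.
Proof.
elim/tensor_ind: d => [|x y IHx IHy|u v].
- by rewrite !emx0 scaler0.
- by rewrite !emxD IHx IHy scalerDr.
- by rewrite !emx_tens -scalemxAr -scalemxAl.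
Qed.

Lemma emx_outer a d b P : emx (outer a d b) P = X a *m emx d P *m X b.
Proof.
elim/tensor_ind: d => [|x y IHx IHy|u v].
- by rewrite (islin0 (outer_islin a b)) emx0 mulmx0 mul0mx.
- by rewrite (islinD _ _ (outer_islin a b)) !emxD IHx IHy mulmxDr mulmxDl.
- by rewrite outer_tens !emx_tens !(XM X_pt) !mulmxA.
Qed.

(** The inner action reaches only the test matrix, as the outer action reaches only the result; this
    is why the test matrix is kept as an argument. *)
Lemma emx_inner a d b P : emx (inner a d b) P = emx d (X b *m P *m X a).
Proof.
elim/tensor_ind: d => [|x y IHx IHy|u v].
- by rewrite (islin0 (inner_islin a b)) !emx0.
- by rewrite (islinD _ _ (inner_islin a b)) !emxD IHx IHy.
- by rewrite inner_tens !emx_tens !(XM X_pt) !mulmxA.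
Qed.

Lemma tr_emx_flip d P Q : \tr (emx (tflip d) P *m Q) = \tr (emx d Q *m P).
Proof.
elim/tensor_ind: d => [|x y IHx IHy|u v].
- by rewrite (islin0 (@tflip_islin K A)) !emx0 !mul0mx.
- by rewrite (islinD _ _ (@tflip_islin K A)) !emxD !mulmxDl !mxtraceD IHx IHy.
- by rewrite tflip_tens !emx_tens -mulmxA mxtrace_mulC !mulmxA.
Qed.

Lemma tau_emx d P : tau (emx d P) =
  emx (tflip (tlift (fun x y => w x \ox w y) d)) (tau P).
Proof.
have wwl := ww_islin w_lin.
elim/tensor_ind: d => [|x y IHx IHy|u v].
- by rewrite (islin0 wwl) (islin0 (@tflip_islin K A)) !emx0 tau0.
- by rewrite (islinD _ _ wwl) (islinD _ _ (@tflip_islin K A)) !emxD tauD IHx IHy.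
- by rewrite (ww_tens w_lin) tflip_tens !emx_tens !(tauM alpha_typed) !(Xw X_pt) mulmxA.
Qed.

(** For constant [P], the trace of [xi] against this commutator is the infinitesimal action of [xi]
    on [\tr (P *m X a)]: it is the gradient along the group orbits. *)
Definition commX a P : M := P *m X a - X a *m P.

Let h2 : S := cst 2^-1.

Lemma cst2 : h2 + h2 = 1.
Proof.
rewrite -rmorphD /= -[RHS](rmorph1 cst); congr (cst _).
by rewrite -mulr2n -[LHS]mulr_natr mulVf // Num.Theory.pnatr_eq0.
Qed.

Lemma tau_commX a P : tau (commX a P) = - commX (w a) (tau P).
Proof. by rewrite /commX tauB !(tauM alpha_typed) !(Xw X_pt) opprB. Qed.

(** [tau] replaces [(a, P)] by [(w a, tau P)] up to a sign, and the minus sign in [projg] cancels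
    it: averaging over the two pairs is projecting to the Lie algebra. *)
Lemma projg_commX a P : projg ty h2 (commX a P) =
  h2 *: (bproj (commX a P) + bproj (commX (w a) (tau P))).
Proof. by rewrite /projg (tau_bproj alpha_typed) tau_commX bprojN opprK. Qed.

Lemma conj_point (g g' : M) : g *m g' = 1%:M -> g' *m g = 1%:M ->
  tau g = g' -> tau g' = g -> bdiag g -> typed_point (fun a => g' *m X a *m g).
Proof.
move=> gg g1 tg tg' bg; split=> [k a b|a b|s|a].
- by rewrite (X_lin X_pt) mulmxDr mulmxDl -scalemxAr -scalemxAl.
- by rewrite (XM X_pt) !mulmxA -[_ *m g *m g']mulmxA gg mulmx1.
- by rewrite (Xe X_pt) -mulmxA bdiag_blockE // mulmxA g1 mul1mx.
- by rewrite (Xw X_pt) !(tauM alpha_typed) tg tg' mulmxA.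
Qed.

Lemma tr_commX (L : M) a i j :
  (X a *m L - L *m X a) i j = \tr (L *m commX a (delta_mx j i)).
Proof.
by rewrite -(tr_mul_delta (X a *m L - L *m X a)); apply: tr_comm_swap.
Qed.

Section Commutator.
Variable L : M.
Let ad a : M := X a *m L - L *m X a.

Lemma comm_lin k a b : ad (k *: a + b) = cst k *: ad a + ad b.
Proof.
rewrite /ad (X_lin X_pt) mulmxDl mulmxDr -scalemxAl -scalemxAr scalerBr opprD.
by rewrite addrACA.
Qed.

Lemma comm_mul a b : ad (a * b) = ad a *m X b + X a *m ad b.
Proof.
by rewrite /ad (XM X_pt) comm_leib.
Qed.

Lemma comm_idem s : bdiag L -> ad (e s) = 0.
Proof. by move=> bL; rewrite /ad (Xe X_pt) bdiag_blockE // subrr. Qed.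

Lemma comm_tau a : tau L = - L -> ad (w a) = tau (ad a).
Proof.
by move=> tL; rewrite /ad (Xw X_pt) tauB !(tauM alpha_typed) tL mulNmx mulmxN opprK addrC.
Qed.

End Commutator.

(** * The averaged bracket and its Jacobiator *)

Section Bracket.
Variable db : A -> A -> tensor A A.
Hypotheses (db_dbl : is_double_bracket e db) (db_typed : typed_double_bracket w db).

Lemma tau_emx_db a b P : tau (emx (db a b) P) = emx (db (w a) (w b)) (tau P).
Proof. by rewrite tau_emx db_typed tflipK. Qed.

Lemma mulXhA P : X hA *m (X hA *m P *m X hA) *m X hA = P.
Proof.
have hh : X hA *m X hA = 1%:M by rewrite X_hA hmx_sq.
by rewrite !mulmxA hh mul1mx -mulmxA hh mulmx1.
Qed.

(** Both squares are conjugations by the signs of the types, which square to 1; the two cancel, so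
    that [(w, tau)] acts as an involution on brackets. *)
Lemma emx_dbww a b P : emx (db (w (w a)) b) (tau (tau P)) = emx (db a b) P.
Proof.
by rewrite wwE (db_A0_inner db_dbl) emx_inner (tau_tau alpha_typed) -X_hA mulXhA.
Qed.

Lemma dbC a b : tflip (db a b) = - db b a.
Proof. by rewrite (db_antisym db_dbl b a) opprK. Qed.

Lemma tr_emx_antisym a b P Q :
  \tr (emx (db a b) P *m Q) = - \tr (emx (db b a) Q *m P).
Proof. by rewrite -(tr_emx_flip _ P Q) dbC emxN mulNmx raddfN opprK. Qed.

(** Apply [tau] inside the trace: typedness puts [w] on both arguments, and the double [w] on the
    first one disappears. *)
Lemma tr_emx_dbw a b P Q :
  \tr (emx (db (w a) b) (tau P) *m Q) = \tr (emx (db a (w b)) P *m tau Q).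
Proof.
rewrite -[LHS](tr_tau alpha_typed) (tauM alpha_typed) tau_emx_db emx_dbww.
by rewrite mxtrace_mulC.
Qed.

(** [Delta a P b] is the matrix of brackets of [\tr (P *m X a)] with the
    entries of [X b]. *)
Definition Delta a P b : M :=
  h2 *: (emx (db a b) P + emx (db (w a) b) (tau P)).

Lemma Delta_lin a P k b c : Delta a P (k *: b + c) = cst k *: Delta a P b + Delta a P c.
Proof.
rewrite /Delta !(db_bilin db_dbl).2 !emxD !emxZ !scalerDr !scalerA ![cst k * _]mulrC.
by rewrite addrACA.
Qed.

Lemma Delta_mul a P b c : Delta a P (b * c) = Delta a P b *m X c + X b *m Delta a P c.
Proof.
rewrite /Delta !(db_leibr db_dbl) !emxD !emx_outer X1 !mul1mx !mulmx1.
by rewrite -scalemxAl -scalemxAr mulmxDl mulmxDr -scalerDr addrACA.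
Qed.

Lemma Delta_idem a P s : Delta a P (e s) = 0.
Proof.
have -> : e s = of_A0 e (fun t => (t == s)%:R).
  rewrite /of_A0 (sum_single (i := s)) => [|t ts]; rewrite ?eqxx ?scale1r //.
  by rewrite (negPf ts) scale0r.
by rewrite /Delta !(db_A0r db_dbl) !emx0 addr0 scaler0.
Qed.

(** [tau] exchanges the two summands of the average; this is how the bracket respects the relation
    [X (w b) = tau (X b)]. *)
Lemma Delta_w a P b : Delta a P (w b) = tau (Delta a P b).
Proof. by rewrite /Delta tauZ tauD !tau_emx_db emx_dbww addrC. Qed.

(** For the untwisted terms this is antisymmetry of the double bracket; in the twisted ones [w] must
    also be moved from one argument to the other. *)
Lemma tr_Delta_antisym a b P Q :
  \tr (Delta a P b *m Q) = - \tr (Delta b Q a *m P).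
Proof.
rewrite /Delta -!scalemxAl !mxtraceZ !mulmxDl !mxtraceD.
rewrite tr_emx_antisym (tr_emx_dbw b a Q P) [X in _ + X]tr_emx_antisym.
by rewrite -opprD mulrN.
Qed.

Lemma Delta_antisym a i j b k l :
  Delta a (delta_mx j i) b k l = - Delta b (delta_mx l k) a i j.
Proof.
rewrite -(tr_mul_delta (Delta a _ b)) -(tr_mul_delta (Delta b _ a)).
exact: tr_Delta_antisym.
Qed.

Lemma Delta_antisym_tr a P b k l :
  - \tr (P *m Delta b (delta_mx l k) a) = Delta a P b k l.
Proof.
by rewrite -(tr_mul_delta (Delta a P b)) tr_Delta_antisym mxtrace_mulC.
Qed.

(** On [a \ox b \ox c] this is the trace of [X a *m P *m X b *m Q *m X c *m R], so that [tau123]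
    only rotates the test matrices. *)
Definition tr3 (t : tensor (tensor A A) A) P Q R : S :=
  tsum (fun d c => \tr (emx d P *m Q *m X c *m R)) t.

Lemma tr3_bal P Q R : balanced (fun d c => \tr (emx d P *m Q *m X c *m R)).
Proof.
split=> [x y z|z x y|k x y]; rewrite ?emxD ?emxZ ?XD ?XZ.
- by rewrite !mulmxDl mxtraceD.
- by rewrite mulmxDr mulmxDl mxtraceD.
- by rewrite -!scalemxAl -scalemxAr -scalemxAl.
Qed.

Lemma tr3_tens d c P Q R : tr3 (d \ox c) P Q R = \tr (emx d P *m Q *m X c *m R).
Proof. exact: tsum_tens (tr3_bal P Q R) d c. Qed.
Lemma tr3D x y P Q R : tr3 (x + y) P Q R = tr3 x P Q R + tr3 y P Q R.
Proof. exact: tsumD (tr3_bal P Q R) x y. Qed.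
Lemma tr30 P Q R : tr3 0 P Q R = 0.
Proof. exact: tsum0 (tr3_bal P Q R). Qed.
Lemma tr3N x P Q R : tr3 (- x) P Q R = - tr3 x P Q R.
Proof. by apply/eqP; rewrite -addr_eq0 -tr3D addNr tr30. Qed.
Lemma tr3B x y P Q R : tr3 (x - y) P Q R = tr3 x P Q R - tr3 y P Q R.
Proof. by rewrite tr3D tr3N. Qed.
Lemma tr3_sum (I : Type) (r : seq I) F P Q R :
  tr3 (\sum_(i <- r) F i) P Q R = \sum_(i <- r) tr3 (F i) P Q R.
Proof.
exact: (big_morph (fun t => tr3 t P Q R) (fun x y => tr3D x y P Q R) (tr30 P Q R)).
Qed.
Lemma tr3Z k x P Q R : tr3 (k *: x) P Q R = cst k * tr3 x P Q R.
Proof.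
elim/tensor_ind: x => [|x y IHx IHy|u v].
- by rewrite !scaler0 tr30 mulr0.
- by rewrite scalerDr !tr3D IHx IHy mulrDr.
- by rewrite -tensZl !tr3_tens emxZ -!scalemxAl mxtraceZ.
Qed.
Lemma tr3_tens3 a b c P Q R :
  tr3 (a \ox b \ox c) P Q R = \tr (X a *m P *m X b *m Q *m X c *m R).
Proof. by rewrite tr3_tens emx_tens. Qed.

Lemma tr3_tau123 t P Q R : tr3 (tau123 t) P Q R = tr3 t Q R P.
Proof.
have tl := @tau123_islin K A.
elim/tensor_ind: t => [|x y IHx IHy|d c].
- by rewrite (islin0 tl) !tr30.
- by rewrite (islinD _ _ tl) !tr3D IHx IHy.
have cl : islin (fun d => d \ox c) := bilin_islinl c (tens_bilin _ _).
elim/tensor_ind: d => [|x y IHx IHy|a b].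
- by rewrite tens0l (islin0 tl) !tr30.
- by rewrite tensDl (islinD _ _ tl) !tr3D IHx IHy.
rewrite tau123_tens !tr3_tens3 -!mulmxA mxtrace_mulC -!mulmxA mxtrace_mulC.
by rewrite -!mulmxA.
Qed.

Let db_lin : bilin db := db_bilin db_dbl.

Lemma tr3_dbL_ww a d P Q R : tr3 (dbL db (w a) d) (tau P) Q R =
  tr3 (dbL db a (tlift (fun x y => w x \ox w y) d)) P (tau R) (tau Q).
Proof.
have wwl := ww_islin w_lin; have dl a' := dbL_islin db_lin a'.
elim/tensor_ind: d => [|x y IHx IHy|u v].
- by rewrite (islin0 wwl) !(islin0 (dl _)) !tr30.
- by rewrite (islinD _ _ wwl) !(islinD _ _ (dl _)) !tr3D IHx IHy.
rewrite (ww_tens w_lin) !(dbL_tens db_lin) !tr3_tens -2!mulmxA tr_emx_dbw.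
by rewrite !(tauM alpha_typed) (Xw X_pt) !mulmxA.
Qed.

(** Moving [w] off the outer argument puts it on both factors of the inner bracket. Typedness turns
    these into the flip of the bracket of [w b] and [w c], whose antisymmetry gives the sign and the
    exchange of [b] with [c]. *)
Lemma tr3_db_ww a b c P Q R :
  tr3 (dbL db (w a) (db b c)) (tau P) Q R =
  - tr3 (dbL db a (db (w c) (w b))) P (tau R) (tau Q).
Proof.
by rewrite tr3_dbL_ww db_typed dbC (islinN _ (dbL_islin db_lin a)) tr3N.
Qed.

Lemma tr3_dbL_outer h a d P Q R :
  tr3 (dbL db a (outer (of_A0 e h) d (of_A0 e h))) P Q R =
  tr3 (dbL db a d) P Q (X (of_A0 e h) *m R *m X (of_A0 e h)).
Proof.
have dl := dbL_islin db_lin a; have ol := outer_islin (of_A0 e h) (of_A0 e h).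
elim/tensor_ind: d => [|x y IHx IHy|u v].
- by rewrite (islin0 ol) !(islin0 dl) !tr30.
- by rewrite (islinD _ _ ol) !(islinD _ _ dl) !tr3D IHx IHy.
rewrite outer_tens !(dbL_tens db_lin) !tr3_tens.
have -> : db a (of_A0 e h * u) = outer (of_A0 e h) (db a u) 1.
  by rewrite (db_leibr db_dbl) (db_A0r db_dbl) (islin0 (outer_islin 1 u)) add0r.
rewrite emx_outer X1 mulmx1 (XM X_pt) -!mulmxA mxtrace_mulC -!mulmxA.
by rewrite [in RHS]mxtrace_mulC -!mulmxA mxtrace_mulC -!mulmxA.
Qed.

Lemma tr3_dbL_inner h a d P Q R :
  tr3 (dbL db a (inner (of_A0 e h) d (of_A0 e h))) P Q R =
  tr3 (dbL db a d) P (X (of_A0 e h) *m Q *m X (of_A0 e h)) R.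
Proof.
have dl := dbL_islin db_lin a; have ol := inner_islin (of_A0 e h) (of_A0 e h).
elim/tensor_ind: d => [|x y IHx IHy|u v].
- by rewrite (islin0 ol) !(islin0 dl) !tr30.
- by rewrite (islinD _ _ ol) !(islinD _ _ dl) !tr3D IHx IHy.
rewrite inner_tens !(dbL_tens db_lin) !tr3_tens.
have -> : db a (u * of_A0 e h) = outer 1 (db a u) (of_A0 e h).
  by rewrite (db_leibr db_dbl) (db_A0r db_dbl) (islin0 (outer_islin u 1)) addr0.
by rewrite emx_outer X1 mul1mx (XM X_pt) !mulmxA.
Qed.

Lemma tr3_dbww_r a b c P Q R :
  tr3 (dbL db a (db b (w (w c)))) P Q (tau (tau R)) = tr3 (dbL db a (db b c)) P Q R.
Proof.
by rewrite wwE (db_A0_outer db_dbl) tr3_dbL_outer (tau_tau alpha_typed) -X_hA mulXhA.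
Qed.

Lemma tr3_dbww_m a b c P Q R :
  tr3 (dbL db a (db (w (w b)) c)) P (tau (tau Q)) R = tr3 (dbL db a (db b c)) P Q R.
Proof.
by rewrite wwE (db_A0_inner db_dbl) tr3_dbL_inner (tau_tau alpha_typed) -X_hA mulXhA.
Qed.

Definition dbdb_tr a P b Q c R : S := tr3 (dbL db a (db b c)) P Q R.

(** [nested_tr] is the value at [\tr (P X a)], [\tr (Q X b)], [\tr (R X c)] of the
    nested bracket [{-, {-, -}}] for Van den Bergh's bracket. *)
Definition nested_tr a P b Q c R : S := dbdb_tr a P b Q c R - dbdb_tr a P c R b Q.

Lemma nested_trC a P b Q c R : nested_tr a P c R b Q = - nested_tr a P b Q c R.
Proof. by rewrite /nested_tr opprB. Qed.

(** [tr3_db_ww] changes the sign and exchanges the inner arguments; [nested_tr] is antisymmetric in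
    them, so the signs cancel. *)
Lemma nested_tr_tau1 a P b Q c R :
  nested_tr (w a) (tau P) b Q c R = nested_tr a P (w b) (tau Q) (w c) (tau R).
Proof. by rewrite /nested_tr /dbdb_tr !tr3_db_ww opprK addrC. Qed.

Lemma nested_tr_tau2 a P b Q c R : nested_tr a P (w (w b)) (tau (tau Q)) c R = nested_tr a P b Q c R.
Proof. by rewrite /nested_tr /dbdb_tr tr3_dbww_m tr3_dbww_r. Qed.

(** By cyclicity of the trace the positive parts of the three terms form the triple bracket of [a],
    [b], [c], and the negative parts that of [a], [c], [b]. *)
Lemma nested_tr_cyclic a P b Q c R :
  nested_tr a P b Q c R + nested_tr b Q c R a P + nested_tr c R a P b Q =
  tr3 (triple_bracket db a b c) P Q R - tr3 (triple_bracket db a c b) P R Q.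
Proof. by rewrite /triple_bracket !tr3D !tr3_tau123 /nested_tr /dbdb_tr; ring. Qed.

Hypothesis db_qp : double_quasi_poisson e db.

(** Consecutive block-diagonal factors must sit in the same block, so the product of the three sums
    defining [bproj] collapses to one sum. *)
Lemma bproj3 U V W : \sum_s \tr (E s *m U *m E s *m V *m E s *m W) =
  \tr (bproj U *m bproj V *m bproj W).
Proof.
have bE s Z : E s *m bproj Z = E s *m Z *m E s.
  apply/matrixP=> i j; rewrite mul_blockE bprojE mulr_blockE mul_blockE.
  case: eqVneq => [<-|_]; last by rewrite !mul0r.
  by rewrite !mul1r [blk j == _]eq_sym; case: eqP; rewrite ?mulr1 ?mulr0.
rewrite {1}/bproj !mulmx_suml raddf_sum /=; apply: eq_bigr => s _.
rewrite -[in RHS](mulmxA (E s *m U)) bE !mulmxA.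
rewrite -[in RHS](mulmxA _ (E s) (bproj W)) bE !mulmxA.
by rewrite [RHS]mxtrace_mulC !mulmxA blockE_id.
Qed.

Lemma tr3_alt8 t1 t2 t3 t4 t5 t6 t7 t8 P Q R :
  tr3 (t1 - t2 - t3 + t4 - t5 + t6 + t7 - t8) P Q R =
  tr3 t1 P Q R - tr3 t2 P Q R - tr3 t3 P Q R + tr3 t4 P Q R
  - tr3 t5 P Q R + tr3 t6 P Q R + tr3 t7 P Q R - tr3 t8 P Q R.
Proof. by rewrite !(tr3B, tr3D). Qed.

Lemma tr3_triple a b c P Q R : tr3 (triple_bracket db a b c) P Q R =
  cst 4^-1 * \tr (bproj (commX a P) *m bproj (commX b Q) *m bproj (commX c R)).
Proof.
rewrite db_qp tr3Z tr3_sum -bproj3; congr (_ * _); apply: eq_bigr => s _.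
rewrite tr3_alt8 !tr3_tens3 !(XM X_pt) (Xe X_pt); exact: tr_comm3_rot.
Qed.

(** By [projg_commX], twice the projection of [commX a P] to the Lie algebra. *)
Definition commX_sym a P : M := bproj (commX a P) + bproj (commX (w a) (tau P)).

(** The twelve nested terms become four cyclic sums, one for each choice of [x] or [x'] and of [y]
    or [y']; [z] occurs only untwisted. *)
Lemma cyclic_regroup (T : Type) (f : T -> T -> T -> S) x x' y y' z :
  (forall x y z, f x z y = - f x y z) ->
  f x y z + f x y' z + f x' y z + f x' y' z
  - (f y x z + f y x' z + f y' x z + f y' x' z)
  + (f z x y + f z x' y + f z x' y' + f z x y') =
  (f x y z + f y z x + f z x y) + (f x y' z + f y' z x + f z x y')
  + (f x' y z + f y z x' + f z x' y) + (f x' y' z + f y' z x' + f z x' y').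
Proof.
move=> fC; rewrite (fC y x z) (fC y x' z) (fC y' x z) (fC y' x' z); ring.
Qed.

Lemma Jacobi_trace a P b Q c R :
  let ND a P b Q c R := nested_tr a P b Q c R + nested_tr a P (w b) (tau Q) c R
    + nested_tr (w a) (tau P) b Q c R + nested_tr (w a) (tau P) (w b) (tau Q) c R in
  ND a P b Q c R - ND b Q a P c R + ND c R a P b Q =
  cst 4^-1 * (\tr (commX_sym a P *m commX_sym b Q *m bproj (commX c R))
             - \tr (commX_sym a P *m bproj (commX c R) *m commX_sym b Q)).
Proof.
(* Twists of [c] occur only in the third group; they are moved onto [a] and [b], where the resulting
   double twists are undone. *)
move=> ND; rewrite /ND !(nested_tr_tau1 c) !(nested_tr_tau2 c).
pose f (x y z : A * M) := nested_tr x.1 x.2 y.1 y.2 z.1 z.2.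
have fC x y z : f x z y = - f x y z by apply: nested_trC.
pose x := (a, P); pose x' := (w a, tau P); pose y := (b, Q); pose y' := (w b, tau Q).
pose z := (c, R); pose J u v := f u v z + f v z u + f z u v.
have JE u v : J u v = cst 4^-1 *
   (\tr (bproj (commX u.1 u.2) *m bproj (commX v.1 v.2) *m bproj (commX c R))
  - \tr (bproj (commX u.1 u.2) *m bproj (commX c R) *m bproj (commX v.1 v.2))).
  by rewrite /J /f nested_tr_cyclic !tr3_triple mulrBr.
transitivity (J x y + J x y' + J x' y + J x' y').
  exact: (@cyclic_regroup _ f x x' y y' z fC).
rewrite !JE -!mulrDr /commX_sym; congr (_ * _).
exact: tr_expand.
Qed.

Section NestedBracket.
Variables (D : S -> S) (a : A) (P : M).
Hypotheses (DD : forall f g, D (f + g) = D f + D g)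
  (DM : forall f g, D (f * g) = D f * g + f * D g)
  (Dcst : forall k, D (cst k) = 0) (DX : forall b, map_mx D (X b) = Delta a P b).
Local Notation cmx := (map_mx cst).

Lemma der_map_mul (U V : M) : map_mx D (U *m V) = map_mx D U *m V + U *m map_mx D V.
Proof.
have D0 : D 0 = 0 by apply: (addrI (D 0)); rewrite -DD !addr0.
apply/matrixP=> i j; rewrite !mxE (big_morph D DD D0) -big_split.
by apply: eq_bigr => k _; rewrite DM !mxE.
Qed.

Lemma der_map_cst (Q : 'M[K]_N) : map_mx D (cmx Q) = 0.
Proof. by apply/matrixP=> i j; rewrite !mxE Dcst. Qed.

Lemma der_tr (U : M) : D (\tr U) = \tr (map_mx D U).
Proof.
have D0 : D 0 = 0 by apply: (addrI (D 0)); rewrite -DD !addr0.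
by rewrite /mxtrace (big_morph D DD D0); apply: eq_bigr => i _; rewrite mxE.
Qed.

(** The test matrices are constant, so [D] differentiates only the two tensor factors. The term with
    the second factor differentiated is rotated into the form of the first, which flips the tensor
    and exchanges [Q] with [R]. *)
Lemma der_tr_emx d (Q R : 'M[K]_N) : D (\tr (emx d (cmx Q) *m cmx R)) = h2 *
  (tr3 (dbL db a d) P (cmx Q) (cmx R) + tr3 (dbL db a (tflip d)) P (cmx R) (cmx Q)
   + (tr3 (dbL db (w a) d) (tau P) (cmx Q) (cmx R)
      + tr3 (dbL db (w a) (tflip d)) (tau P) (cmx R) (cmx Q))).
Proof.
have D0 : D 0 = 0 by apply: (addrI (D 0)); rewrite -DD !addr0.
have dl a' := dbL_islin db_lin a'.
elim/tensor_ind: d => [|x y IHx IHy|u v].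
- rewrite emx0 mul0mx mxtrace0 D0 (islin0 (@tflip_islin K A)) !(islin0 (dl _)) !tr30.
  by rewrite !addr0 mulr0.
- rewrite emxD mulmxDl mxtraceD DD IHx IHy (islinD _ _ (@tflip_islin K A)).
  by rewrite !(islinD _ _ (dl _)) !tr3D; ring.
rewrite emx_tens der_tr !der_map_mul !der_map_cst !DX !mulmx0 !addr0 tflip_tens.
rewrite !(dbL_tens db_lin) !tr3_tens mulmxDl mxtraceD /Delta.
set d1 := emx (db a u) P; set d2 := emx (db (w a) u) (tau P).
set d3 := emx (db a v) P; set d4 := emx (db (w a) v) (tau P).
have -> : \tr (h2 *: (d1 + d2) *m cmx Q *m X v *m cmx R) =
    h2 * (\tr (d1 *m cmx Q *m X v *m cmx R) + \tr (d2 *m cmx Q *m X v *m cmx R)).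
  by rewrite -!scalemxAl mxtraceZ !mulmxDl mxtraceD.
have -> : \tr (X u *m cmx Q *m (h2 *: (d3 + d4)) *m cmx R) =
    h2 * (\tr (d3 *m cmx R *m X u *m cmx Q) + \tr (d4 *m cmx R *m X u *m cmx Q)).
  have rot Z : \tr (X u *m cmx Q *m Z *m cmx R) = \tr (Z *m cmx R *m X u *m cmx Q).
    by rewrite -!mulmxA mulmxA mxtrace_mulC !mulmxA.
  by rewrite rot -!scalemxAl mxtraceZ !mulmxDl mxtraceD.
move: (\tr _) (\tr _) (\tr _) (\tr _) => t1 t2 t3 t4; ring.
Qed.

(** Flipped terms change sign by antisymmetry, the origin of the difference in [nested_tr]. Each of
    the two averages contributes one factor [h2]. *)
Lemma der_tr_Delta b (Q : 'M[K]_N) c (R : 'M[K]_N) :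
  D (\tr (Delta b (cmx Q) c *m cmx R)) = h2 * h2 *
  (nested_tr a P b (cmx Q) c (cmx R) + nested_tr a P (w b) (tau (cmx Q)) c (cmx R)
   + nested_tr (w a) (tau P) b (cmx Q) c (cmx R)
   + nested_tr (w a) (tau P) (w b) (tau (cmx Q)) c (cmx R)).
Proof.
rewrite /Delta -scalemxAl mxtraceZ mulmxDl mxtraceD DM Dcst mul0r add0r DD.
rewrite -(map_tau alpha_typed) !der_tr_emx !dbC !(islinN _ (dbL_islin db_lin _)) !tr3N.
rewrite /nested_tr /dbdb_tr -/h2.
move: (tr3 _ _ _ _) (tr3 _ _ _ _) (tr3 _ _ _ _) (tr3 _ _ _ _) => t1 t2 t3 t4.
move: (tr3 _ _ _ _) (tr3 _ _ _ _) (tr3 _ _ _ _) (tr3 _ _ _ _) => t5 t6 t7 t8.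
ring.
Qed.

End NestedBracket.

Lemma der_Delta_entry (D : S -> S) a i j
  (DD : forall f g, D (f + g) = D f + D g)
  (DM : forall f g, D (f * g) = D f * g + f * D g)
  (Dcst : forall k, D (cst k) = 0)
  (DX : forall b, map_mx D (X b) = Delta a (delta_mx j i) b) b k l c u v :
  let P := delta_mx j i in let Q := delta_mx l k in let R := delta_mx v u in
  D (Delta b Q c u v) = h2 * h2 *
  (nested_tr a P b Q c R + nested_tr a P (w b) (tau Q) c R
   + nested_tr (w a) (tau P) b Q c R + nested_tr (w a) (tau P) (w b) (tau Q) c R).
Proof.
move=> P Q R; rewrite -(tr_mul_delta (Delta b Q c)) -/R /R /Q -!(map_delta cst).
by rewrite (der_tr_Delta DD DM Dcst DX).
Qed.

Section GroupAction.
Variables (gam : S -> S) (g g' : M).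
Hypotheses (gamD : forall f h, gam (f + h) = gam f + gam h)
  (gamM : forall f h, gam (f * h) = gam f * gam h)
  (gam_cst : forall k, gam (cst k) = cst k)
  (gamX : forall b, map_mx gam (X b) = g' *m X b *m g)
  (tau_g : tau g = g') (tau_g' : tau g' = g).
Local Notation cmx := (map_mx cst).

Let gam0 : gam 0 = 0.
Proof. by apply: (addrI (gam 0)); rewrite -gamD !addr0. Qed.

Let map_gamM (U V : M) : map_mx gam (U *m V) = map_mx gam U *m map_mx gam V.
Proof.
apply/matrixP=> i j; rewrite !mxE (big_morph gam gamD gam0).
by apply: eq_bigr => k _; rewrite gamM !mxE.
Qed.

Let map_gamD (U V : M) : map_mx gam (U + V) = map_mx gam U + map_mx gam V.
Proof. by apply/matrixP=> i j; rewrite !mxE gamD. Qed.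

Let map_gamZ z (U : M) : map_mx gam (z *: U) = gam z *: map_mx gam U.
Proof. by apply/matrixP=> i j; rewrite !mxE gamM. Qed.

Lemma map_gam_cst (Q : 'M[K]_N) : map_mx gam (cmx Q) = cmx Q.
Proof. by apply/matrixP=> i j; rewrite !mxE gam_cst. Qed.

Lemma map_gam_emx d (Q : 'M[K]_N) :
  map_mx gam (emx d (cmx Q)) = g' *m emx d (g *m cmx Q *m g') *m g.
Proof.
elim/tensor_ind: d => [|x y IHx IHy|u v].
- by rewrite !emx0 mulmx0 mul0mx; apply/matrixP=> i j; rewrite !mxE gam0.
- by rewrite !emxD map_gamD IHx IHy mulmxDr mulmxDl.
- by rewrite !emx_tens !map_gamM map_gam_cst !gamX !mulmxA.
Qed.

(** The twisted summand transforms like the untwisted one because [tau] exchanges [g] and [g']. *)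
Lemma map_gam_Delta a (Q : 'M[K]_N) b :
  map_mx gam (Delta a (cmx Q) b) = g' *m Delta a (g *m cmx Q *m g') b *m g.
Proof.
rewrite /Delta map_gamZ map_gamD -(map_tau alpha_typed) !map_gam_emx gam_cst.
rewrite (map_tau alpha_typed) !(tauM alpha_typed) tau_g tau_g' -scalemxAr -scalemxAl.
by rewrite mulmxDr mulmxDl !mulmxA.
Qed.

End GroupAction.

(** The commutator of [Mx] and [My] lies in the Lie algebra, so against it the projection in [Mz]
    can be reduced to the block-diagonal part of [commX c R]. This reconciles the special role of
    [c] in the Jacobiator with the symmetry of the trivector. *)
Lemma tr_projg_comm a P b Q c R :
  let Mx := projg ty h2 (commX a P) in let My := projg ty h2 (commX b Q) in
  let Mz := projg ty h2 (commX c R) in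
  \tr (Mx *m (My *m Mz - Mz *m My)) = h2 * h2 *
    (\tr (commX_sym a P *m commX_sym b Q *m bproj (commX c R))
     - \tr (commX_sym a P *m bproj (commX c R) *m commX_sym b Q)).
Proof.
move=> Mx My Mz.
rewrite tr_mul_comm.
have bM Z : bdiag (projg ty h2 Z) := bdiag_projg alpha_typed h2 Z.
have tM Z : tau (projg ty h2 Z) = - projg ty h2 Z := tau_projg alpha_typed h2 Z.
have bN : bdiag (Mx *m My - My *m Mx).
  rewrite -[X in bdiag X]scale1r.
  by apply: bdiag_scaleB; apply: bdiag_mul; apply: bM.
rewrite tr_projg // ?cst2 //; last first.
  exact: (tau_comm alpha_typed (tM _) (tM _)).
rewrite -tr_bproj //.
have -> : Mx = h2 *: commX_sym a P by apply: projg_commX.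
have -> : My = h2 *: commX_sym b Q by apply: projg_commX.
exact: tr_comm_scale.
Qed.

Lemma quasi_Jacobi_trace a P b Q c R :
  let ND a P b Q c R := h2 * h2 * (nested_tr a P b Q c R + nested_tr a P (w b) (tau Q) c R
    + nested_tr (w a) (tau P) b Q c R + nested_tr (w a) (tau P) (w b) (tau Q) c R) in
  let Mx := projg ty h2 (commX a P) in let My := projg ty h2 (commX b Q) in
  let Mz := projg ty h2 (commX c R) in
  ND a P b Q c R - ND b Q a P c R + ND c R a P b Q =
  h2 * (h2 * \tr (Mx *m (My *m Mz - Mz *m My))).
Proof.
move=> ND Mx My Mz; rewrite /Mx /My /Mz tr_projg_comm.
have := Jacobi_trace a P b Q c R.
rewrite /ND; set N1 := (X in X - _); set N2 := (X in _ - X); set N3 := (X in _ + X).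
rewrite [X in X -> _]/=; set Tr := (X in cst 4^-1 * X).
(* The constant of the quasi-Poisson identity is absorbed by the halves that turn the two
   [commX_sym] into projections. *)
have -> : cst 4^-1 = h2 * h2.
  by rewrite /h2 -rmorphM /= -invfM -natrM.
exact: lin4.
Qed.

End Bracket.

(** * The Casimir element of the Lie algebra *)

Section Casimir.
Variables (d : nat) (F F' : d.-tuple 'M[K]_N).
Hypothesis FF' : dual_bases ty F F'.
Local Notation cmx := (map_mx cst).

(** Dual bases give the reproducing kernel of the trace form on the Lie algebra. The hypotheses
    provide a spanning set in [F], so the expansion is proved in [F] and transferred to [F'] by
    self-adjointness of the projection. *)
Lemma Casimir (Y : M) :
  \sum_a \tr (cmx (tnth F a) *m Y) *: cmx (tnth F' a) = projg ty h2 Y.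
Proof.
case: FF' => freeF LieF LieF' dualF.
have LieK (x : 'M[K]_N) : inLie ty x -> x = \sum_a \tr (tnth F' a *m x) *: tnth F a.
  move/LieF/coord_span => xE; rewrite {1}xE; apply: eq_bigr => a _.
  rewrite -(tnth_nth 0) mxtrace_mulC; congr (_ *: _).
  rewrite {2}xE mulmx_suml raddf_sum (sum_single (i := a)) => [|b ba] /=.
    by rewrite -(tnth_nth 0) -scalemxAl mxtraceZ dualF eqxx mulr1.
  by rewrite -(tnth_nth 0) -scalemxAl mxtraceZ dualF (negPf ba) mulr0.
have hK : 2^-1 + 2^-1 = 1 :> K.
  by rewrite -mulr2n -[LHS]mulr_natr mulVf // Num.Theory.pnatr_eq0.
have prF' (Y' : M) : \sum_a \tr (cmx (tnth F' a) *m Y') *: cmx (tnth F a) = projg ty h2 Y'.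
  (* The projection of an elementary matrix has entries in the base field, where the expansion
     [LieK] applies. *)
  apply: (mx_lin_ext (f := fun Y' => \sum_a \tr (cmx (tnth F' a) *m Y') *: cmx (tnth F a))
    (g := projg ty h2)) => [z Y1 Y2||i j].
  - rewrite scaler_sumr -big_split; apply: eq_bigr => a _ /=.
    by rewrite mulmxDr -scalemxAr mxtraceD mxtraceZ scalerDl scalerA.
  - exact: projg_lin.
  have := congr1 (map_mx cst) (LieK _ (inLie_projg alpha_typed 2^-1 (delta_mx i j))).
  rewrite (map_projg alpha_typed cst) (map_delta cst) => ->.
  rewrite -(map_delta cst) map_mx_sum; apply: eq_bigr => a _; rewrite map_mxZ; congr (_ *: _).
  rewrite -map_mxM trace_map_mx; congr (cst _).
  by have /(inLieP alpha_typed)[bF tF] := LieF' a; rewrite tr_projg.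
apply: tr_mul_inj => Z; rewrite -tr_projg_sym // -prF' mulmx_suml mulmx_sumr !raddf_sum /=.
apply: eq_bigr => a _; rewrite -scalemxAl -scalemxAr !mxtraceZ mulrC.
by rewrite [X in _ * X]mxtrace_mulC.
Qed.

End Casimir.
End TypedPoints.

(** * The trivector field of the trace form *)
Section Determinant.
Variable S : comPzRingType.

Lemma det3 (m : 'M[S]_3) : \det m =
    m 0 0 * m 1 1 * m ord_max ord_max - m 0 0 * m 1 ord_max * m ord_max 1
  - m 0 1 * m 1 0 * m ord_max ord_max + m 0 1 * m 1 ord_max * m ord_max 0
  + m 0 ord_max * m 1 0 * m ord_max 1 - m 0 ord_max * m 1 1 * m ord_max 0.
Proof.
have o1 : lift 0 0 = 1 :> 'I_3 by apply: val_inj.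
have o2 : lift 0 1 = ord_max :> 'I_3 by apply: val_inj.
rewrite (expand_det_row _ 0) !big_ord_recl big_ord0 /cofactor.
have det2 (q : 'M[S]_2) : \det q = q 0 0 * q 1 1 - q 0 1 * q 1 0.
  rewrite (expand_det_row _ 0) !big_ord_recl big_ord0 /cofactor !det_mx11 !mxE /=.
  have -> : lift 0 0 = 1 :> 'I_2 by apply: val_inj.
  have -> : lift 1 0 = 0 :> 'I_2 by apply: val_inj.
  by rewrite /bump /= expr0 expr1; ring.
rewrite !det2 !mxE.
have l10 : lift (lift 0 0) 0 = 0 :> 'I_3 by apply: val_inj.
have l11 : lift (lift 0 0) 1 = ord_max :> 'I_3 by apply: val_inj.
have l20 : lift (lift 0 (lift 0 0)) 0 = 0 :> 'I_3 by apply: val_inj.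
have l21 : lift (lift 0 (lift 0 0)) 1 = 1 :> 'I_3 by apply: val_inj.
have l22 : lift 0 (lift 0 0) = ord_max :> 'I_3 by apply: val_inj.
rewrite l10 l11 l20 l21 l22 !o1 !o2 /= /bump /= expr0 expr1 sqrrN expr1n.
move: (m 0 0) (m 0 1) (m 0 _) (m 1 0) (m 1 1) (m 1 _) (m _ 0) (m _ 1) (m _ _).
by move=> *; ring.
Qed.

(** The left side is the Leibniz formula of a determinant, which avoids enumerating the
    permutations. *)
Lemma sum_perm3 (m : 'I_3 -> 'I_3 -> S) :
  \sum_(s : 'S_3) (-1) ^+ s * \prod_(i < 3) m i (s i) =
    m 0 0 * m 1 1 * m ord_max ord_max - m 0 0 * m 1 ord_max * m ord_max 1
  - m 0 1 * m 1 0 * m ord_max ord_max + m 0 1 * m 1 ord_max * m ord_max 0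
  + m 0 ord_max * m 1 0 * m ord_max 1 - m 0 ord_max * m 1 1 * m ord_max 0.
Proof.
transitivity (\det (\matrix_(i, j) m i j)); last by rewrite det3 !mxE.
by apply: eq_bigr => s _; congr (_ * _); apply: eq_bigr => i _; rewrite mxE.
Qed.

(** The hypotheses make [t] antisymmetric under all permutations; renaming the summation indices
    turns each of the six signed terms into the first. *)
Lemma sum3_alt d (t G : 'I_d -> 'I_d -> 'I_d -> S) :
  (forall a b c, t a c b = - t a b c) -> (forall a b c, t b c a = t a b c) ->
  \sum_a \sum_b \sum_c t a b c * (G a b c - G a c b - G b a c + G b c a + G c a b - G c b a)
  = 6%:R * \sum_a \sum_b \sum_c t a b c * G a b c.
Proof.
move=> tC tR; set T := (X in _ = _ * X).
have tB a b c : t b a c = - t a b c by rewrite -tR tC tR.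
have sw12 (f : 'I_d -> 'I_d -> 'I_d -> S) :
    \sum_a \sum_b \sum_c f a b c = \sum_a \sum_b \sum_c f b a c by rewrite exchange_big.
have sw23 (f : 'I_d -> 'I_d -> 'I_d -> S) :
    \sum_a \sum_b \sum_c f a b c = \sum_a \sum_b \sum_c f a c b.
  by apply: eq_bigr => a _; rewrite exchange_big.
have neg (f : 'I_d -> 'I_d -> 'I_d -> S) :
    \sum_a \sum_b \sum_c - f a b c = - \sum_a \sum_b \sum_c f a b c.
  rewrite -sumrN; apply: eq_bigr => a _; rewrite -sumrN; apply: eq_bigr => b _.
  by rewrite sumrN.
have add (f g : 'I_d -> 'I_d -> 'I_d -> S) :
    \sum_a \sum_b \sum_c (f a b c + g a b c) =
    \sum_a \sum_b \sum_c f a b c + \sum_a \sum_b \sum_c g a b c.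
  rewrite -big_split; apply: eq_bigr => a _; rewrite -big_split; apply: eq_bigr => b _.
  by rewrite -big_split.
have eq3 (f g : 'I_d -> 'I_d -> 'I_d -> S) : (forall a b c, f a b c = g a b c) ->
    \sum_a \sum_b \sum_c f a b c = \sum_a \sum_b \sum_c g a b c.
  by move=> E; do 3!apply: eq_bigr => ? _; apply: E.
have Tacb : \sum_a \sum_b \sum_c t a b c * G a c b = - T.
  rewrite (sw23 (fun a b c => t a b c * G a c b)) -neg; apply: eq3 => a b c.
  by rewrite tC mulNr.
have Tbac : \sum_a \sum_b \sum_c t a b c * G b a c = - T.
  rewrite (sw12 (fun a b c => t a b c * G b a c)) -neg; apply: eq3 => a b c.
  by rewrite tB mulNr.
have Tbca : \sum_a \sum_b \sum_c t a b c * G b c a = T.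
  rewrite (sw12 (fun a b c => t a b c * G b c a)).
  rewrite (sw23 (fun a b c => t b a c * G a c b)); apply: eq3 => a b c.
  by rewrite -(tR c a b).
have Tcab : \sum_a \sum_b \sum_c t a b c * G c a b = T.
  rewrite (sw23 (fun a b c => t a b c * G c a b)).
  rewrite (sw12 (fun a b c => t a c b * G b a c)); apply: eq3 => a b c.
  by rewrite tR.
have Tcba : \sum_a \sum_b \sum_c t a b c * G c b a = - T.
  rewrite (sw12 (fun a b c => t a b c * G c b a)).
  rewrite (sw23 (fun a b c => t b a c * G c a b)).
  rewrite (sw12 (fun a b c => t c a b * G b a c)) -neg; apply: eq3 => a b c.
  by rewrite tC -(tR c a b) mulNr.
transitivity (\sum_a \sum_b \sum_c (t a b c * G a b c + (- (t a b c * G a c b)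
   + (- (t a b c * G b a c) + (t a b c * G b c a + (t a b c * G c a b
   + - (t a b c * G c b a))))))).
  by apply: eq3 => a b c; ring.
by rewrite !add !neg Tacb Tbac Tbca Tcab Tcba -/T; ring.
Qed.

End Determinant.

(** * The bracket on the coordinate ring *)
Section RepSpace.
Variables (K : numFieldType) (n : nat) (A : algType K) (e : 'I_n -> A).
Variables (ty : 'I_n -> gtype) (w : A -> A) (alpha : 'I_n -> nat).
Hypotheses (A_A0 : A0_algebra e) (w_tai : typed_anti_involution ty e w).
Hypothesis alpha_typed : typed_dim ty alpha.

Local Notation N := (\sum_s alpha s)%N.
Local Notation O := (repO ty alpha e w).
Local Notation rel := (@rep_rel K n ty alpha A e w).
Local Notation cst := (ccst rel).
Local Notation X := (Xmx ty alpha e w).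
Local Notation x_ := (rcoord ty (alpha := alpha) e w).
Local Notation M := 'M[O]_N.
Local Notation cmx := (map_mx cst).
Implicit Types (P Q R Z : M) (a b c : A).

Lemma cevalS (K' Y : Type) (S : pzSemiRingType) (io : K' -> S) v
    (I : Type) (r : seq I) (k0 : K') (F : I -> expr K' Y) : io k0 = 0 ->
  ceval io v (\big[Add/Cst k0]_(i <- r) F i) = \sum_(i <- r) ceval io v (F i).
Proof. by move=> k00; apply: big_morph => [p q|] //=. Qed.

Lemma cdevalS (K' Y : Type) (S : pzSemiRingType) (io : K' -> S) v d
    (I : Type) (r : seq I) (k0 : K') (F : I -> expr K' Y) :
  cdeval io v d (\big[Add/Cst k0]_(i <- r) F i) =
  \sum_(i <- r) cdeval io v d (F i).
Proof. by apply: big_morph => [p q|] //=. Qed.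

(** The tautological point, through which the trace identities for points become identities between
    functions. *)
Lemma X_point : typed_point e ty w cst X.
Proof.
split=> [k a b|a b|s|a]; apply/matrixP=> i j; rewrite ?tauE // !mxE.
- have /cpiP := ceq_rel (rep_lin ty e w k a b i j).
  by rewrite /rcoord /cgen => ->; rewrite cpiE.
- have /cpiP := ceq_rel (rep_mul ty e w a b i j).
  rewrite /rcoord /cgen => ->; rewrite cpiE cevalS //=.
  by apply: eq_bigr => r _; rewrite !mxE.
- have /cpiP := ceq_rel (rep_idem ty e w s i j).
  by rewrite /rcoord /cgen => ->; rewrite cpiE /= rmorph_nat.
- have /cpiP := ceq_rel (rep_inv ty e w a i j).
  rewrite /rcoord /cgen => ->; rewrite cpiE /= sgn2_alphaE // rmorphM /=.
  by rewrite !rmorph_sign.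
Qed.

Lemma rep_morph_compat (V : A -> M) : typed_point e ty w cst V ->
  forall p q, rel p q ->
    ceval (@ccst _ _ rel) (fun x => let: (a, i, j) := x in V a i j) p =
    ceval (@ccst _ _ rel) (fun x => let: (a, i, j) := x in V a i j) q.
Proof.
move=> [Vl Vm Ve Vw] p q [k a b i j|a b i j|s i j|a i j] /=.
- by rewrite Vl !mxE.
- by rewrite Vm mxE cevalS.
- by rewrite Ve mxE rmorph_nat.
- by rewrite Vw tauE // sgn2_alphaE // rmorphM /= !rmorph_sign.
Qed.

(** The hypotheses are the conditions of [typed_point] linearized at the tautological point. *)
Lemma rep_der_compat (D : A -> M) :
  (forall k a b, D (k *: a + b) = cst k *: D a + D b) ->
  (forall a b, D (a * b) = D a *m X b + X a *m D b) ->
  (forall s, D (e s) = 0) ->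
  (forall a, D (w a) = tau ty (D a)) ->
  forall p q, rel p q ->
    cdeval (@ccst _ _ rel) (@cgen _ _ rel) (fun x => let: (a, i, j) := x in D a i j) p =
    cdeval (@ccst _ _ rel) (@cgen _ _ rel) (fun x => let: (a, i, j) := x in D a i j) q.
Proof.
move=> Dl Dm De Dw p q [k a b i j|a b i j|s i j|a i j] /=.
- by rewrite Dl !mxE mul0r add0r.
- rewrite Dm !mxE cdevalS /= -big_split /=.
  by apply: eq_bigr => r _; rewrite !mxE.
- by rewrite De mxE.
- by rewrite Dw tauE // sgn2_alphaE // rmorphM /= !rmorph_sign mul0r add0r.
Qed.

Section Bracket.
Variable db : A -> A -> tensor A A.
Hypotheses (db_dbl : is_double_bracket e db) (db_typed : typed_double_bracket w db).
Local Notation De := (Delta ty w cst X db).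

Definition bracket_gen (x y : A * 'I_N * 'I_N) : O :=
  let: (a, i, j) := x in let: (b, k, l) := y in De a (delta_mx j i) b k l.

Lemma bracket_gen_antisym x y : bracket_gen x y = - bracket_gen y x.
Proof.
case: x => [[a i] j]; case: y => [[b k] l].
exact: (Delta_antisym A_A0 w_tai alpha_typed X_point db_dbl db_typed).
Qed.

Lemma bracket_exists : exists br : O -> O -> O,
  [/\ forall f, cder id (br f), forall f g, br f g = - br g f &
      forall a b i j k l, br (x_ a i j) (x_ b k l) = De a (delta_mx j i) b k l].
Proof.
have [x p q|br [brd bra brg]] := biderivation_exists bracket_gen_antisym.
  case: x => [[a i] j]; apply: (rep_der_compat (D := De a (delta_mx j i))).
  - exact: (Delta_lin X_point db_dbl).
  - exact: (Delta_mul A_A0 X_point db_dbl).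
  - exact: (Delta_idem X_point db_dbl).
  - exact: (Delta_w A_A0 w_tai alpha_typed X_point db_dbl db_typed).
by exists br; split=> // a b i j k l; apply: brg.
Qed.

Lemma mul_delta_mx2 (U V : M) i j k l : (U *m delta_mx j i *m V) k l = U k j * V i l.
Proof.
rewrite mxE (sum_single (i := i)) => [|r ri].
  rewrite mxE (sum_single (i := j)) => [|p pj]; first by rewrite mxE !eqxx mulr1.
  by rewrite mxE (negPf pj) mulr0.
rewrite mxE (sum_single (i := j)) => [|p pj]; rewrite mxE ?(negPf ri) ?andbF ?mulr0 ?mul0r //.
Qed.

Lemma rcoord_islin i j : islin (fun a => x_ a i j).
Proof.
move=> k a b; have := congr1 (fun U : M => U i j) (X_lin X_point k a b).
by rewrite !mxE.
Qed.

Lemma entry2_bilin k j i l : bilin (fun d' d'' => x_ d' k j * x_ d'' i l).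
Proof.
split=> [c u u' v|c u v v']; rewrite rcoord_islin !calg_scaleE; ring.
Qed.

Lemma entry2E d k j i l : entry2 ty e w d k j i l = emx X d (delta_mx j i) k l.
Proof.
elim/tensor_ind: d => [|x y IHx IHy|u v].
- by rewrite (emx0 X_point) mxE /entry2 (islin0 (tlift_islin (entry2_bilin k j i l))).
- rewrite (emxD X_point) mxE -IHx -IHy.
  by rewrite /entry2 (islinD _ _ (tlift_islin (entry2_bilin k j i l))).
- rewrite (emx_tens X_point) mul_delta_mx2 !mxE.
  exact: (tliftE _ _ (entry2_bilin k j i l)).
Qed.

(** [tau] sends an elementary matrix to a signed elementary matrix with indices [theta i] and
    [theta j]: this is the origin of the sign and of the indices in the second term of the
    formula. *)
Lemma bracket_formulaE br : bracket_formula db br <->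
  forall a b i j k l, br (x_ a i j) (x_ b k l) = De a (delta_mx j i) b k l.
Proof.
suff H a b i j k l : De a (delta_mx j i) b k l =
    2^-1 *: entry2 ty e w (db a b) k j i l +
    (2^-1 * sgn2_alpha K ty (theta ty i) (theta ty j)) *:
        entry2 ty e w (db (w a) b) k (theta ty i) (theta ty j) l.
  by split=> E a b i j k l; rewrite E H.
rewrite !entry2E /Delta tau_delta // sgn2_alphaE // !thetaK // !calg_scaleE.
rewrite (emx_Zr X_point) rmorphM /= rmorphM /= !rmorph_sign -mulrA -mulrDr.
by rewrite [LHS]mxE; congr (_ * _); rewrite [LHS]mxE; congr (_ + _); rewrite [LHS]mxE.
Qed.

Lemma bracket_antisym_bider (br : O -> O -> O) :
  (forall f, cder id (br f)) -> (forall f g, br f g = - br g f) ->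
  antisym_biderivation br.
Proof.
move=> brd bra; split=> //; last by move=> f g h; rewrite (cderM (brd f)).
have br_r k f g g' : br f (k *: g + g') = k *: br f g + br f g'.
  by rewrite (cderD (brd f)) (cderZ _ _ (cmorph_id _) (brd f)).
split=> // k g g' f; rewrite bra br_r (bra g) (bra g').
by rewrite opprD -scalerN.
Qed.

Lemma antisym_bider_der (br : O -> O -> O) f :
  antisym_biderivation br -> cder id (br f).
Proof.
move=> [[_ br_r] _ leib].
have brD g h : br f (g + h) = br f g + br f h.
  by have := br_r 1 f g h; rewrite !scale1r.
have br1 : br f 1 = 0.
  have := leib f 1 1; rewrite !mulr1 mul1r => E1.
  by apply: (addrI (br f 1)); rewrite addr0 -E1.
have br0 : br f 0 = 0 by apply: (addrI (br f 0)); rewrite -brD !addr0.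
split=> // k; have := br_r k f 1 0; rewrite !addr0 br1 br0 addr0 scaler0.
by rewrite calg_scaleE mulr1.
Qed.

Lemma bracket_unique (br br' : O -> O -> O) :
  antisym_biderivation br -> bracket_formula db br ->
  antisym_biderivation br' -> bracket_formula db br' -> br' =2 br.
Proof.
move=> bd bf bd' bf' f g.
apply: (cder_ext (antisym_bider_der f bd') (antisym_bider_der f bd)) => -[[b k] l].
rewrite (br_antisym bd') (br_antisym bd); congr (- _).
apply: (cder_ext (antisym_bider_der _ bd') (antisym_bider_der _ bd)) => -[[a i] j].
by rewrite bf bf'.
Qed.

End Bracket.
End RepSpace.

(** * Contraction with the structure constants *)

Section PsiSum.
Variables (K : fieldType) (S : comPzRingType) (cst : {rmorphism K -> S}) (N d : nat).
Variables (F' : d.-tuple 'M[K]_N) (g : 'I_3 -> 'I_d -> S).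
Local Notation cmx := (map_mx cst).
Local Notation t a b c :=
  (\tr (tnth F' a *m (tnth F' b *m tnth F' c - tnth F' c *m tnth F' b))).

Lemma tr_sumr (Z : 'M[S]_N) (h : 'I_d -> S) (G : 'I_d -> 'M[S]_N) :
  \tr (Z *m (\sum_a h a *: G a)) = \sum_a h a * \tr (Z *m G a).
Proof.
rewrite mulmx_sumr raddf_sum; apply: eq_bigr => a _ /=.
by rewrite -scalemxAr mxtraceZ.
Qed.

Lemma tr_suml (Z : 'M[S]_N) (h : 'I_d -> S) (G : 'I_d -> 'M[S]_N) :
  \tr ((\sum_a h a *: G a) *m Z) = \sum_a h a * \tr (G a *m Z).
Proof.
rewrite mxtrace_mulC tr_sumr; apply: eq_bigr => a _.
by rewrite mxtrace_mulC.
Qed.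

(** [M i] gathers the action of the whole basis on one function, so the contraction becomes a single
    trace. The 6 is the number of permutations, which contribute equally because the structure
    constants are totally antisymmetric. *)
Lemma psi_sum :
  let M i := \sum_a g i a *: cmx (tnth F' a) in
  \sum_a \sum_b \sum_c cst (t a b c) *
    (\sum_(s : 'S_3) (-1) ^+ s * \prod_(i < 3) g i (tnth [tuple a; b; c] (s i))) =
  6%:R * \tr (M 0 *m (M 1 *m M ord_max - M ord_max *m M 1)).
Proof.
move=> M; pose G a b c := g 0 a * g 1 b * g ord_max c.
transitivity (\sum_a \sum_b \sum_c cst (t a b c) *
    (G a b c - G a c b - G b a c + G b c a + G c a b - G c b a)).
  apply: eq_bigr => a _; apply: eq_bigr => b _; apply: eq_bigr => c _.
  rewrite (sum_perm3 (fun i j => g i (tnth [tuple a; b; c] j))).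
  by rewrite !(tnth_nth a).
rewrite (sum3_alt (t := fun a b c => cst (t a b c))) => [|a b c|a b c]; last 2 first.
- by rewrite -(opprB (tnth F' b *m _)) mulmxN mxtraceN rmorphN.
- by congr (cst _); rewrite tr_mul_comm mxtrace_mulC.
congr (_ * _); rewrite tr_suml; apply: eq_bigr => a _.
rewrite tr_mul_comm tr_sumr mulr_sumr exchange_big; apply: eq_bigr => c _ /=.
rewrite -tr_mul_comm.
set L := cmx (tnth F' a); set Y := cmx (tnth F' c).
rewrite tr_comm_opp.
rewrite tr_sumr -sumrN !mulr_sumr; apply: eq_bigr => b _ /=.
rewrite -tr_mul_comm -(opprB (cmx (tnth F' b) *m Y)) mulmxN mxtraceN.
rewrite /L /Y -!map_mxM -map_mxB -map_mxM trace_map_mx /G; ring.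
Qed.

End PsiSum.

(** * The quasi-Poisson property *)
Section Poisson.
Variables (K : numFieldType) (n : nat) (A : algType K) (e : 'I_n -> A).
Variables (ty : 'I_n -> gtype) (w : A -> A) (alpha : 'I_n -> nat).
Hypotheses (A_A0 : A0_algebra e) (w_tai : typed_anti_involution ty e w).
Hypothesis alpha_typed : typed_dim ty alpha.

Local Notation N := (\sum_s alpha s)%N.
Local Notation O := (repO ty alpha e w).
Local Notation rel := (@rep_rel K n ty alpha A e w).
Local Notation cst := (ccst rel).
Local Notation X := (Xmx ty alpha e w).
Local Notation x_ := (rcoord ty (alpha := alpha) e w).
Local Notation M := 'M[O]_N.
Local Notation cmx := (map_mx cst).
Local Notation X_pt := (X_point e w alpha_typed).
Implicit Types (P Q R Z : M) (a b c : A).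

Section InfinitesimalAction.
Variable xi : 'M[K]_N.
Hypothesis xi_Lie : inLie ty xi.

Lemma commute_Lie_compat p q : rel p q ->
    cdeval (@ccst _ _ rel) (@cgen _ _ rel) (fun x => let: (a, i, j) := x in
       (X a *m cmx xi - cmx xi *m X a) i j) p =
    cdeval (@ccst _ _ rel) (@cgen _ _ rel) (fun x => let: (a, i, j) := x in
       (X a *m cmx xi - cmx xi *m X a) i j) q.
Proof.
have /(inLieP alpha_typed)[bxi txi] := xi_Lie.
apply: (rep_der_compat alpha_typed (D := fun a => X a *m cmx xi - cmx xi *m X a)).
- move=> k a b; exact: (comm_lin X_pt).
- move=> a b; exact: (comm_mul X_pt).
- move=> s; apply: (comm_idem X_pt).
  by move=> i j ij; rewrite mxE bxi // rmorph0.
- move=> a; apply: (comm_tau alpha_typed X_pt).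
  by rewrite -(map_tau alpha_typed) txi map_mxN.
Qed.

Lemma inf_act_der : cder id (inf_act xi : O -> O).
Proof. exact: cderiv_cder commute_Lie_compat. Qed.

Lemma inf_act_gen a i j :
  inf_act xi (x_ a i j) = \tr (cmx xi *m commX X a (delta_mx j i)).
Proof. rewrite [LHS](cderiv_gen commute_Lie_compat); exact: tr_commX. Qed.

End InfinitesimalAction.

Section Psi.
Variables (d : nat) (F F' : d.-tuple 'M[K]_N).
Hypothesis FF' : dual_bases ty F F'.

Lemma Lie_F (a : 'I_d) : inLie ty (tnth F a).
Proof. by case: FF' => _ LieF _ _; apply/LieF/memv_span/mem_tnth. Qed.

(** The Lie algebra element with coefficients in functions that represents [xi |-> inf_act xi f] for
    the trace form. *)
Definition infmx (f : O) : M := \sum_a inf_act (tnth F a) f *: cmx (tnth F' a).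

Lemma infmx_gen a i j :
  infmx (x_ a i j) = projg ty (cst 2^-1) (commX X a (delta_mx j i)).
Proof.
rewrite -(Casimir alpha_typed _ FF'); apply: eq_bigr => b _.
by rewrite (inf_act_gen (Lie_F b)).
Qed.

Lemma psiM_unfold (f1 f2 f3 : O) : psiM F F' f1 f2 f3 = cst 12^-1 *
  \sum_a \sum_b \sum_c
    cst (\tr (tnth F' a *m (tnth F' b *m tnth F' c - tnth F' c *m tnth F' b))) *
    \sum_(s : 'S_3) (-1) ^+ s * \prod_(i < 3)
      inf_act (tnth F (tnth [tuple a; b; c] (s i))) (tnth [tuple f1; f2; f3] i).
Proof.
have scE k (f : O) : k *: f = cst k * f by [].
rewrite /psiM scE; apply: congr1; apply: eq_bigr => a _; apply: eq_bigr => b _.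
apply: eq_bigr => c _; rewrite scE; apply: congr1; apply: eq_bigr => s _.
have -> : (-1) ^+ s = cst ((-1) ^+ s) :> O by rewrite rmorph_sign.
rewrite scE; apply: congr1; apply: eq_bigr => i _; apply: (congr1 (fun x => inf_act x _)).
by case: (s i) => [[|[|[|m]]] lt_m] //=; rewrite !(tnth_nth (tnth F a)) /= (tnth_nth a).
Qed.

Lemma psiME (f1 f2 f3 : O) : psiM F F' f1 f2 f3 =
  cst 2^-1 * \tr (infmx f1 *m (infmx f2 *m infmx f3 - infmx f3 *m infmx f2)).
Proof.
rewrite psiM_unfold.
rewrite (psi_sum cst F' (fun i (a : 'I_d) => inf_act (tnth F a) (tnth [tuple f1; f2; f3] i))).
have -> : (6%:R : O) = cst 6%:R by rewrite rmorph_nat.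
rewrite mulrA -rmorphM /=.
have -> : 12^-1 * 6 = 2^-1 :> K.
  have n6 : 6%:R != 0 :> K by rewrite Num.Theory.pnatr_eq0.
  rewrite (_ : 12%:R = 2%:R * 6%:R); last by rewrite -natrM.
  by rewrite invfM mulfVK.
by [].
Qed.

Lemma psi_cyclic (f1 f2 f3 : O) : psiM F F' f1 f2 f3 = psiM F F' f2 f3 f1.
Proof. by rewrite !psiME (tr_comm_cyc (infmx f1)). Qed.

Lemma psi_der (f1 f2 : O) : cder id (psiM F F' f1 f2).
Proof.
have E1 f3 : psiM F F' f1 f2 f3 = \sum_a
    (cst 2^-1 * \tr ((infmx f1 *m infmx f2 - infmx f2 *m infmx f1) *m cmx (tnth F' a)))
    * inf_act (tnth F a) f3.
  rewrite psiME tr_mul_comm tr_sumr mulr_sumr; apply: eq_bigr => a _.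
  by rewrite mulrCA mulrC.
have -> : psiM F F' f1 f2 = fun f3 => \sum_a
    (cst 2^-1 * \tr ((infmx f1 *m infmx f2 - infmx f2 *m infmx f1) *m cmx (tnth F' a)))
    * inf_act (tnth F a) f3 by apply/funext.
by apply: cder_bigsum => a; apply/cder_lscale/inf_act_der/Lie_F.
Qed.

End Psi.

(** Cyclic symmetry brings each argument in turn to the last place, where the derivation property is
    given. *)
Lemma trider_ext (T T' : O -> O -> O -> O) :
  (forall f g, cder id (T f g)) -> (forall f g, cder id (T' f g)) ->
  (forall f g h, T f g h = T g h f) -> (forall f g h, T' f g h = T' g h f) ->
  (forall a b c i j k l u v, T (x_ a i j) (x_ b k l) (x_ c u v) =
     T' (x_ a i j) (x_ b k l) (x_ c u v)) -> forall f g h, T f g h = T' f g h.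
Proof.
move=> dT dT' cT cT' E f g h.
apply: (cder_ext (dT f g) (dT' f g)) => -[[c u] v]; rewrite -cT -cT'.
apply: (cder_ext (dT _ f) (dT' _ f)) => -[[b k] l]; rewrite -cT -cT'.
apply: (cder_ext (dT _ _) (dT' _ _)) => -[[a i] j]; rewrite -cT -cT'.
exact: E.
Qed.

Section Bracket.
Variable db : A -> A -> tensor A A.
Hypotheses (db_dbl : is_double_bracket e db) (db_typed : typed_double_bracket w db).
Hypothesis db_qp : double_quasi_poisson e db.
Local Notation De := (Delta ty w cst X db).
Variable br : O -> O -> O.
Hypotheses (brd : forall f, cder id (br f)) (bra : forall f g, br f g = - br g f).
Hypothesis brg : forall a b i j k l, br (x_ a i j) (x_ b k l) = De a (delta_mx j i) b k l.

Lemma map_br_X a i j b : map_mx (br (x_ a i j)) (X b) = De a (delta_mx j i) b.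
Proof. by apply/matrixP=> k l; rewrite [LHS]mxE [X b k l]mxE brg. Qed.

Lemma nested_bracket a i j b k l c u v :
  let P := delta_mx j i in let Q := delta_mx l k in let R := delta_mx v u in
  br (x_ a i j) (br (x_ b k l) (x_ c u v)) = cst 2^-1 * cst 2^-1 *
  (nested_tr X db a P b Q c R + nested_tr X db a P (w b) (tau ty Q) c R
   + nested_tr X db (w a) (tau ty P) b Q c R + nested_tr X db (w a) (tau ty P) (w b) (tau ty Q) c R).
Proof.
rewrite brg; have bx := brd (x_ a i j).
apply: (der_Delta_entry alpha_typed X_pt db_dbl (cderD bx) (cderM bx) (cderC bx)).
exact: map_br_X.
Qed.

Lemma quasi_Jacobi d (F F' : d.-tuple 'M[K]_N) : dual_bases ty F F' ->
  forall f g h, br f (br g h) + br g (br h f) + br h (br f g) =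
    2^-1 *: psiM F F' f g h.
Proof.
move=> FF'; apply: trider_ext => [f g|f g|f g h|f g h|a b c i j k l u v].
(* In this form the Jacobiator is the commutator of the derivations [br f] and [br g] minus
   [br (br f g)], hence a derivation in [h]. *)
- have E1 h : br f (br g h) + br g (br h f) + br h (br f g) =
      br f (br g h) + - br g (br f h) + - br (br f g) h.
    by rewrite (bra h f) (cderN (brd g)) (bra h).
  rewrite (_ : (fun h => _) = fun h => br f (br g h) + - br g (br f h) + - br (br f g) h);
    last by apply/funext.
  apply: cder_add; last exact/cder_opp/brd.
  exact: cder_comm (brd f) (brd g).
- have -> : (fun h => 2^-1 *: psiM F F' f g h) = fun h => cst 2^-1 * psiM F F' f g h.
    by apply/funext => h; rewrite calg_scaleE.
  exact/cder_lscale/psi_der.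
- by rewrite -addrA addrC.
- by rewrite psi_cyclic.
(* The middle term is turned around so that the three nested brackets have the argument order of
   [quasi_Jacobi_trace]. *)
rewrite (bra (x_ c u v) (x_ a i j)) (cderN (brd _)) !nested_bracket calg_scaleE.
rewrite psiME !(infmx_gen FF').
exact: (quasi_Jacobi_trace A_A0 w_tai alpha_typed X_pt db_dbl db_typed db_qp).
Qed.

Section GroupInvariance.
Variable g : 'M[K]_N.
Hypothesis g_G : inG ty g.

Let cg_inv : [/\ tau ty (cmx g) = cmx (invmx g), tau ty (cmx (invmx g)) = cmx g,
  cmx g *m cmx (invmx g) = 1%:M & cmx (invmx g) *m cmx g = 1%:M].
Proof.
have [ig tig gi gg] := inG_inv alpha_typed g_G.
split; rewrite -?(map_tau alpha_typed cst) ?tig -?ig //.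
- by rewrite -map_mxM gi map_mx1.
- by rewrite -map_mxM gg map_mx1.
Qed.

Lemma Gact_point : typed_point e ty w cst
  (fun a => cmx (invmx g) *m X a *m cmx g).
Proof.
have [tg tg' gg gg'] := cg_inv; apply: (conj_point alpha_typed X_pt) => //.
have /(inGP alpha_typed)[bg _] := g_G.
by move=> i j ij; rewrite mxE bg // rmorph0.
Qed.

Lemma Gact_cmorph : cmorph (Gact g : O -> O).
Proof. exact: csubst_cmorph (rep_morph_compat alpha_typed Gact_point). Qed.

Lemma Gact_gen a i j : Gact g (x_ a i j) = (cmx (invmx g) *m X a *m cmx g) i j.
Proof. exact: (csubst_gen (rep_morph_compat alpha_typed Gact_point)). Qed.

Lemma map_Gact_X b : map_mx (Gact g) (X b) = cmx (invmx g) *m X b *m cmx g.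
Proof. by apply/matrixP=> i j; rewrite [LHS]mxE [X b i j]mxE Gact_gen. Qed.

(** Invariance needs this for conjugates of elementary matrices; [P] is constant, so the bracket
    passes to [X a]. *)
Lemma br_tr a (P : 'M[K]_N) b :
  map_mx (br (\tr (cmx P *m X a))) (X b) = De a (cmx P) b.
Proof.
apply/matrixP=> k l; rewrite [LHS]mxE [X b k l]mxE bra (cder_tr_cst _ _ (brd _)) map_br_X.
exact: (Delta_antisym_tr A_A0 w_tai alpha_typed X_pt db_dbl db_typed).
Qed.

Lemma map_entry (D : O -> O) (Z : M) i j : D (Z i j) = map_mx D Z i j.
Proof. by rewrite mxE. Qed.

Lemma br_Gact_gen a i j h : br (Gact g (x_ a i j)) (Gact g h) = Gact g (br (x_ a i j) h).
Proof.
have mG := Gact_cmorph; have [tg tg' _ _] := cg_inv.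
apply: (cder_ext (cder_comp (brd _) mG) (cmorph_comp_der (brd _) mG)) => -[[b k] l].
rewrite -[LHS]/(br (Gact g (x_ a i j)) (Gact g (x_ b k l))).
rewrite -[RHS]/(Gact g (br (x_ a i j) (x_ b k l))).
(* A transformed coordinate is the trace of [X a] against a conjugated elementary matrix, which is
   again constant. *)
rewrite brg !Gact_gen conj_entry !map_entry.
rewrite (map_cder_conj _ _ _ (brd _)).
have -> : cmx g *m delta_mx j i *m cmx (invmx g) = cmx (g *m delta_mx j i *m invmx g).
  by rewrite !map_mxM (map_delta cst).
rewrite br_tr -(map_delta cst).
have -> := map_gam_Delta alpha_typed X_pt db (cmorphD mG) (cmorphM mG) (cmorphC mG)
  map_Gact_X tg tg' a (delta_mx j i) b.
by rewrite !map_mxM.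
Qed.

Lemma br_Gact f h : br (Gact g f) (Gact g h) = Gact g (br f h).
Proof.
have mG := Gact_cmorph.
apply: (cder_ext (cder_comp (brd _) mG) (cmorph_comp_der (brd _) mG)) => -[[b k] l].
rewrite -[LHS]/(br (Gact g f) (Gact g (x_ b k l))).
rewrite -[RHS]/(Gact g (br f (x_ b k l))).
by rewrite bra br_Gact_gen -(cmorphN _ mG) -bra.
Qed.

End GroupInvariance.

Lemma bracket_quasi_poisson : quasi_poisson br.
Proof.
split; first exact: bracket_antisym_bider.
  by move=> g gG f h; apply: br_Gact.
by move=> d F F' FF' f g h; apply: quasi_Jacobi.
Qed.

End Bracket.
End Poisson.

Lemma cmorph_mulmx_entry (K : comNzRingType) (X Y : Type)
    (rel : expr K X -> expr K X -> Prop) (rel' : expr K Y -> expr K Y -> Prop)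
    (phi : calg rel -> calg rel') n (U V : 'M_n) i j : cmorph phi ->
  phi ((U *m V) i j) = (map_mx phi U *m map_mx phi V) i j.
Proof. by move=> m; rewrite -(map_cmorphM _ _ m) [RHS]mxE. Qed.

(** * The moment map *)
Section MomentElement.
Variables (K : numFieldType) (n : nat) (A : algType K) (e : 'I_n -> A).
Variables (ty : 'I_n -> gtype) (w : A -> A).
Hypotheses (A_A0 : A0_algebra e) (w_tai : typed_anti_involution ty e w).
Variable db : A -> A -> tensor A A.
Hypotheses (db_dbl : is_double_bracket e db) (db_typed : typed_double_bracket w db).
Implicit Types a b : A.

Definition moment_tens (s : 'I_n) (psi a : A) : tensor A A :=
  (a * e s) \ox psi - e s \ox (psi * a) + (a * psi) \ox e s - psi \ox (e s * a).

(** This makes [w] bijective, so every element can be written as an image under [w]. *)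
Lemma tai_pow4 a : w (w (w (w a))) = a.
Proof.
have hh : hA e ty * hA e ty = 1.
  have [e_ort e_sum] := A_A0; rewrite /hA /of_A0 mulr_suml -e_sum.
  apply: eq_bigr => s _; rewrite mulr_sumr (sum_single (i := s)) => [|t ts].
    by rewrite -scalerAl -scalerAr e_ort eqxx scalerA tsignE -signr_addb addbb scale1r.
  by rewrite -scalerAl -scalerAr e_ort eq_sym (negPf ts) !scaler0.
by rewrite !(wwE A_A0 w_tai) !mulrA hh mul1r -mulrA hh mulr1.
Qed.

(** Applying [w] to both factors and flipping exchanges the four terms in pairs of opposite sign.
    Thus [w psi] satisfies the equation expected of an inverse of [psi]. *)
Lemma moment_tens_w (k : K) s psi : (forall a, db psi a = k *: moment_tens s psi a) ->
  forall a, db (w psi) a = - k *: moment_tens s (w psi) a.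
Proof.
(* Typedness concerns brackets of two images under [w], so [b] is written as one. *)
move=> H b; rewrite -(tai_pow4 b); set a := w (w (w b)).
have wl := w_lin w_tai; have wwl := ww_islin wl; have fl := @tflip_islin K A.
have -> : db (w psi) (w a) = tflip (tlift (fun x y => w x \ox w y) (db psi a)).
  by rewrite db_typed tflipK.
rewrite H (islinZ _ _ wwl) (islinZ _ _ fl) scaleNr -scalerN; congr (_ *: _).
rewrite /moment_tens !(islinB _ _ wwl, islinD _ _ wwl) !(ww_tens wl).
rewrite !(islinB _ _ fl, islinD _ _ fl) !tflip_tens !(tai_mul w_tai) !(tai_idem w_tai).
rewrite !opprD !opprK.
move: (_ \ox _) (_ \ox _) (_ \ox _) (_ \ox _) => t1 t2 t3 t4.
by rewrite [RHS]addrC addrA -!addrA; congr (_ + _); rewrite addrCA [in RHS]addrC -?addrA.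
Qed.

Lemma e_comp (psi_ : 'I_n -> A) : (forall s, psi_ s = e s * psi_ s * e s) ->
  forall s, [/\ e s * psi_ s = psi_ s, psi_ s * e s = psi_ s,
    e s * (\sum_t psi_ t) = psi_ s & (\sum_t psi_ t) * e s = psi_ s].
Proof.
have [e_ort e_sum] := A_A0 => psiE s.
have ee : e s * e s = e s by rewrite e_ort eqxx.
have e1 : e s * psi_ s = psi_ s by rewrite psiE !mulrA ee.
have e2 : psi_ s * e s = psi_ s by rewrite psiE -!mulrA ee.
split=> //.
- rewrite mulr_sumr (sum_single (i := s)) // => t ts.
  by rewrite psiE !mulrA e_ort eq_sym (negPf ts) !mul0r.
- rewrite mulr_suml (sum_single (i := s)) // => t ts.
  by rewrite psiE -!mulrA e_ort (negPf ts) !mulr0.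
Qed.

Section Trace.
Variables (alpha : 'I_n -> nat) (S : comPzRingType) (cst : {rmorphism K -> S}).
Local Notation N := (\sum_s alpha s)%N.
Local Notation M := 'M[S]_N.
Variable X : A -> M.
Hypotheses (alpha_typed : typed_dim ty alpha) (X_pt : typed_point e ty w cst X).
Local Notation h2 := (cst 2^-1).

Lemma tr_emx_sum (I : finType) (F : I -> tensor A A) (P Q : M) :
  \tr (emx X (\sum_i F i) P *m Q) = \sum_i \tr (emx X (F i) P *m Q).
Proof.
apply: (big_morph (fun d => \tr (emx X d P *m Q))) => [x y|].
  by rewrite (emxD X_pt) mulmxDl mxtraceD.
by rewrite (emx0 X_pt) mul0mx mxtrace0.
Qed.

Lemma tr_emx_momF s psi a (P Q : M) :
  \tr (emx X (moment_tens s psi a) P *m Q) =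
  \tr (X a *m X (e s) *m P *m X psi *m Q) - \tr (X (e s) *m P *m (X psi *m X a) *m Q)
  + \tr (X a *m X psi *m P *m X (e s) *m Q) - \tr (X psi *m P *m (X (e s) *m X a) *m Q).
Proof.
rewrite /moment_tens !(emxD X_pt) !(emxN X_pt) !(emx_tens X_pt) !(XM X_pt).
by rewrite !mulmxDl !mxtraceD !mulNmx !mxtraceN.
Qed.

Lemma tr_emx_moment (psi_ : 'I_n -> A) (k : K) : (forall s, psi_ s = e s * psi_ s * e s) ->
  (forall s a, db (psi_ s) a = k *: moment_tens s (psi_ s) a) ->
  forall a (P Q : M), let Y := X (\sum_s psi_ s) in
  \tr (emx X (db (\sum_s psi_ s) a) P *m Q) =
  cst k * \tr (bproj (P *m Y + Y *m P) *m commX X a Q).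
Proof.
move=> psiE psi_mom a P Q Y.
rewrite (islin_sum _ _ _ (bilin_islinl a (db_bilin db_dbl))) tr_emx_sum.
rewrite /bproj mulmx_suml raddf_sum mulr_sumr; apply: eq_bigr => s _ /=.
rewrite psi_mom (emxZ X_pt) -scalemxAl mxtraceZ tr_emx_momF -(Xe X_pt).
have [_ _ e1 e2] := e_comp psiE s.
congr (_ * _); apply: tr_moment; rewrite /Y -(XM X_pt) ?e1 ?e2 //.
Qed.

(** By [moment_tens_w] the twisted half of the average enters with a minus sign, which makes the
    average the projection to the Lie algebra. *)
Lemma Delta_moment (psi_ : 'I_n -> A) : (forall s, psi_ s = e s * psi_ s * e s) ->
  (forall s a, db (psi_ s) a = 2^-1 *: moment_tens s (psi_ s) a) ->
  forall a i j k l, let Y := X (\sum_s psi_ s) in let P := delta_mx j i in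
  Delta ty w cst X db (\sum_s psi_ s) P a k l =
  h2 * \tr (projg ty h2 (P *m Y + Y *m P) *m commX X a (delta_mx l k)).
Proof.
move=> psiE psi_mom a i j k l Y P.
have wl := w_lin w_tai.
have wpsiE s : w (psi_ s) = e s * w (psi_ s) * e s.
  by rewrite {1}psiE !(tai_mul w_tai) !(tai_idem w_tai) mulrA.
have wpsi_mom s := moment_tens_w (psi_mom s).
have wsum : w (\sum_s psi_ s) = \sum_s w (psi_ s) by apply: islin_sum.
rewrite -(tr_mul_delta (Delta ty w cst X db _ P a)) /Delta -scalemxAl mxtraceZ.
congr (_ * _); rewrite mulmxDl mxtraceD wsum.
rewrite (tr_emx_moment psiE psi_mom) (tr_emx_moment wpsiE wpsi_mom) -wsum (Xw X_pt) -/Y.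
rewrite /projg (tau_bproj alpha_typed) tauD !(tauM alpha_typed).
rewrite -scalemxAl mxtraceZ mulmxBl mxtraceD mxtraceN mulrDr rmorphN mulNr mulrN.
by rewrite [tau ty Y *m _ + _]addrC.
Qed.

Lemma Casimir_tr d (F F' : d.-tuple 'M[K]_N) (U V : M) : dual_bases ty F F' ->
  \sum_a \tr (map_mx cst (tnth F a) *m U) * \tr (map_mx cst (tnth F' a) *m V) =
  \tr (projg ty h2 U *m V).
Proof.
move=> FF'; rewrite -(Casimir alpha_typed cst FF') mulmx_suml raddf_sum.
by apply: eq_bigr => a _ /=; rewrite -scalemxAl mxtraceZ.
Qed.

Lemma Casimir_moment d (F F' : d.-tuple 'M[K]_N) (Y V : M) p q : dual_bases ty F F' ->
  \sum_b \tr (map_mx cst (tnth F' b) *m V) *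
      ((Y *m map_mx cst (tnth F b)) p q + (map_mx cst (tnth F b) *m Y) p q) =
  \tr (projg ty h2 (delta_mx q p *m Y + Y *m delta_mx q p) *m V).
Proof.
move=> FF'; rewrite -(Casimir_tr _ _ FF'); apply: eq_bigr => b _.
by rewrite -tr_comm_entry [in RHS]mxE mulrC.
Qed.

Lemma bdiag_point (psi_ : 'I_n -> A) : (forall s, psi_ s = e s * psi_ s * e s) ->
  bdiag (X (\sum_s psi_ s)).
Proof.
move=> psiE; suff -> : X (\sum_s psi_ s) = bproj (X (\sum_s psi_ s)).
  exact: bproj_bdiag.
rewrite {1}(X_sum X_pt) /bproj; apply: eq_bigr => s _.
have [_ e2 e3 _] := e_comp psiE s.
by rewrite -(Xe X_pt) -!(XM X_pt) e3 e2.
Qed.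

Lemma inG_point (psi_ : 'I_n -> A) : (forall s, psi_ s = e s * psi_ s * e s) ->
  w (\sum_s psi_ s) * (\sum_s psi_ s) = 1 -> inG ty (X (\sum_s psi_ s)).
Proof.
move=> psiE psi1; apply/(inGP alpha_typed); split; first exact: bdiag_point.
by rewrite -(Xw X_pt) -(XM X_pt) psi1 (X1 A_A0 X_pt).
Qed.

End Trace.
End MomentElement.

(** * The coordinate ring of the group and its invariant vector fields *)

Section GroupCoordinates.
Variables (K : fieldType) (n : nat) (ty : 'I_n -> gtype) (alpha : 'I_n -> nat).
Hypothesis alpha_typed : typed_dim ty alpha.
Local Notation N := (\sum_s alpha s)%N.
Local Notation grel := (@group_rel K n ty alpha).
Local Notation GO := (groupO K ty alpha).
Local Notation G := (Gcoord K ty alpha).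
Local Notation gcst := (ccst grel).

Lemma group_morph_compat (Y : Type) (rel' : expr K Y -> expr K Y -> Prop)
    (Z : 'M[calg rel']_N) : inG ty Z ->
  forall p q, grel p q -> ceval (ccst rel') (fun x => Z x.1 x.2) p =
                          ceval (ccst rel') (fun x => Z x.1 x.2) q.
Proof.
move=> /(inGP alpha_typed)[bZ /(Theta_form alpha_typed) ZZ] p q [i j ij|i j] /=.
  by rewrite bZ // rmorph0.
rewrite -[RHS]/(ccst rel' (Theta ty alpha K i j)) (map_ThetaE alpha_typed).
rewrite -[in RHS]ZZ mulmx3E cevalS ?rmorph0 //; apply: eq_bigr => p' _.
rewrite cevalS ?rmorph0 //; apply: eq_bigr => q' _ /=.
by rewrite (map_ThetaE alpha_typed).
Qed.

Lemma gcst_Theta i j : gcst (Theta ty alpha K i j) = Theta ty alpha GO i j.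
Proof. exact: map_ThetaE. Qed.

Lemma GcoordE i j : G i j = cgen grel (i, j).
Proof. by rewrite mxE. Qed.

Lemma group_der_compat (D : 'M[GO]_N) : bdiag D ->
  D^T *m Theta ty alpha GO *m G + G^T *m Theta ty alpha GO *m D = 0 ->
  forall p q, grel p q ->
    cdeval (@ccst _ _ grel) (@cgen _ _ grel) (fun x => D x.1 x.2) p =
    cdeval (@ccst _ _ grel) (@cgen _ _ grel) (fun x => D x.1 x.2) q.
Proof.
move=> bD DG p q [i j ij|i j] /=; first exact: bD.
have := congr1 (fun U : 'M[GO]_N => U i j) DG; rewrite mxE !mulmx3E mxE => <-.
rewrite cdevalS -big_split; apply: eq_bigr => p' _ /=.
rewrite cdevalS -big_split; apply: eq_bigr => q' _ /=.
by rewrite !GcoordE mulr0 addr0 gcst_Theta.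
Qed.

Lemma Gcoord_inG : inG ty G.
Proof.
apply/(inGP alpha_typed); split.
  by move=> i j ij; rewrite mxE; apply/cpiP/ceq_rel/group_diag.
apply/(Theta_form alpha_typed)/matrixP => i j.
have /cpiP := ceq_rel (@group_form K n ty alpha i j).
rewrite !cpiE /= cevalS // gcst_Theta => <-; rewrite mulmx3E.
apply: eq_bigr => p _; rewrite cevalS //; apply: eq_bigr => q _ /=.
by rewrite !GcoordE gcst_Theta.
Qed.

Section VectorFields.
Variable xi : 'M[K]_N.
Hypothesis xi_Lie : inLie ty xi.
Local Notation cxi := (map_mx gcst xi).
Local Notation Th := (Theta ty alpha GO).

Let xi_facts : bdiag cxi /\ cxi^T *m Th + Th *m cxi = 0.
Proof.
have /(inLieP alpha_typed)[bx tx] := xi_Lie; split.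
  by move=> i j ij; rewrite mxE bx // rmorph0.
by apply/(Lie_form alpha_typed); rewrite -(map_tau alpha_typed) tx map_mxN.
Qed.

Let G_facts : bdiag G /\ G^T *m Th *m G = Th.
Proof.
by have /(inGP alpha_typed)[bG /(Theta_form alpha_typed) GG] := Gcoord_inG.
Qed.

Let vfL_compat : forall p q, grel p q ->
    cdeval (@ccst _ _ grel) (@cgen _ _ grel) (fun x => (G *m cxi) x.1 x.2) p =
    cdeval (@ccst _ _ grel) (@cgen _ _ grel) (fun x => (G *m cxi) x.1 x.2) q.
Proof.
have [bx tx] := xi_facts; have [bG GG] := G_facts.
by apply: group_der_compat; [exact: bdiag_mul|exact: form_der_mull].
Qed.

Let vfR_compat : forall p q, grel p q ->
    cdeval (@ccst _ _ grel) (@cgen _ _ grel) (fun x => (cxi *m G) x.1 x.2) p =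
    cdeval (@ccst _ _ grel) (@cgen _ _ grel) (fun x => (cxi *m G) x.1 x.2) q.
Proof.
have [bx tx] := xi_facts; have [bG GG] := G_facts.
by apply: group_der_compat; [exact: bdiag_mul|exact: form_der_mulr].
Qed.

Lemma vfL_der : cder id (vfL xi : GO -> GO).
Proof. exact: cderiv_cder vfL_compat. Qed.
Lemma vfL_gen i j : vfL xi (cgen grel (i, j)) = (G *m cxi) i j.
Proof. exact: cderiv_gen vfL_compat (i, j). Qed.
Lemma vfR_der : cder id (vfR xi : GO -> GO).
Proof. exact: cderiv_cder vfR_compat. Qed.
Lemma vfR_gen i j : vfR xi (cgen grel (i, j)) = (cxi *m G) i j.
Proof. exact: cderiv_gen vfR_compat (i, j). Qed.

End VectorFields.
End GroupCoordinates.

(** * The moment map condition on the representation space *)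

Section MomentMap.
Variables (K : numFieldType) (n : nat) (A : algType K) (e : 'I_n -> A).
Variables (ty : 'I_n -> gtype) (w : A -> A) (alpha : 'I_n -> nat).
Hypotheses (A_A0 : A0_algebra e) (w_tai : typed_anti_involution ty e w).
Hypothesis alpha_typed : typed_dim ty alpha.

Local Notation N := (\sum_s alpha s)%N.
Local Notation O := (repO ty alpha e w).
Local Notation GO := (groupO K ty alpha).
Local Notation rel := (@rep_rel K n ty alpha A e w).
Local Notation grel := (@group_rel K n ty alpha).
Local Notation cst := (ccst rel).
Local Notation X := (Xmx ty alpha e w).
Local Notation x_ := (rcoord ty (alpha := alpha) e w).
Local Notation cmx := (map_mx cst).
Local Notation X_pt := (X_point e w alpha_typed).

Variable db : A -> A -> tensor A A.
Hypotheses (db_dbl : is_double_bracket e db) (db_typed : typed_double_bracket w db).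
Local Notation De := (Delta ty w cst X db).
Variable br : O -> O -> O.
Hypotheses (brd : forall f, cder id (br f)) (bra : forall f g, br f g = - br g f).
Hypothesis brg : forall a b i j k l, br (x_ a i j) (x_ b k l) = De a (delta_mx j i) b k l.

Section Comorphism.
Variable Y : 'M[O]_N.
Hypothesis Y_G : inG ty Y.

Lemma comorphism_cmorph : cmorph (comorphism Y : GO -> O).
Proof. exact: csubst_cmorph (group_morph_compat alpha_typed Y_G). Qed.

Lemma comorphism_gen p q : comorphism Y (cgen grel (p, q)) = Y p q.
Proof. exact: csubst_gen (group_morph_compat alpha_typed Y_G) (p, q). Qed.

Lemma map_comorphism_Gcoord : map_mx (comorphism Y) (Gcoord K ty alpha) = Y.
Proof.
apply/matrixP=> p q; transitivity (comorphism Y (cgen grel (p, q))).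
  by rewrite !mxE.
exact: comorphism_gen.
Qed.

Lemma comorphism_vfL xi p q : inLie ty xi ->
  comorphism Y (vfL xi (cgen grel (p, q))) = (Y *m cmx xi) p q.
Proof.
move=> xiL; have m := comorphism_cmorph.
rewrite (vfL_gen alpha_typed xiL) (cmorph_mulmx_entry _ _ _ _ m).
by rewrite map_comorphism_Gcoord (map_cmorph_cst _ m).
Qed.

Lemma comorphism_vfR xi p q : inLie ty xi ->
  comorphism Y (vfR xi (cgen grel (p, q))) = (cmx xi *m Y) p q.
Proof.
move=> xiL; have m := comorphism_cmorph.
rewrite (vfR_gen alpha_typed xiL) (cmorph_mulmx_entry _ _ _ _ m).
by rewrite map_comorphism_Gcoord (map_cmorph_cst _ m).
Qed.

End Comorphism.

Section Element.
Variable Phi_ : 'I_n -> A.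
Hypothesis PhiE : forall s, Phi_ s = e s * Phi_ s * e s.
Hypothesis Phi_mom : forall s a, db (Phi_ s) a = 2^-1 *: moment_tens e s (Phi_ s) a.
Local Notation Phi := (\sum_s Phi_ s).
Hypothesis wPhi : w Phi * Phi = 1.
Variables (d : nat) (F F' : d.-tuple 'M[K]_N).
Hypothesis FF' : dual_bases ty F F'.
Local Notation phi := (comorphism (X Phi) : GO -> O).

Lemma X_Phi_inG : inG ty (X Phi).
Proof. exact: (@inG_point _ _ _ _ _ _ A_A0 _ O cst X alpha_typed X_pt _ PhiE wPhi). Qed.

(** Both sides are derivations in [f]; on coordinates the Casimir identity splits the projection of
    [Delta_moment] along the dual bases. *)
Lemma moment_gen p q f : br (X Phi p q) f =
  cst 2^-1 * \sum_b inf_act (tnth F' b) f *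
    ((X Phi *m cmx (tnth F b)) p q + (cmx (tnth F b) *m X Phi) p q).
Proof.
have LF' b : inLie ty (tnth F' b) by case: FF'.
pose D b f : O := ((X Phi *m cmx (tnth F b)) p q + (cmx (tnth F b) *m X Phi) p q)
  * inf_act (tnth F' b) f.
have dD : cder id (fun f => cst 2^-1 * \sum_b D b f).
  by apply/cder_lscale/cder_bigsum => b; apply/cder_lscale/(inf_act_der _ _ alpha_typed (LF' b)).
have -> : \sum_b inf_act (tnth F' b) f *
    ((X Phi *m cmx (tnth F b)) p q + (cmx (tnth F b) *m X Phi) p q) = \sum_b D b f.
  by apply: eq_bigr => b _; apply: mulrC.
apply: (cder_ext (brd _) dD) => -[[a k] l].
transitivity (br (x_ Phi p q) (x_ a k l)); first by rewrite [X Phi p q]mxE.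
rewrite brg (Delta_moment A_A0 w_tai db_dbl db_typed alpha_typed X_pt PhiE Phi_mom).
congr (_ * _); rewrite -(Casimir_moment _ alpha_typed _ _ _ _ FF').
apply: eq_bigr => b _.
by rewrite /D mulrC -(inf_act_gen _ _ alpha_typed (LF' b)).
Qed.

(** Both sides are derivations in [H] along the comorphism, so the matrix coordinates of the group
    suffice, and there [moment_gen] applies. *)
Lemma moment_condition H f : br (phi H) f =
  2^-1 *: \sum_a phi (vfL (tnth F a) H + vfR (tnth F a) H) * inf_act (tnth F' a) f.
Proof.
have m := comorphism_cmorph X_Phi_inG.
have LF b : inLie ty (tnth F b) by apply: Lie_F FF' b.
rewrite calg_scaleE bra.
have -> : \sum_a phi (vfL (tnth F a) H + vfR (tnth F a) H) * inf_act (tnth F' a) f =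
    \sum_a inf_act (tnth F' a) f * (phi (vfL (tnth F a) H) + phi (vfR (tnth F a) H)).
  by apply: eq_bigr => a _; rewrite mulrC (cmorphD m).
pose D b H : O := inf_act (tnth F' b) f *
  (phi (vfL (tnth F b) H) + phi (vfR (tnth F b) H)).
have dD : cder phi (fun H => cst 2^-1 * \sum_b D b H).
  apply/cder_lscale/cder_bigsum => b; apply/cder_lscale.
  exact: cder_add (cmorph_comp_der (vfL_der alpha_typed (LF b)) m)
    (cmorph_comp_der (vfR_der alpha_typed (LF b)) m).
apply: (cder_ext (cder_opp (cder_comp (brd f) m)) dD) => -[p q].
rewrite /= -bra (comorphism_gen X_Phi_inG) moment_gen /D.
congr (_ * _); apply: eq_bigr => b _.
by rewrite (comorphism_vfL X_Phi_inG _ _ (LF b)) (comorphism_vfR X_Phi_inG _ _ (LF b)).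
Qed.

End Element.

Lemma moment_map_X Phi : double_moment_map e db Phi -> Phi * w Phi = 1 ->
  moment_map br (X Phi).
Proof.
move=> [[Psi [PhiK PsiK]] [Phi_ [E PhiE Phi_mom]]] Phi1; rewrite {}E in PhiK PsiK Phi1 *.
(* A right inverse of the invertible [Phi] is also a left inverse. *)
have wPhi : w (\sum_s Phi_ s) * \sum_s Phi_ s = 1.
  by rewrite -[RHS]PsiK -[in RHS](mulr1 Psi) -Phi1 mulrA PsiK mul1r.
split; first exact: X_Phi_inG PhiE wPhi.
- by move=> g g_G; apply: map_Gact_X.
- by move=> d F F' FF' H f; apply: moment_condition.
Qed.

End MomentMap.

(** * Normalization of the moment map *)
Section LinearFunctional.
Variables (K : fieldType) (V : lmodType K) (x : V).
Hypothesis x0 : x != 0.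

(** The condition admits the empty set, which is the union of the empty chain in Zorn's lemma. *)
Let avoids (B : set V) := (forall k u v, B u -> B v -> B (k *: u + v)) /\ ~ B x.

Let maximal_avoiding : exists2 B : set V, avoids B /\ B 0 &
  forall y, ~ B y -> exists2 k, B (k *: y - x) & k != 0.
Proof.
have [F FP Ftot|B [[Bl Bx] Bmax]] := @Zorn_bigcup V avoids.
  split=> [k u v [C FC Cu] [D FD Dv]|[C FC Cx]]; last by have [] := FP C FC.
  have [CD|DC] := Ftot _ _ FC FD.
    by exists D => //; apply: (FP _ FD).1 => //; apply: CD.
  by exists C => //; apply: (FP _ FC).1 => //; apply: DC.
(* If [0] were missing, it could be adjoined, against maximality. *)
have B0 : B 0.
  apply: contrapT => nB0; apply: (Bmax [set v | B v \/ v = 0]%classic _ _).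
    by split=> [v Bv|sub]; [left|apply/nB0/sub; right].
  split=> [k u v|[//|/eqP]]; last by rewrite (negPf x0).
  move=> [Bu|->] [Bv|->].
  - by left; apply: Bl.
  - rewrite addr0; have [->|k0] := eqVneq k 0; first by right; rewrite scale0r.
    left; have -> : k *: u = (k - 1) *: u + u by rewrite scalerBl scale1r subrK.
    exact: Bl.
  - by left; rewrite scaler0 add0r.
  - by right; rewrite scaler0 addr0.
exists B => // y nBy; apply: contrapT => H.
(* Otherwise the span of [B] and [y] would be larger and still avoid [x]. *)
apply: (Bmax [set v | exists k, B (v - k *: y)]%classic _ _).
  split=> [v Bv|sub]; first by exists 0; rewrite scale0r subr0.
  by apply/nBy/sub; exists 1; rewrite scale1r subrr.
have BN v : B v -> B (- v) by move=> Bv; rewrite -[- v]addr0 -scaleN1r; apply: Bl.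
split=> [k u v [k1 Bu] [k2 Bv]|[k Bk]].
  exists (k * k1 + k2); rewrite scalerDl -scalerA opprD addrACA -scalerBr.
  exact: Bl.
apply: H; exists k; first by rewrite -opprB; apply: BN.
by apply/eqP => k0; apply: Bx; rewrite -[x]subr0 -(scale0r y) -k0.
Qed.

(** [V] may be infinite dimensional. A maximal subspace avoiding [x] is a complement of the line of
    [x], and [f] is the coordinate along that line. *)
Lemma linear_functional : exists f : V -> K^o, islin f /\ f x = 1.
Proof.
have [B [[Bl Bx] B0] Bmax] := maximal_avoiding.
have BZ k v : B v -> B (k *: v) by move=> Bv; rewrite -[_ *: _]addr0; apply: Bl.
have BD u v : B u -> B v -> B (u + v) by move=> Bu Bv; rewrite -[u]scale1r; apply: Bl.
have ex y : exists k, B (y - k *: x).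
  have [By|/Bmax[k Bk k0]] := pselect (B y); first by exists 0; rewrite scale0r subr0.
  by exists k^-1; have := BZ k^-1 _ Bk; rewrite scalerBr scalerA mulVf ?scale1r.
have [f fP] := choice ex.
have uniq k : B (k *: x) -> k = 0.
  move=> Bk; have [//|k0] := eqVneq k 0; case: Bx.
  by have := BZ k^-1 _ Bk; rewrite scalerA mulVf ?scale1r.
have f_eq y k : B (y - k *: x) -> f y = k.
  move=> Bk; apply/eqP; rewrite -subr_eq0; apply/eqP/uniq.
  have -> : (f y - k) *: x = (-1) *: (y - f y *: x) + (y - k *: x).
    by rewrite scaleN1r opprB addrA subrK scalerBl.
  exact: Bl.
exists f; split=> [k u v|]; apply: f_eq; last by rewrite scale1r subrr.
rewrite scalerDl -scalerA opprD addrACA -scalerBr; exact: Bl.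
Qed.

End LinearFunctional.

Import Num.Theory.

Section Normalization.
Variables (K : numClosedFieldType) (n : nat) (A : algType K) (e : 'I_n -> A).
Variables (ty : 'I_n -> gtype) (w : A -> A).
Hypotheses (A_A0 : A0_algebra e) (w_tai : typed_anti_involution ty e w).
Variable db : A -> A -> tensor A A.
Hypotheses (db_dbl : is_double_bracket e db) (db_typed : typed_double_bracket w db).

Section Component.
Variables (s : 'I_n) (psi : A).
Hypotheses (psiE : psi = e s * psi * e s) (psi_mom : forall a, db psi a = 2^-1 *: moment_tens e s psi a).
Local Notation psi' := (psi * w psi).

Let ee : e s * e s = e s.
Proof. by have [e_ort _] := A_A0; rewrite e_ort eqxx. Qed.
Let epsi : e s * psi = psi. Proof. by rewrite psiE !mulrA ee. Qed.
Let psie : psi * e s = psi. Proof. by rewrite psiE -!mulrA ee. Qed.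
Let ew : e s * w psi = w psi.
Proof. by rewrite -{1}(tai_idem w_tai s) -(tai_mul w_tai) psie. Qed.
Let we : w psi * e s = w psi.
Proof. by rewrite -{1}(tai_idem w_tai s) -(tai_mul w_tai) epsi. Qed.

(** The moment equations of [psi] and [w psi] have opposite signs, so in the Leibniz rule the mixed
    terms, with [psi] and [w psi] in different factors, cancel. *)
Lemma db_mul_w a : db psi' a = 2^-1 *:
  ((a * psi') \ox e s - psi' \ox (e s * a) - (a * e s) \ox psi' + e s \ox (psi' * a)).
Proof.
have il := @inner_islin K A; rewrite (db_leibl db_dbl) psi_mom.
rewrite (moment_tens_w A_A0 w_tai db_typed psi_mom) !(islinZ _ _ (il _ _)) scaleNr -scalerBr.
congr (_ *: _); rewrite /moment_tens !(islinB _ _ (il _ _), islinD _ _ (il _ _)) !inner_tens.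
rewrite !mul1r !mulr1 -!mulrA ew psie [psi * (e s * a)]mulrA psie.
move: (_ \ox _) (_ \ox _) (_ \ox _) (_ \ox _) (_ \ox _) (_ \ox _) => t6 t5 t4 t3 t2 t1.
rewrite -[t1 - t2 + t3 - t4]addrA -[t5 - t6 + t1 - t2]addrA [t1 - t2 + _]addrC.
by rewrite [t5 - t6 + _]addrC addrKA opprD opprK addrA.
Qed.

(** The moment map equations of [psi] and of [psi'] both compute
    [db psi psi'] up to the flip. *)
Lemma mul_w_tens : (psi' * psi) \ox e s = psi \ox psi'.
Proof.
have fl := @tflip_islin K A.
have := db_antisym db_dbl psi psi'; rewrite psi_mom db_mul_w (islinZ _ _ fl) -scalerN.
have h0 : 2^-1 != 0 :> K by rewrite invr_eq0 Num.Theory.pnatr_eq0.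
move=> /(scalerI h0); rewrite /moment_tens !(islinB _ _ fl, islinD _ _ fl) !tflip_tens.
rewrite psie epsi -!mulrA we [e s * _]mulrA epsi.
move: (_ \ox _) (_ \ox _) (_ \ox _) (_ \ox _) => t4 t3 t2 t1.
have -> : - (t2 - t4 - t1 + t3) = t1 - t2 - (t3 - t4).
  by rewrite [t2 - t4 - t1]addrAC -[_ + t3]addrA [- t4 + t3]addrC opprD opprB.
(* Two terms agree on both sides; the difference of the other two equals its own opposite, and 2 is
   invertible. *)
rewrite -[t1 - t2 + t3 - t4]addrA => /addrI/eqP; rewrite -addr_eq0 -mulr2n -scaler_nat.
by rewrite scaler_eq0 Num.Theory.pnatr_eq0 /= subr_eq0 => /eqP.
Qed.

(** Contracting the first factor of [mul_w_tens] with a functional equal to 1 at [psi] leaves [psi']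
    on one side and a multiple of [e s] on the other. *)
Lemma mul_w_scalar : psi != 0 -> exists k, psi' = k *: e s.
Proof.
move=> /linear_functional[f [fl f1]]; exists (f (psi' * psi)).
have fb : bilin (fun u v : A => f u *: v).
  split=> [k u u' v|k u v v'].
    by rewrite fl scalerDl scalerA.
  by rewrite scalerDr !scalerA [_ * k]mulrC.
have := congr1 (tlift (fun u v : A => f u *: v)) mul_w_tens.
by rewrite !tliftE // f1 scale1r => ->.
Qed.

End Component.

Lemma of_A0M (c d : 'I_n -> K) : of_A0 e c * of_A0 e d = of_A0 e (fun s => c s * d s).
Proof.
have [e_ort e_sum] := A_A0; rewrite /of_A0 mulr_suml; apply: eq_bigr => s _.
rewrite mulr_sumr (sum_single (i := s)) => [|t ts]; rewrite -scalerAl -scalerAr e_ort.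
  by rewrite eqxx scalerA.
by rewrite eq_sym (negPf ts) !scaler0.
Qed.

Lemma moment_map_normalization Phi : double_moment_map e db Phi ->
  exists c : 'I_n -> K,
    [/\ forall s, c s != 0,
        double_moment_map e db (of_A0 e c * Phi) &
        of_A0 e c * Phi * w (of_A0 e c * Phi) = 1].
Proof.
have [e_ort e_sum] := A_A0; have wl := w_lin w_tai.
move=> [[Psi [PhiK PsiK]] [Phi_ [E PhiE Phi_mom]]].
have comp := e_comp A_A0 PhiE; rewrite -E in comp.
have [s|k kP] := @choice _ _ (fun s (k : K) => k != 0 /\ Phi_ s * w (Phi_ s) = k *: e s) _.
  have [e1 e2 e3 e4] := comp s.
  (* If [e s = 0] the component vanishes and any nonzero scalar serves. *)
  have [es0|es0] := eqVneq (e s) 0.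
    by exists 1; rewrite -e1 es0 !mul0r scaler0 oner_neq0.
  have Phi0 : Phi_ s != 0.
    apply: contra_neq es0 => Phi0.
    by rewrite -[LHS]mul1r -PsiK -mulrA e4 Phi0 mulr0.
  have [k kE] := mul_w_scalar (PhiE s) (Phi_mom s) Phi0; exists k; split=> //.
  (* A zero scalar would give [w (Phi_ s) = 0], because [Phi] is invertible, and then [Phi_ s = 0]
     by [tai_pow4]. *)
  apply: contra_neq Phi0 => k0; rewrite {}k0 scale0r in kE.
  have we : e s * w (Phi_ s) = w (Phi_ s).
    by rewrite -{1}(tai_idem w_tai s) -(tai_mul w_tai) e2.
  rewrite -(tai_pow4 A_A0 w_tai (Phi_ s)) -we -[e s]mul1r -PsiK -(mulrA Psi) e4 -mulrA kE mulr0.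
  by rewrite !(islin0 wl).
(* Rescaling [Phi_ s] by [c s] multiplies [Phi_ s * w (Phi_ s)] by the square of [c s], whence the
   inverse square root. *)
pose c s := (sqrtC (k s))^-1.
have c0 s : c s != 0 by rewrite invr_eq0 Num.Theory.sqrtC_eq0; case: (kP s).
have cPhiE : of_A0 e c * Phi = \sum_s c s *: Phi_ s.
  rewrite /of_A0 mulr_suml; apply: eq_bigr => s _.
  by rewrite -scalerAl; case: (comp s) => _ _ -> _.
exists c; split=> //.
- split.
    have cc (d d' : 'I_n -> K) : (forall s, d s * d' s = 1) -> of_A0 e d * of_A0 e d' = 1.
      move=> dd; rewrite of_A0M /of_A0 -e_sum; apply: eq_bigr => s _.
      by rewrite dd scale1r.
    exists (Psi * of_A0 e (fun s => (c s)^-1)); split.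
      rewrite mulrA -(mulrA _ Phi) PhiK mulr1; apply: cc => s; exact: mulfV.
    rewrite mulrA -(mulrA Psi) cc ?mulr1 // => s; exact: mulVf.
  exists (fun s => c s *: Phi_ s); split=> // [s|s a].
    by rewrite -scalerAr -scalerAl -PhiE.
  rewrite (islinZ _ _ (bilin_islinl a (db_bilin db_dbl))) Phi_mom !scalerA mulrC -scalerA.
  by congr (_ *: _); rewrite -!(scalerAl, scalerAr) !(tensZl, tensZr) -!(scalerBr, scalerDr).
- rewrite cPhiE (islin_sum _ _ _ wl) mulr_suml -e_sum; apply: eq_bigr => s _.
  rewrite mulr_sumr (sum_single (i := s)) => [|t ts]; rewrite (islinZ _ _ wl) -scalerAl -scalerAr.
    have [k0 ->] := kP s; rewrite !scalerA -[RHS]scale1r; congr (_ *: _).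
    by rewrite /c -invfM -expr2 Num.Theory.sqrtCK mulVf.
  have [_ e2 _ _] := comp s; have [f1 f2 _ _] := comp t.
  rewrite -e2 -f2 (tai_mul w_tai) (tai_idem w_tai) mulrA -(mulrA _ (e s)) e_ort.
  by rewrite eq_sym (negPf ts) mulr0 mul0r !scaler0.
Qed.

End Normalization.

Theorem theorem5p12 (R : realType) (n : nat) (A : algType R[i])
    (e : 'I_n -> A) (ty : 'I_n -> gtype) (w : A -> A)
    (db : A -> A -> tensor A A) (alpha : 'I_n -> nat)
    (A_fg : finitely_generated A)
    (A_A0 : A0_algebra e)
    (w_tai : typed_anti_involution ty e w)
    (db_dbl : is_double_bracket e db)
    (db_typed : typed_double_bracket w db)
    (db_qp : double_quasi_poisson e db)
    (alpha_typed : typed_dim ty alpha) :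
  exists br : repO ty alpha e w -> repO ty alpha e w -> repO ty alpha e w,
    [/\ antisym_biderivation br,
        bracket_formula db br,
        (forall br' : repO ty alpha e w -> repO ty alpha e w -> repO ty alpha e w,
           antisym_biderivation br' -> bracket_formula db br' -> br' =2 br),
        quasi_poisson br &
        forall Phi : A, double_moment_map e db Phi ->
          (exists c : 'I_n -> R[i],
             [/\ forall s, c s != 0,
                 double_moment_map e db (of_A0 e c * Phi) &
                 of_A0 e c * Phi * w (of_A0 e c * Phi) = 1]) /\
          (Phi * w Phi = 1 -> moment_map br (Xmx ty alpha e w Phi))].
Proof.
have [br [brd bra brg]] := bracket_exists A_A0 w_tai alpha_typed db_dbl db_typed.
have ab := bracket_antisym_bider brd bra.
have bf : bracket_formula db br by apply/(bracket_formulaE alpha_typed).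
exists br; split=> //.
- by move=> br' ab' bf'; apply: (bracket_unique ab bf ab' bf').
- exact: (bracket_quasi_poisson A_A0 w_tai alpha_typed db_dbl db_typed db_qp brd bra brg).
- move=> Phi PhiM; split; first exact: (moment_map_normalization A_A0 w_tai db_dbl db_typed PhiM).
  exact: (moment_map_X A_A0 w_tai alpha_typed db_dbl db_typed brd bra brg PhiM).
Qed.
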